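(* Let $\mathcal{C}$ and $\mathcal{D}$ be semisimple tensor categories with spectrum sets $S$ and $T$, and let $\begin{bmatrix} x\,y\\ z\end{bmatrix}$ and $a_{x,y,z,w}$ ($x,y,z,w\in S*T$) be the triangular vector spaces and the associativity transformations of the free product, defined in the context. Then the family $\{a_{x,y,z,w}\}$ satisfies the pentagonal relation: for all $s,t,u,v,w\in S*T$ the following two composite isomorphisms from $$\bigoplus_{p,q\in S*T}\begin{bmatrix} s\,t\\ p\end{bmatrix}\otimes\begin{bmatrix} p\,u\\ q\end{bmatrix}\otimes\begin{bmatrix} q\,v\\ w\end{bmatrix}\quad\text{to}\quad \bigoplus_{p,q\in S*T}\begin{bmatrix} u\,v\\ p\end{bmatrix}\otimes\begin{bmatrix} t\,p\\ q\end{bmatrix}\otimes\begin{bmatrix} s\,q\\ w\end{bmatrix}$$ coincide (tensor factors being permuted by the flip where needed): (A) apply $a_{p,u,v,w}$ to the factors $\begin{bmatrix} p\,u\\ q\end{bmatrix}\otimes\begin{bmatrix} q\,v\\ w\end{bmatrix}$ (summed over $q$), obtaining $\bigoplus_{p,r}\begin{bmatrix} s\,t\\ p\end{bmatrix}\otimes\begin{bmatrix} u\,v\\ r\end{bmatrix}\otimes\begin{bmatrix} p\,r\\ w\end{bmatrix}$, and then apply $a_{s,t,r,w}$ to $\begin{bmatrix} s\,t\\ p\end{bmatrix}\otimes\begin{bmatrix} p\,r\\ w\end{bmatrix}$ (summed over $p$); (B) apply $a_{s,t,u,q}$ to $\begin{bmatrix} s\,t\\ p\end{bmatrix}\otimes\begin{bmatrix}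 p\,u\\ q\end{bmatrix}$ (summed over $p$), obtaining $\bigoplus_{p',q}\begin{bmatrix} t\,u\\ p'\end{bmatrix}\otimes\begin{bmatrix} s\,p'\\ q\end{bmatrix}\otimes\begin{bmatrix} q\,v\\ w\end{bmatrix}$, then apply $a_{s,p',v,w}$ to the last two factors (summed over $q$), obtaining $\bigoplus_{p',q'}\begin{bmatrix} t\,u\\ p'\end{bmatrix}\otimes\begin{bmatrix} p'\,v\\ q'\end{bmatrix}\otimes\begin{bmatrix} s\,q'\\ w\end{bmatrix}$, and then apply $a_{t,u,v,q'}$ to the first two factors (summed over $p'$).
   Context: A semisimple tensor category is a $\mathbb{C}$-linear tensor category whose unit object is simple and in which every object is isomorphic to a finite direct sum of simple objects (with finite-dimensional hom-spaces, so that $\mathrm{End}(x)=\mathbb{C}$ for $x$ simple). Its spectrum set is a set of representatives of the isomorphism classes of simple objects, containing the unit object, denoted $1$. Base data. For $a,b,c,d$ all in $S$ (or all in $T$; the unit $1$ belongs to both) put $\begin{bmatrix} a\,b\\ c\end{bmatrix}=\mathrm{Hom}(a\otimes b,c)$, and identify $\begin{bmatrix} 1\,b\\ c\end{bmatrix}=\mathbb{C}\delta_{b,c}$, $\begin{bmatrix} a\,1\\ c\end{bmatrix}=\mathbb{C}\delta_{a,c}$ by means of the unit constraints. Put $L_0(a,b,c;d)=\bigoplus_u\begin{bmatrix} a\,b\\ u\end{bmatrix}\otimes\begin{bmatrix} u\,c\\ d\end{bmatrix}$ and $R_0(a,b,c;d)=\bigoplus_v\begin{bmatrix} b\,c\\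 v\end{bmatrix}\otimes\begin{bmatrix} a\,v\\ d\end{bmatrix}$ ($u,v$ running over $S$, resp. $T$), and let $\alpha_{a,b,c,d}:L_0(a,b,c;d)\to R_0(a,b,c;d)$ be the isomorphism obtained from $L_0\cong \mathrm{Hom}((a\otimes b)\otimes c,d)$, $f\otimes g\mapsto g(f\otimes 1_c)$, and $R_0\cong\mathrm{Hom}(a\otimes(b\otimes c),d)$, $f\otimes g\mapsto g(1_a\otimes f)$, by the associativity constraint of the category. Words. Let $S^\circ=S\setminus\{1\}$, $T^\circ=T\setminus\{1\}$. $S*T$ is the set of finite words (including the empty word $1$) in the letters $S^\circ\sqcup T^\circ$ in which letters of $S^\circ$ and $T^\circ$ alternate; $|x|$ is the word length. For $x,y\in S*T$ write $x\|y$ if the concatenation $xy$ is again in $S*T$ with $|xy|=|x|+|y|$ (this includes $x=1$ or $y=1$), and $x|y$ otherwise. Triangular vector spaces. If $x\|y$: $\begin{bmatrix} x\,y\\ z\end{bmatrix}=\mathbb{C}\delta_{xy,z}$. If $x|y$ and $|x|=|y|=1$: $\begin{bmatrix} x\,y\\ z\end{bmatrix}=\mathrm{Hom}(x\otimes y,z)$ if $x,y,z$ all lie in $S$ or all lie in $T$, and $\{0\}$ otherwise. If $x|y$, $|x|+|y|\ge 3$, $x=x'a$, $y=by'$ with $|a|=|b|=1$: $\begin{bmatrix} x\,y\\ z\end{bmatrix}=\begin{bmatrix} a\,b\\ c\end{bmatrix}$ if $z=x'cy'$ with $|c|=1$, and $\begin{bmatrix} x\,y\\ z\end{bmatrix}=\begin{bmatrix}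 a\,b\\ 1\end{bmatrix}\otimes\begin{bmatrix} x'\,y'\\ z\end{bmatrix}$ otherwise (recursively). Associativity transformations. Put $L(x,y,z;w)=\bigoplus_{u\in S*T}\begin{bmatrix} x\,y\\ u\end{bmatrix}\otimes\begin{bmatrix} u\,z\\ w\end{bmatrix}$ and $R(x,y,z;w)=\bigoplus_{v\in S*T}\begin{bmatrix} y\,z\\ v\end{bmatrix}\otimes\begin{bmatrix} x\,v\\ w\end{bmatrix}$. The isomorphism $a_{x,y,z,w}:L(x,y,z;w)\to R(x,y,z;w)$ is defined by induction on $|y|$. Below, $u,v$ denote letters (elements of $S^\circ$ or $T^\circ$, of the same type as the letters they are fused from), and tensor factors are permuted by flips where needed. (1) If $x\|y$ and $y\|z$: both sides equal $\mathbb{C}\delta_{xyz,w}$ if $y\neq1$, and both equal $\begin{bmatrix} x\,z\\ w\end{bmatrix}$ if $y=1$; $a_{x,y,z,w}$ is the identity. (2) If $x\|y$ and $y|z$, write $z=cz'$ with $|c|=1$. If $|y|=1$, both sides equal $\bigoplus_{u\ne1}\delta_{xuz',w}\begin{bmatrix} y\,c\\ u\end{bmatrix}\oplus\begin{bmatrix} y\,c\\ 1\end{bmatrix}\otimes\begin{bmatrix} x\,z'\\ w\end{bmatrix}$ and $a_{x,y,z,w}$ is the identity. If $|y|\ge2$, $y=y'b$ with $|b|=1$, then $L(x,y,z;w)=\bigoplus_{u\neq1}\delta_{xy'uz',w}\begin{bmatrix} b\,c\\ u\end{bmatrix}\oplus\begin{bmatrix} b\,c\\ 1\end{bmatrix}\otimes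 L(x,y',z';w)$, likewise for $R$ with $R(x,y',z';w)$, and $a_{x,y,z,w}=\mathrm{id}\oplus(\mathrm{id}\otimes a_{x,y',z',w})$. (3) If $x|y$ and $y\|z$: the left-right mirror image of (2). (4) If $x|y$ and $y|z$, write $x=x'a$, $z=cz'$ with $|a|=|c|=1$. If $|y|=1$, then $L(x,y,z;w)=\bigoplus_{v\neq1}\delta_{x'vz',w}L_0(a,y,c;v)\oplus L_0(a,y,c;1)\otimes\begin{bmatrix} x'\,z'\\ w\end{bmatrix}$, likewise for $R$ with $R_0$, and $a_{x,y,z,w}$ is given by the $\alpha_{a,y,c,v}$ on the first summands and by $\alpha_{a,y,c,1}\otimes\mathrm{id}$ on the last. If $|y|\ge2$, write $y=by''b'$ with $|b|=|b'|=1$. Then $L(x,y,z;w)=\bigoplus_{u\ne1}\begin{bmatrix} a\,b\\ u\end{bmatrix}\otimes\begin{bmatrix} x'uy''b'\ z\\ w\end{bmatrix}\oplus\begin{bmatrix} a\,b\\ 1\end{bmatrix}\otimes L(x',y''b',z;w)$. Applying $\mathrm{id}\otimes a_{x',y''b',z,w}$ to the last summand and expanding gives an isomorphism $\psi_L$ of $L(x,y,z;w)$ onto $M\oplus\begin{bmatrix} a\,b\\ 1\end{bmatrix}\otimes\begin{bmatrix} b'\,c\\ 1\end{bmatrix}\otimes R(x',y'',z';w)$, where $$M=\bigoplus_{u,v\ne1}\delta_{x'uy''vz',w}\begin{bmatrix} a\,b\\ u\end{bmatrix}\otimes\begin{bmatrix} b'\,c\\ v\end{bmatrix}\oplus\bigoplus_{u\ne1}\begin{bmatrix}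 a\,b\\ u\end{bmatrix}\otimes\begin{bmatrix} b'\,c\\ 1\end{bmatrix}\otimes\begin{bmatrix} x'uy''\ z'\\ w\end{bmatrix}\oplus\bigoplus_{v\ne1}\begin{bmatrix} a\,b\\ 1\end{bmatrix}\otimes\begin{bmatrix} b'\,c\\ v\end{bmatrix}\otimes\begin{bmatrix} x'\ y''vz'\\ w\end{bmatrix}.$$ Symmetrically, $R(x,y,z;w)=\bigoplus_{v\neq1}\begin{bmatrix} b'\,c\\ v\end{bmatrix}\otimes\begin{bmatrix} x\ by''vz'\\ w\end{bmatrix}\oplus\begin{bmatrix} b'\,c\\ 1\end{bmatrix}\otimes R(x,by'',z';w)$, and applying $\mathrm{id}\otimes a_{x,by'',z',w}^{-1}$ to the last summand gives an isomorphism $\psi_R$ of $R(x,y,z;w)$ onto $M\oplus\begin{bmatrix} a\,b\\ 1\end{bmatrix}\otimes\begin{bmatrix} b'\,c\\ 1\end{bmatrix}\otimes L(x',y'',z';w)$. Then $a_{x,y,z,w}=\psi_R^{-1}\circ(\mathrm{id}_M\oplus \mathrm{id}\otimes\mathrm{id}\otimes a_{x',y'',z',w}^{-1})\circ\psi_L$. *)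

(* Defs.v *)
From HB Require Import structures.
From mathcomp Require Import all_boot all_order all_algebra.
From mathcomp Require Import boolp classical_sets functions cardinality fsbigop.
From mathcomp Require Import ring_quotient complex reals.

Set Implicit Arguments.
Unset Strict Implicit.
Unset Printing Implicit Defensive.

Import GRing.Theory.
Local Open Scope ring_scope.

Definition mklin (K : fieldType) (U V : lmodType K) (f : U -> V)
    (Hf : linear f) : {linear U -> V} :=
  HB.pack f (GRing.isLinear.Build K U V *:%R f Hf).
Arguments mklin : simpl never.

Lemma mklinE (K : fieldType) (U V : lmodType K) (f : U -> V) (Hf : linear f) u :
  mklin Hf u = f u.
Proof. by []. Qed.

Section Combinators.
Variable K : fieldType.
Implicit Types U V W : lmodType K.

Definition lid U : {linear U -> U} := idfun.
Definition lzero U V : {linear U -> V} := \0.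
Definition lcomp U V W (g : {linear V -> W}) (f : {linear U -> V}) :
  {linear U -> W} := g \o f.
Arguments lcomp : simpl never.
Lemma lcompE U V W (g : {linear V -> W}) (f : {linear U -> V}) u :
  lcomp g f u = g (f u).
Proof. by []. Qed.

Lemma linv_subproof U V (f : {linear U -> V}) (h : bijective f) :
  linear (fun y => xget 0 [set x | f x = y]%classic).
Proof.
have [g fK gK] := h.
have E y : xget 0 [set x | f x = y]%classic = g y.
  case: xgetP => [x _ /= <-|/(_ (g y)) /=]; first by rewrite fK.
  by rewrite gK.
by move=> k x y; rewrite !E; apply: (can_inj fK); rewrite linearP !gK.
Qed.

Definition linv U V (f : {linear U -> V}) : {linear V -> U} :=
  match pselect (bijective f) with
  | left h => mklin (linv_subproof h)
  | right _ => lzero V U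
  end.

Lemma linvK U V (f : {linear U -> V}) : bijective f -> cancel f (linv f).
Proof.
move=> h x; rewrite /linv; case: pselect => // h' /=.
case: xgetP => [y _ /= |/(_ x) /=]; last by [].
exact: bij_inj.
Qed.

End Combinators.

Section DirectSum.
Variables (K : fieldType) (I : choiceType) (V : I -> lmodType K).

Record dsum_of := DSum {
  dcoord :> forall i, V i;
  dcoord_fin : finite_set [set i | dcoord i <> 0]%classic }.

HB.instance Definition _ := gen_eqMixin dsum_of.
HB.instance Definition _ := gen_choiceMixin dsum_of.

Lemma dsumP (s t : dsum_of) : (forall i, s i = t i) -> s = t.
Proof.
case: s t => [s hs] [t ht] /= e.
have {}e : s = t by apply: functional_extensionality_dep.
by case: t / e ht => ht; congr DSum; exact: Prop_irrelevance.
Qed.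

Lemma dsum0_fin : finite_set [set i | (0 : V i) <> 0]%classic.
Proof. by apply: (sub_finite_set _ (finite_set0 I)) => i /=. Qed.
Definition dsum0 := DSum dsum0_fin.

Lemma dsumN_fin (s : dsum_of) : finite_set [set i | - s i <> 0]%classic.
Proof.
by apply: sub_finite_set (dcoord_fin s) => i /= h e; apply: h; rewrite e oppr0.
Qed.
Definition dsumN s := DSum (dsumN_fin s).

Lemma dsumD_fin (s t : dsum_of) : finite_set [set i | s i + t i <> 0]%classic.
Proof.
have h : finite_set ([set i | s i <> 0] `|` [set i | t i <> 0])%classic.
  by rewrite finite_setU; split; exact: dcoord_fin.
apply: sub_finite_set h => i /= h.
have [e|] := pselect (s i = 0); last by left.
by right=> e'; apply: h; rewrite e e' addr0.
Qed.
Definition dsumD s t := DSum (dsumD_fin s t).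

Lemma dsumZ_fin k (s : dsum_of) : finite_set [set i | k *: s i <> 0]%classic.
Proof.
by apply: sub_finite_set (dcoord_fin s) => i /= h e; apply: h; rewrite e scaler0.
Qed.
Definition dsumZ k s := DSum (dsumZ_fin k s).

Let dsumDA : associative dsumD.
Proof. by move=> *; apply: dsumP => i /=; rewrite addrA. Qed.
Let dsumDC : commutative dsumD.
Proof. by move=> *; apply: dsumP => i /=; rewrite addrC. Qed.
Let dsumD0 : left_id dsum0 dsumD.
Proof. by move=> *; apply: dsumP => i /=; rewrite add0r. Qed.
Let dsumDN : left_inverse dsum0 dsumN dsumD.
Proof. by move=> *; apply: dsumP => i /=; rewrite addNr. Qed.
HB.instance Definition _ := GRing.isZmodule.Build dsum_of dsumDA dsumDC dsumD0 dsumDN.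

Let dsumZA a b s : dsumZ a (dsumZ b s) = dsumZ (a * b) s.
Proof. by apply: dsumP => i /=; rewrite scalerA. Qed.
Let dsumZ1 : left_id 1 dsumZ.
Proof. by move=> *; apply: dsumP => i /=; rewrite scale1r. Qed.
Let dsumZDr : right_distributive dsumZ +%R.
Proof. by move=> *; apply: dsumP => i /=; rewrite scalerDr. Qed.
Let dsumZDl s : {morph dsumZ^~ s : a b / a + b}.
Proof. by move=> *; apply: dsumP => i /=; rewrite scalerDl. Qed.
HB.instance Definition _ :=
  GRing.Zmodule_isLmodule.Build K dsum_of dsumZA dsumZ1 dsumZDr dsumZDl.

Definition dsum : lmodType K := dsum_of.

Lemma dsumDE (s t : dsum_of) i : (s + t) i = s i + t i. Proof. by []. Qed.
Lemma dsumZE k (s : dsum_of) i : (k *: s) i = k *: s i. Proof. by []. Qed.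

Definition dsing (i : I) (v : V i) (j : I) : V j :=
  match i =P j with
  | ReflectT e => eq_rect i V v j e
  | ReflectF _ => 0
  end.

Lemma dsingE i (v : V i) : dsing v i = v.
Proof.
rewrite /dsing; case: eqP => // e.
by rewrite (eq_irrelevance e (erefl i)).
Qed.

Lemma dsingN i (v : V i) j : i <> j -> dsing v j = 0.
Proof. by rewrite /dsing; case: eqP. Qed.

Lemma dsing_fin i (v : V i) : finite_set [set j | dsing v j <> 0]%classic.
Proof.
apply: (sub_finite_set _ (finite_set1 i)) => j /=; rewrite /dsing.
by case: eqP => // <-.
Qed.

Lemma dinj_subproof i : linear (fun v : V i => DSum (dsing_fin v)).
Proof.
move=> k u v; apply: dsumP => j; rewrite dsumDE dsumZE /=.
have [<-|ne] := pselect (i = j); first by rewrite !dsingE.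
by rewrite !dsingN // scaler0 addr0.
Qed.
Definition dinj i : {linear V i -> dsum} := mklin (@dinj_subproof i).


Definition dsupp (s : dsum_of) : seq I :=
  finmap.enum_fset (fset_set [set i | s i <> 0]%classic).

Section Lift.
Variables (W : lmodType K) (f : forall i, {linear V i -> W}).

Definition dlift_fun (s : dsum_of) : W := \sum_(i <- dsupp s) f i (s i).

Lemma dlift_funE (r : seq I) (s : dsum_of) :
  uniq r -> (forall i, s i <> 0 -> i \in r) ->
  dlift_fun s = \sum_(i <- r) f i (s i).
Proof.
move=> ur hr; rewrite /dlift_fun.
rewrite [RHS](bigID (fun i => i \in dsupp s)) /= [X in _ + X]big1 ?addr0; last first.
  move=> i; rewrite in_fset_set; last exact: dcoord_fin.
  by rewrite notin_setE /= => /contrapT ->; rewrite linear0.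
rewrite -[RHS]big_filter; apply: perm_big; apply: uniq_perm; rewrite ?filter_uniq //.
  exact: finmap.fset_uniq.
move=> i; rewrite mem_filter; case: (boolP (i \in dsupp s)) => //=.
rewrite in_fset_set; last exact: dcoord_fin.
by rewrite inE /= => /hr ->.
Qed.

Lemma dsuppP (s : dsum_of) i : s i <> 0 -> i \in dsupp s.
Proof. by move=> h; rewrite in_fset_set ?inE //; exact: dcoord_fin. Qed.

Lemma dlift_subproof : linear dlift_fun.
Proof.
move=> k s t; pose r := undup (dsupp s ++ dsupp t).
have rs i : s i <> 0 -> i \in r.
  by move=> /dsuppP h; rewrite mem_undup mem_cat h.
have rt i : t i <> 0 -> i \in r.
  by move=> /dsuppP h; rewrite mem_undup mem_cat h orbT.
have ur : uniq r by apply: undup_uniq.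
rewrite !(dlift_funE ur) //; last first.
  move=> i h; have [e|/rs //] := pselect (s i = 0).
  by apply: rt => e'; apply: h; rewrite dsumDE dsumZE e e' scaler0 addr0.
rewrite scaler_sumr -big_split; apply: eq_bigr => i _ /=.
by rewrite linearP.
Qed.

Definition dlift : {linear dsum -> W} := mklin dlift_subproof.

Lemma dlift_inj i (v : V i) : dlift (dinj i v) = f i v.
Proof.
rewrite /= (@dlift_funE [:: i]) //; first by rewrite big_seq1 /= dsingE.
move=> j /= h; rewrite inE; apply/eqP; apply: contrapT => e; apply: h.
by rewrite dsingN // => e'; apply: e.
Qed.
End Lift.

Lemma dsumE (s : dsum_of) : s = \sum_(i <- dsupp s) dinj i (s i).
Proof.
apply: dsumP => j.
have -> r : (\sum_(i <- r) dinj i (s i)) j = \sum_(i <- r) dsing (s i) j.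
  by elim: r => [|i r ih]; rewrite ?big_nil ?big_cons // dsumDE ih.
have [e|/dsuppP h] := pselect (s j = 0).
  rewrite e big1 // => i _; have [ij|/dsingN //] := pselect (i = j).
  by subst j; rewrite dsingE.
rewrite (bigD1_seq j) //=; last exact: finmap.fset_uniq.
rewrite dsingE big1 ?addr0 // => i /eqP; exact: dsingN.
Qed.

Lemma dsum_ext (W : lmodType K) (f g : {linear dsum -> W}) :
  (forall i v, f (dinj i v) = g (dinj i v)) -> f =1 g.
Proof. by move=> e s; rewrite (dsumE s) !linear_sum; apply: eq_bigr. Qed.

End DirectSum.

Arguments dinj {K I V} i : simpl never.
Arguments dlift {K I V W} f : simpl never.

Section Tensor.
Variables (K : fieldType) (U V : lmodType K).

Definition tens_free : lmodType K := dsum (fun _ : U * V => K^o).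
Definition tens_gen (u : U) (v : V) : tens_free :=
  dinj (V := fun _ : U * V => K^o) (u, v) (1 : K^o).

Inductive tens_null : tens_free -> Prop :=
| TensNull0 : tens_null 0
| TensNullP k s t : tens_null s -> tens_null t -> tens_null (k *: s + t)
| TensNullL k u u' v :
    tens_null (tens_gen (k *: u + u') v - (k *: tens_gen u v + tens_gen u' v))
| TensNullR k u v v' :
    tens_null (tens_gen u (k *: v + v') - (k *: tens_gen u v + tens_gen u v')).

Definition tens_nullb (t : tens_free) : bool := `[< tens_null t >].

Lemma tens_null_zmod : zmod_closed tens_nullb.
Proof.
split; first by apply/asboolP; exact: TensNull0.
move=> s t /asboolP hs /asboolP ht; apply/asboolP.
by rewrite addrC -scaleN1r; exact: TensNullP.
Qed.


Definition tens_zc : zmodClosed tens_free :=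
  HB.pack tens_nullb (GRing.isZmodClosed.Build tens_free tens_nullb tens_null_zmod).
Definition tens_of := Quotient.quot tens_zc.
HB.instance Definition _ := GRing.Zmodule.on tens_of.

Definition tpi : {additive tens_free -> tens_of} := \pi_(Quotient.quot tens_zc)%qT.
Definition trepr (x : tens_of) : tens_free := repr (x : Quotient.quot tens_zc).

Lemma treprK x : tpi (trepr x) = x.
Proof. exact: (@reprK _ (Quotient.quot tens_zc)). Qed.

Lemma tpiP (s t : tens_free) : tpi s = tpi t <-> tens_null (s - t).
Proof.
split=> [/eqP|h].
  by rewrite -[_ == _]/(s == t %[mod Quotient.quot tens_zc])%qT
             -Quotient.idealrBE => /asboolP.
apply/eqP; rewrite -[_ == _]/(s == t %[mod Quotient.quot tens_zc])%qT.
by rewrite -Quotient.idealrBE; apply/asboolP.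
Qed.

Lemma tpi_scale k (s t : tens_free) : tpi s = tpi t -> tpi (k *: s) = tpi (k *: t).
Proof.
move=> /tpiP h; apply/tpiP; rewrite -scalerBr -[_ *: _]addr0.
by apply: TensNullP => //; exact: TensNull0.
Qed.

Definition tscale (k : K) (x : tens_of) : tens_of := tpi (k *: trepr x).

Lemma tscale_pi k s : tscale k (tpi s) = tpi (k *: s).
Proof. by apply: tpi_scale; rewrite treprK. Qed.

Lemma tscaleA a b x : tscale a (tscale b x) = tscale (a * b) x.
Proof. by rewrite -(treprK x) !tscale_pi scalerA. Qed.
Lemma tscale1 : left_id 1 tscale.
Proof. by move=> x; rewrite -(treprK x) !tscale_pi scale1r. Qed.
Lemma tscaleDr : right_distributive tscale +%R.
Proof.
move=> k x y; rewrite -(treprK x) -(treprK y) -raddfD !tscale_pi scalerDr.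
exact: raddfD.
Qed.
Lemma tscaleDl x : {morph tscale^~ x : a b / a + b}.
Proof.
by move=> a b; rewrite -(treprK x) !tscale_pi scalerDl; exact: raddfD.
Qed.
HB.instance Definition _ :=
  GRing.Zmodule_isLmodule.Build K tens_of tscaleA tscale1 tscaleDr tscaleDl.

Definition tens : lmodType K := tens_of.

Definition tpure (u : U) (v : V) : tens := tpi (tens_gen u v).

Lemma tpi_linear : linear tpi.
Proof. by move=> k s t; rewrite raddfD -tscale_pi. Qed.
Definition tpil : {linear tens_free -> tens} := mklin tpi_linear.
Lemma tpilE s : tpi s = tpil s. Proof. by []. Qed.

Lemma tpure_linl v : linear (tpure^~ v).
Proof.
move=> k u u'; rewrite /tpure !tpilE -linearP -!tpilE.
by apply/tpiP; exact: TensNullL.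
Qed.

Lemma tpure_linr u : linear (tpure u).
Proof.
move=> k v v'; rewrite /tpure !tpilE -linearP -!tpilE.
by apply/tpiP; exact: TensNullR.
Qed.

Definition tpurer u : {linear V -> tens} := mklin (tpure_linr u).

Lemma tens_ext (W : lmodType K) (f g : {linear tens -> W}) :
  (forall u v, f (tpure u v) = g (tpure u v)) -> f =1 g.
Proof.
move=> e x; rewrite -(treprK x).
have h : lcomp f tpil =1 lcomp g tpil.
  apply: dsum_ext => -[u v] k.
  have -> : k = k *: (1 : K^o) by rewrite /GRing.scale /= mulr1.
  rewrite [dinj _ _]linearZ [LHS]linearZ [RHS]linearZ; congr (k *: _); exact: e.
exact: h.
Qed.

Section Lift.
Variables (W : lmodType K) (f : U -> {linear V -> W}).
Hypothesis f_lin : forall v, linear (f^~ v).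

Lemma tlift_gen_subproof (p : U * V) : linear (fun k : K^o => (k : K) *: f p.1 p.2).
Proof. by move=> k a b; rewrite scalerDl scalerA. Qed.

Definition tlift_free : {linear tens_free -> W} :=
  dlift (fun p => mklin (tlift_gen_subproof p)).

Lemma tlift_gen u v : tlift_free (tens_gen u v) = f u v.
Proof. by rewrite [LHS]dlift_inj /= scale1r. Qed.

Lemma tlift_null t : tens_null t -> tlift_free t = 0.
Proof.
elim=> [|k s {}t _ es _ et|k u u' v|k u v v'].
- by rewrite linear0.
- by rewrite linearP es et scaler0 addr0.
- by rewrite linearB linearP !tlift_gen f_lin subrr.
- by rewrite linearB linearP !tlift_gen linearP subrr.
Qed.

Definition tlift_fun (x : tens) : W := tlift_free (trepr x).

Lemma tlift_pi s : tlift_fun (tpi s) = tlift_free s.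
Proof.
apply/eqP; rewrite -subr_eq0 -linearB /=; apply/eqP/tlift_null/tpiP.
exact: treprK.
Qed.

Lemma tlift_subproof : linear tlift_fun.
Proof.
move=> k x y; rewrite -(treprK x) -(treprK y) !tpilE -linearP.
by rewrite -!tpilE !tlift_pi linearP.
Qed.

Definition tlift : {linear tens -> W} := mklin tlift_subproof.

Lemma tliftE u v : tlift (tpure u v) = f u v.
Proof. by rewrite [LHS]tlift_pi tlift_gen. Qed.

End Lift.
End Tensor.
Arguments tlift : simpl never.
Arguments tpurer : simpl never.

Notation "g \ol f" := (lcomp g f) (at level 50, left associativity).

Definition prodm (K : fieldType) (U V : lmodType K) : lmodType K := (U * V)%type.

Section Pairs.
Variables (K : fieldType) (U V X : lmodType K).

Definition lfst : {linear (prodm U V) -> U} := fst.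
Definition lsnd : {linear (prodm U V) -> V} := snd.

Lemma lpair_subproof (f : {linear X -> U}) (g : {linear X -> V}) :
  linear (fun x => (f x, g x)).
Proof. by move=> k x y; rewrite !linearP. Qed.
Definition lpair f g : {linear X -> (prodm U V)} := mklin (lpair_subproof f g).
End Pairs.
Arguments lfst {K U V}.
Arguments lsnd {K U V}.

Definition lprod (K : fieldType) (U V U' V' : lmodType K)
    (f : {linear U -> U'}) (g : {linear V -> V'}) : {linear (prodm U V) -> (prodm U' V')} :=
  lpair (f \ol lfst) (g \ol lsnd).
Definition linl (K : fieldType) (U V : lmodType K) : {linear U -> (prodm U V)} :=
  lpair (lid U) (lzero U V).
Definition linr (K : fieldType) (U V : lmodType K) : {linear V -> (prodm U V)} :=
  lpair (lzero V U) (lid V).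
Lemma lcase_subproof (K : fieldType) (U V W : lmodType K)
  (f : {linear U -> W}) (g : {linear V -> W}) :
  linear (fun p : prodm U V => f p.1 + g p.2).
Proof. by move=> k p q; rewrite !linearP scalerDr addrACA. Qed.
Definition lcase (K : fieldType) (U V W : lmodType K)
    (f : {linear U -> W}) (g : {linear V -> W}) : {linear prodm U V -> W} :=
  mklin (lcase_subproof f g).
Arguments lid {K U}.
Arguments lzero {K U V}.
Arguments linl {K U V}.
Arguments linr {K U V}.

Definition dmap (K : fieldType) (I : choiceType) (V W : I -> lmodType K)
    (f : forall i, {linear V i -> W i}) : {linear dsum V -> dsum W} :=
  dlift (fun i => dinj i \ol f i).

Section TensorMaps.
Variable K : fieldType.
Implicit Types U V W X : lmodType K.

Definition tpurel U V (v : V) : {linear U -> tens U V} := mklin (tpure_linl v).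

Lemma tmap_subproof U V U' V' (f : {linear U -> U'}) (g : {linear V -> V'}) v :
  linear (fun u => (tpurer V' (f u) \ol g) v).
Proof. by move=> k u u' /=; rewrite linearP; exact: tpure_linl. Qed.
Definition tmap U V U' V' (f : {linear U -> U'}) (g : {linear V -> V'}) :
    {linear tens U V -> tens U' V'} :=
  tlift (tmap_subproof f g).
Arguments tmap : simpl never.
Lemma tmapE U V U' V' (f : {linear U -> U'}) (g : {linear V -> V'}) u v :
  tmap f g (tpure u v) = tpure (f u) (g v).
Proof. by rewrite tliftE. Qed.

Lemma tswap_subproof U V v : linear (fun u => tpurel V (u : U) v).
Proof. by move=> k u u' /=; exact: tpure_linr. Qed.
Definition tswap U V : {linear tens U V -> tens V U} := tlift (@tswap_subproof U V).
Arguments tswap : simpl never.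
Lemma tswapE U V (u : U) (v : V) : tswap U V (tpure u v) = tpure v u.
Proof. by rewrite tliftE. Qed.

Lemma tunitl_fun_subproof V (k : K) : linear (fun v : V => k *: v).
Proof. by move=> a u v; rewrite scalerDr !scalerA mulrC. Qed.
Lemma tunitl_subproof V (v : V) :
  linear (fun k : K^o => mklin (@tunitl_fun_subproof V k) v).
Proof. by move=> a k l /=; rewrite scalerDl scalerA. Qed.
Definition tunitl V : {linear tens K^o V -> V} := tlift (@tunitl_subproof V).
Definition tunitr V : {linear tens V K^o -> V} := tunitl V \ol tswap V K^o.

Lemma tens_linear_family U V W X (g : W -> {linear tens U V -> X}) :
  (forall u v, linear (fun w => g w (tpure u v))) ->
  forall t, linear (fun w => g w t).
Proof.
move=> h t k w w'.
have hl : linear (fun t => k *: g w t + g w' t).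
  move=> a x y; rewrite (linearP (g w)) (linearP (g w')) !scalerDr !scalerA [a * k]mulrC -!addrA.
  by congr (_ + _); rewrite addrCA.
apply: (@tens_ext _ _ _ _ (g (k *: w + w')) (mklin hl)) => u v /=.
exact: h.
Qed.

Definition tassoc_fun U V W (w : W) : {linear tens U V -> tens U (tens V W)} :=
  tmap lid (tpurel V w).
Lemma tassoc_subproof1 U V W (t : tens U V) : linear (fun w : W => tassoc_fun U V w t).
Proof.
apply: tens_linear_family => u v k w w'.
by rewrite !tmapE /= -tpure_linr; congr tpure; exact: tpure_linr.
Qed.
Lemma tassoc_subproof2 U V W (w : W) :
  linear (fun t => mklin (tassoc_subproof1 (t : tens U V)) w).
Proof. by move=> k s t; exact: linearP. Qed.
Definition tassoc U V W : {linear tens (tens U V) W -> tens U (tens V W)} :=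
  tlift (@tassoc_subproof2 U V W).
Lemma tassocE U V W (u : U) (v : V) (w : W) :
  tassoc U V W (tpure (tpure u v) w) = tpure u (tpure v w).
Proof. by rewrite tliftE mklinE [LHS]tliftE. Qed.
Arguments tassoc : simpl never.

Definition tassocV U V W : {linear tens U (tens V W) -> tens (tens U V) W} :=
  tswap _ _ \ol tassoc W U V \ol tswap _ _ \ol tassoc V W U \ol tswap _ _.
Lemma tassocVE U V W (u : U) (v : V) (w : W) :
  tassocV U V W (tpure u (tpure v w)) = tpure (tpure u v) w.
Proof. by rewrite /tassocV !lcompE !(tswapE, tassocE). Qed.
Arguments tassocV : simpl never.

Definition tflip U V W : {linear tens U (tens V W) -> tens V (tens U W)} :=
  tassoc V U W \ol tmap (tswap U V) lid \ol tassocV U V W.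
Lemma tflipE U V W (u : U) (v : V) (w : W) :
  tflip U V W (tpure u (tpure v w)) = tpure v (tpure u w).
Proof. by rewrite /tflip 2!lcompE tassocVE tmapE tswapE tassocE. Qed.
Arguments tflip : simpl never.

Section TensorSum.
Variables (U : lmodType K) (I : choiceType) (V : I -> lmodType K) (W : lmodType K).

Lemma tdsumr_subproof (f : forall i, {linear tens U (V i) -> W}) s :
  linear (fun u => dlift (fun i => f i \ol tpurer (V i) u) s).
Proof.
move=> k u u' /=; rewrite /dlift_fun scaler_sumr -big_split.
by apply: eq_bigr => i _ /=; rewrite tpure_linl linearP.
Qed.
Definition tdsumr (f : forall i, {linear tens U (V i) -> W}) :
    {linear tens U (dsum V) -> W} := tlift (tdsumr_subproof f).
Lemma tdsumrE f u i (v : V i) : tdsumr f (tpure u (dinj i v)) = f i (tpure u v).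
Proof. by rewrite [LHS]tliftE dlift_inj. Qed.
Arguments tdsumr : simpl never.

Definition tdsuml (f : forall i, {linear tens (V i) U -> W}) :
    {linear tens (dsum V) U -> W} :=
  tdsumr (fun i => f i \ol tswap U (V i)) \ol tswap _ _.
Lemma tdsumlE f u i (v : V i) : tdsuml f (tpure (dinj i v) u) = f i (tpure v u).
Proof. by rewrite /tdsuml lcompE tswapE tdsumrE lcompE tswapE. Qed.
Arguments tdsuml : simpl never.
End TensorSum.
End TensorMaps.

Record tensorCategory (K : fieldType) := TensorCategory {
  obj : Type;
  hom : obj -> obj -> vectType K;
  idm : forall x, hom x x;
  mcomp : forall x y z, hom y z -> hom x y -> hom x z;
  comp_linear_l : forall x y z (f : hom x y),
    linear (fun g : hom y z => mcomp g f);
  comp_linear_r : forall x y z (g : hom y z),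
    linear (fun f : hom x y => mcomp g f);
  compA : forall x y z t (h : hom z t) (g : hom y z) (f : hom x y),
    mcomp h (mcomp g f) = mcomp (mcomp h g) f;
  comp1m : forall x y (f : hom x y), mcomp (idm y) f = f;
  compm1 : forall x y (f : hom x y), mcomp f (idm x) = f;

  oten : obj -> obj -> obj;
  mten : forall x x' y y', hom x x' -> hom y y' -> hom (oten x y) (oten x' y');
  mten_linear_l : forall x x' y y' (g : hom y y'),
    linear (fun f : hom x x' => mten f g);
  mten_linear_r : forall x x' y y' (f : hom x x'),
    linear (fun g : hom y y' => mten f g);
  mten1 : forall x y, mten (idm x) (idm y) = idm (oten x y);
  mten_comp : forall x x' x'' y y' y'' (f' : hom x' x'') (f : hom x x')
      (g' : hom y' y'') (g : hom y y'),
    mten (mcomp f' f) (mcomp g' g) = mcomp (mten f' g') (mten f g);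

  ounit : obj;
  assoc : forall x y z, hom (oten (oten x y) z) (oten x (oten y z));
  assocV : forall x y z, hom (oten x (oten y z)) (oten (oten x y) z);
  lunit : forall x, hom (oten ounit x) x;
  lunitV : forall x, hom x (oten ounit x);
  runit : forall x, hom (oten x ounit) x;
  runitV : forall x, hom x (oten x ounit);
  assocK : forall x y z, mcomp (assocV x y z) (assoc x y z) = idm _;
  assocVK : forall x y z, mcomp (assoc x y z) (assocV x y z) = idm _;
  lunitK : forall x, mcomp (lunitV x) (lunit x) = idm _;
  lunitVK : forall x, mcomp (lunit x) (lunitV x) = idm _;
  runitK : forall x, mcomp (runitV x) (runit x) = idm _;
  runitVK : forall x, mcomp (runit x) (runitV x) = idm _;
  assoc_nat : forall x x' y y' z z' (f : hom x x') (g : hom y y') (h : hom z z'),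
    mcomp (assoc x' y' z') (mten (mten f g) h) =
    mcomp (mten f (mten g h)) (assoc x y z);
  lunit_nat : forall x x' (f : hom x x'),
    mcomp (lunit x') (mten (idm ounit) f) = mcomp f (lunit x);
  runit_nat : forall x x' (f : hom x x'),
    mcomp (runit x') (mten f (idm ounit)) = mcomp f (runit x);
  pentagon : forall x y z t,
    mcomp (assoc x y (oten z t)) (assoc (oten x y) z t) =
    mcomp (mten (idm x) (assoc y z t))
      (mcomp (assoc x (oten y z) t) (mten (assoc x y z) (idm t)));
  triangle : forall x y,
    mcomp (mten (idm x) (lunit y)) (assoc x ounit y) = mten (runit x) (idm y) }.

Arguments ounit {K} C : rename.
Arguments hom {K} C x y : rename.
Arguments idm {K C} x : rename.

Section Semisimple.
Variables (K : fieldType) (C : tensorCategory K).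
Implicit Types x y : obj C.

Definition mono x y (f : hom C x y) :=
  forall t (g h : hom C t x), mcomp f g = mcomp f h -> g = h.
Definition iso x y (f : hom C x y) :=
  exists g : hom C y x, mcomp g f = idm x /\ mcomp f g = idm y.
Definition isomorphic x y := exists f : hom C x y, iso f.

Definition simple x :=
  idm x <> 0 /\ forall y (f : hom C y x), mono f -> f = 0 \/ iso f.

Definition direct_sum x n (s : 'I_n -> obj C) :=
  exists (inc : forall i, hom C (s i) x) (prj : forall i, hom C x (s i)),
    [/\ forall i, mcomp (prj i) (inc i) = idm (s i),
        forall i j, i <> j -> mcomp (prj j) (inc i) = 0
      & \sum_i mcomp (inc i) (prj i) = idm x].

(* The last clause is Schur's lemma, which follows from the definition of      *)
(* [simple] as soon as kernels exist; the category is not assumed to be closed *)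
(* under direct sums or subobjects.                                            *)
Definition semisimple :=
  [/\ simple (ounit C),
      forall x, exists n (s : 'I_n -> obj C),
        (forall i, simple (s i)) /\ direct_sum x s
    & forall x y (f : hom C x y), simple x -> simple y -> f <> 0 -> iso f].

(* A spectrum set is {1} together with the objects [spec_rep s]; thus it is    *)
(* represented by [option spec], with [None] standing for the unit object.     *)
Record spectrum := Spectrum {
  spec :> choiceType;
  spec_rep : spec -> obj C;
  spec_obj := fun a : option spec => oapp spec_rep (ounit C) a;
  spec_simple : forall a, simple (spec_obj a);
  spec_inj : forall a b, isomorphic (spec_obj a) (spec_obj b) -> a = b;
  spec_surj : forall x, simple x -> exists a, isomorphic x (spec_obj a) }.

End Semisimple.

Section BaseData.
Variables (K : fieldType) (C : tensorCategory K) (S : spectrum C).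
Implicit Types a b c d u v : option S.

Definition bracket a b c : lmodType K :=
  hom C (oten (spec_obj a) (spec_obj b)) (spec_obj c).

Definition baseL a b c d := dsum (fun u => tens (bracket a b u) (bracket u c d)).
Definition baseR a b c d := dsum (fun v => tens (bracket b c v) (bracket a v d)).

Definition baseL_in a b c d u :
  {linear tens (bracket a b u) (bracket u c d) -> baseL a b c d} :=
  dinj (V := fun u => tens (bracket a b u) (bracket u c d)) u.
Definition baseR_in a b c d v :
  {linear tens (bracket b c v) (bracket a v d) -> baseR a b c d} :=
  dinj (V := fun v => tens (bracket b c v) (bracket a v d)) v.

Lemma evalL_subproof a b c d u (g : bracket u c d) :
  linear (fun f : bracket a b u =>
    mklin (comp_linear_l (mten f (idm (spec_obj c)))) g).
Proof. by move=> k f f' /=; rewrite mten_linear_l comp_linear_r. Qed.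

Definition evalL a b c d : {linear baseL a b c d ->
    hom C (oten (oten (spec_obj a) (spec_obj b)) (spec_obj c)) (spec_obj d)} :=
  dlift (fun u => tlift (@evalL_subproof a b c d u)).

Lemma evalR_subproof a b c d v (g : bracket a v d) :
  linear (fun f : bracket b c v =>
    mklin (comp_linear_l (mten (idm (spec_obj a)) f)) g).
Proof. by move=> k f f' /=; rewrite mten_linear_r comp_linear_r. Qed.

Definition evalR a b c d : {linear baseR a b c d ->
    hom C (oten (spec_obj a) (oten (spec_obj b) (spec_obj c))) (spec_obj d)} :=
  dlift (fun v => tlift (@evalR_subproof a b c d v)).

Definition base_assoc a b c d : {linear baseL a b c d -> baseR a b c d} :=
  linv (evalR a b c d)
    \ol mklin (comp_linear_l (assocV (spec_obj a) (spec_obj b) (spec_obj c)))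
    \ol evalL a b c d.

Definition baseL_unit a b c : {linear bracket a b None -> baseL a b c c} :=
  baseL_in a b c c None \ol tpurel _ (lunit (spec_obj c)).
Definition baseR_unit a b c : {linear bracket b c None -> baseR a b c a} :=
  baseR_in a b c a None \ol tpurel _ (runit (spec_obj a)).

End BaseData.

Section Guard.
Variable K : fieldType.
Implicit Types U V W : lmodType K.

Definition null : lmodType K := 'rV[K]_0.

Definition guard (b : bool) V : lmodType K := if b then V else null.
Definition delta (b : bool) : lmodType K := guard b K^o.

Definition guard_in b V : {linear V -> guard b V} :=
  if b return {linear V -> guard b V} then lid else lzero.
Definition guard_out b V : {linear guard b V -> V} :=
  if b return {linear guard b V -> V} then lid else lzero.

Definition transport (I : eqType) (V : I -> lmodType K) (i j : I) :
    {linear V i -> V j} :=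
  match i =P j with
  | ReflectT e => eq_rect i (fun k => {linear V i -> V k}) lid j e
  | ReflectF _ => lzero
  end.

Lemma vec_subproof V (v : V) : linear (fun k : K^o => (k : K) *: v).
Proof. by move=> k a b; rewrite scalerDl scalerA. Qed.
Definition vec V (v : V) : {linear K^o -> V} := mklin (vec_subproof v).
End Guard.
Arguments null {K}.
Arguments guard_in {K} b {V}.
Arguments guard_out {K} b {V}.

Section FreeProduct.
Variables (K : fieldType) (C D : tensorCategory K).
Variables (S : spectrum C) (T : spectrum D).

Definition letter : choiceType := (S + T)%type.
Implicit Types (a b c : letter) (x y z w : seq letter).

Definition side a : bool := if a is inl _ then true else false.

Definition alternating x : bool := sorted (fun a b => side a != side b) x.

Definition word := {x : seq letter | alternating x}.

Definition joins x y : bool := alternating (x ++ y).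

Definition onS (V : option S -> lmodType K) (c : option letter) : lmodType K :=
  match c with
  | None => V None
  | Some (inl s) => V (Some s)
  | Some (inr _) => null
  end.
Definition onT (V : option T -> lmodType K) (c : option letter) : lmodType K :=
  match c with
  | None => V None
  | Some (inl _) => null
  | Some (inr t) => V (Some t)
  end.

Definition lbracket a b (c : option letter) : lmodType K :=
  match a, b with
  | inl a, inl b => onS (@bracket K C S (Some a) (Some b)) c
  | inr a, inr b => onT (@bracket K D T (Some a) (Some b)) c
  | _, _ => null
  end.

Definition letterL a b c (d : option letter) : lmodType K :=
  match a, b, c with
  | inl a, inl b, inl c => onS (@baseL K C S (Some a) (Some b) (Some c)) d
  | inr a, inr b, inr c => onT (@baseL K D T (Some a) (Some b) (Some c)) d
  | _, _, _ => null
  end.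
Definition letterR a b c (d : option letter) : lmodType K :=
  match a, b, c with
  | inl a, inl b, inl c => onS (@baseR K C S (Some a) (Some b) (Some c)) d
  | inr a, inr b, inr c => onT (@baseR K D T (Some a) (Some b) (Some c)) d
  | _, _, _ => null
  end.

Definition onS_map (V W : option S -> lmodType K) (f : forall d, {linear V d -> W d}) (c : option letter) :
    {linear onS V c -> onS W c} :=
  match c return {linear onS V c -> onS W c} with
  | None => f None
  | Some (inl s) => f (Some s)
  | Some (inr _) => lid
  end.
Definition onT_map (V W : option T -> lmodType K) (f : forall d, {linear V d -> W d}) (c : option letter) :
    {linear onT V c -> onT W c} :=
  match c return {linear onT V c -> onT W c} with
  | None => f None
  | Some (inl _) => lid
  | Some (inr t) => f (Some t)
  end.

Definition letter_assoc a b c d : {linear letterL a b c d -> letterR a b c d} :=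
  match a, b, c return {linear letterL a b c d -> letterR a b c d} with
  | inl a, inl b, inl c =>
      onS_map (@base_assoc K C S (Some a) (Some b) (Some c)) d
  | inr a, inr b, inr c =>
      onT_map (@base_assoc K D T (Some a) (Some b) (Some c)) d
  | _, _, _ => lid
  end.

Definition letterL_in a b c (d : option letter) u :
    {linear tens (lbracket a b (Some u)) (lbracket u c d) -> letterL a b c d} :=
  match a, b, c, u, d
  return {linear tens (lbracket a b (Some u)) (lbracket u c d) -> letterL a b c d}
  with
  | inl a, inl b, inl c, inl u, None =>
      @baseL_in K C S (Some a) (Some b) (Some c) None (Some u)
  | inl a, inl b, inl c, inl u, Some (inl d) =>
      @baseL_in K C S (Some a) (Some b) (Some c) (Some d) (Some u)
  | inr a, inr b, inr c, inr u, None =>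
      @baseL_in K D T (Some a) (Some b) (Some c) None (Some u)
  | inr a, inr b, inr c, inr u, Some (inr d) =>
      @baseL_in K D T (Some a) (Some b) (Some c) (Some d) (Some u)
  | _, _, _, _, _ => lzero
  end.
Definition letterL_unit a b c :
    {linear lbracket a b None -> letterL a b c (Some c)} :=
  match a, b, c
  return {linear lbracket a b None -> letterL a b c (Some c)}
  with
  | inl a, inl b, inl c => @baseL_unit K C S (Some a) (Some b) (Some c)
  | inr a, inr b, inr c => @baseL_unit K D T (Some a) (Some b) (Some c)
  | _, _, _ => lzero
  end.
Definition letterR_in a b c (d : option letter) v :
    {linear tens (lbracket b c (Some v)) (lbracket a v d) -> letterR a b c d} :=
  match a, b, c, v, d
  return {linear tens (lbracket b c (Some v)) (lbracket a v d) -> letterR a b c d}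
  with
  | inl a, inl b, inl c, inl v, None =>
      @baseR_in K C S (Some a) (Some b) (Some c) None (Some v)
  | inl a, inl b, inl c, inl v, Some (inl d) =>
      @baseR_in K C S (Some a) (Some b) (Some c) (Some d) (Some v)
  | inr a, inr b, inr c, inr v, None =>
      @baseR_in K D T (Some a) (Some b) (Some c) None (Some v)
  | inr a, inr b, inr c, inr v, Some (inr d) =>
      @baseR_in K D T (Some a) (Some b) (Some c) (Some d) (Some v)
  | _, _, _, _, _ => lzero
  end.
Definition letterR_unit a b c :
    {linear lbracket b c None -> letterR a b c (Some a)} :=
  match a, b, c
  return {linear lbracket b c None -> letterR a b c (Some a)}
  with
  | inl a, inl b, inl c => @baseR_unit K C S (Some a) (Some b) (Some c)
  | inr a, inr b, inr c => @baseR_unit K D T (Some a) (Some b) (Some c)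
  | _, _, _ => lzero
  end.

Definition middle x y z : option letter := ohead [seq c <- z | x ++ c :: y == z].

Definition tri_letters a b z : lmodType K :=
  match z with
  | [::] => lbracket a b None
  | [:: c] => lbracket a b (Some c)
  | _ => null
  end.

Definition tri_fused a b x y z (V : lmodType K) : lmodType K :=
  if nilp x && nilp y then tri_letters a b z else
  match middle x y z with
  | Some c => lbracket a b (Some c)
  | None => tens (lbracket a b None) V
  end.

Fixpoint tri_rev (rx y z : seq letter) : lmodType K :=
  if joins (rev rx) y then delta K (rev rx ++ y == z) else
  match rx, y with
  | a :: rx', b :: y' => tri_fused a b (rev rx') y' z (tri_rev rx' y' z)
  | _, _ => null
  end.

Definition tri x y z : lmodType K := tri_rev (rev x) y z.

Definition fus x y (F : seq letter -> lmodType K) : lmodType K :=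
  dsum (fun u : word => tens (tri x y (val u)) (F (val u))).

Definition spaceL x y z w : lmodType K := fus x y (fun u => tri u z w).
Definition spaceR x y z w : lmodType K := fus y z (fun v => tri x v w).

Definition join_out x y z : {linear tri x y z -> K^o} :=
  match rev x as rx return {linear tri_rev rx y z -> K^o} with
  | [::] =>
    if joins (rev [::]) y as j return
      {linear (if j then delta K (rev [::] ++ y == z) else null) -> K^o}
    then guard_out _ else lzero
  | a :: rx' =>
    if joins (rev (a :: rx')) y as j return
      {linear (if j then delta K (rev (a :: rx') ++ y == z) else _) -> K^o}
    then guard_out _ else lzero
  end.
Definition join_in x y z : {linear K^o -> tri x y z} :=
  match rev x as rx return {linear K^o -> tri_rev rx y z} with
  | [::] =>
    if joins (rev [::]) y as j return
      {linear K^o -> (if j then delta K (rev [::] ++ y == z) else null)}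
    then guard_in _ else lzero
  | a :: rx' =>
    if joins (rev (a :: rx')) y as j return
      {linear K^o -> (if j then delta K (rev (a :: rx') ++ y == z) else _)}
    then guard_in _ else lzero
  end.

Definition split_target x a b y z : lmodType K :=
  prodm (dsum (fun c => guard (x ++ c :: y == z) (lbracket a b (Some c))))
    (tens (lbracket a b None) (tri x y z)).

Definition split_letters x a b y z :
    {linear tri_letters a b z -> split_target x a b y z} :=
  match z return {linear tri_letters a b z -> split_target x a b y z} with
  | [::] => linr \ol tpurel _ (join_in x y [::] (1 : K^o))
  | [:: c] => linl \ol dinj c \ol guard_in _
  | _ => lzero
  end.

Definition split_fused x1 x a b y z :
    {linear tri_fused a b x1 y z (tri x y z) -> split_target x a b y z} :=
  if nilp x1 && nilp y as j return
    {linear ((if j then tri_letters a b z else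
              match middle x1 y z with
              | Some c => lbracket a b (Some c)
              | None => tens (lbracket a b None) (tri x y z)
              end) : lmodType K) -> split_target x a b y z}
  then split_letters x a b y z else
  match middle x1 y z as m return
    {linear (match m with
             | Some c => lbracket a b (Some c)
             | None => tens (lbracket a b None) (tri x y z)
             end : lmodType K) -> split_target x a b y z}
  with
  | Some c => linl \ol dinj c \ol guard_in _
  | None => linr
  end.

Definition split_rev x a b y z :
    {linear tri_rev (a :: rev x) (b :: y) z -> split_target x a b y z} :=
  if joins (rev (a :: rev x)) (b :: y) as j return
    {linear ((if j then delta K (rev (a :: rev x) ++ b :: y == z)
              else tri_fused a b (rev (rev x)) y z (tri x y z)) : lmodType K) ->
            split_target x a b y z}
  then lzero else split_fused _ _ _ _ _ _.

Definition tri_cast x y z x' y' z' : {linear tri x y z -> tri x' y' z'} :=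
  transport (fun p : seq letter * seq letter * seq letter => tri p.1.1 p.1.2 p.2)
    (x, y, z) (x', y', z').

Definition split x y x' a b y' z : {linear tri x y z -> split_target x' a b y' z} :=
  split_rev x' a b y' z \ol
  transport (fun p : seq letter * seq letter => tri_rev p.1 p.2 z)
    (rev x, y) (a :: rev x', b :: y').

Section Expand.
Variables (x y : seq letter) (F : seq letter -> lmodType K).

Definition join : {linear fus x y F -> F (x ++ y)} :=
  dlift (fun u : word =>
    transport F (val u) (x ++ y) \ol tunitl _ \ol tmap (join_out x y (val u)) lid).

Variables (x' : seq letter) (a b : letter) (y' : seq letter).

Definition expand : {linear fus x y F ->
    prodm (dsum (fun c => tens (lbracket a b (Some c)) (F (x' ++ c :: y'))))
      (tens (lbracket a b None) (fus x' y' F))} :=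
  dlift (fun u : word => lpair
    (tdsuml (fun c => dinj c \ol tmap (guard_out _) (transport F (val u) (x' ++ c :: y')))
      \ol tmap (lfst \ol split x y x' a b y' (val u)) lid)
    (tmap lid (dinj u) \ol tassoc _ _ _
      \ol tmap (lsnd \ol split x y x' a b y' (val u)) lid)).
End Expand.

Local Notation B := lbracket.

Section Cases.
Variables x y z w : seq letter.

Definition assoc1 : {linear spaceL x y z w -> spaceR x y z w} :=
  if nilp y then
    let toL := tri_cast (x ++ y) z w x z w \ol join x y (fun u => tri u z w) in
    let toR := tri_cast x (y ++ z) w x z w \ol join y z (fun v => tri x v w) in
    linv toR \ol toL
  else
    let toL := guard_in (x ++ y ++ z == w) \ol join_out (x ++ y) z w
                 \ol join x y (fun u => tri u z w) in
    let toR := guard_in (x ++ y ++ z == w) \ol join_out x (y ++ z) w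
                 \ol join y z (fun v => tri x v w) in
    linv toR \ol toL.

Section Case2.
Variables (y' : seq letter) (b c : letter) (z' : seq letter).

Definition assoc2_letter : {linear spaceL x y z w -> spaceR x y z w} :=
  let toL := split (x ++ y) z x b c z' w \ol join x y (fun u => tri u z w) in
  let toR : {linear spaceR x y z w -> split_target x b c z' w} :=
    lprod (dmap (fun u => guard_in _ \ol tunitr _
                            \ol tmap lid (join_out x (u :: z') w)))
          (tmap lid (join [::] z' (fun v => tri x v w)))
      \ol expand y z (fun v => tri x v w) [::] b c z' in
  linv toR \ol toL.

Definition target2 (V : lmodType K) : lmodType K :=
  prodm (dsum (fun u => guard (x ++ y' ++ u :: z' == w) (B b c (Some u))))
    (tens (B b c None) V).

Definition toL2 : {linear spaceL x y z w -> target2 (spaceL x y' z' w)} :=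
  lprod (dmap (fun u => guard_in _ \ol guard_out _))
        (tmap lid (linv (join x y' (fun u => tri u z' w))))
    \ol split (x ++ y) z (x ++ y') b c z' w \ol join x y (fun u => tri u z w).

Definition toR2 : {linear spaceR x y z w -> target2 (spaceR x y' z' w)} :=
  lprod (dmap (fun u => guard_in _ \ol tunitr _
                          \ol tmap lid (join_out x (y' ++ u :: z') w)))
        lid
    \ol expand y z (fun v => tri x v w) y' b c z'.

Definition assoc2 (f : {linear spaceL x y' z' w -> spaceR x y' z' w}) :
    {linear spaceL x y z w -> spaceR x y z w} :=
  linv toR2 \ol lprod lid (tmap lid f) \ol toL2.
End Case2.

Section Case3.
Variables (x' : seq letter) (a b : letter) (y' : seq letter).

Definition assoc3_letter : {linear spaceL x y z w -> spaceR x y z w} :=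
  let toL : {linear spaceL x y z w -> split_target x' a b z w} :=
    lprod (dmap (fun u => guard_in _ \ol tunitr _
                            \ol tmap lid (join_out (x' ++ [:: u]) z w)))
          (tmap lid (tri_cast (x' ++ [::]) z w x' z w
                       \ol join x' [::] (fun u => tri u z w)))
      \ol expand x y (fun u => tri u z w) x' a b [::] in
  let toR := split x (y ++ z) x' a b z w \ol join y z (fun v => tri x v w) in
  linv toR \ol toL.

Definition target3 (V : lmodType K) : lmodType K :=
  prodm (dsum (fun u => guard (x' ++ u :: y' ++ z == w) (B a b (Some u))))
    (tens (B a b None) V).

Definition toL3 : {linear spaceL x y z w -> target3 (spaceL x' y' z w)} :=
  lprod (dmap (fun u => guard_in _ \ol tunitr _
                          \ol tmap lid (join_out (x' ++ u :: y') z w)))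
        lid
    \ol expand x y (fun u => tri u z w) x' a b y'.

Definition toR3 : {linear spaceR x y z w -> target3 (spaceR x' y' z w)} :=
  lprod lid (tmap lid (linv (join y' z (fun v => tri x' v w))))
    \ol split x (y ++ z) x' a b (y' ++ z) w \ol join y z (fun v => tri x v w).

Definition assoc3 (f : {linear spaceL x' y' z w -> spaceR x' y' z w}) :
    {linear spaceL x y z w -> spaceR x y z w} :=
  linv toR3 \ol lprod lid (tmap lid f) \ol toL3.
End Case3.

Section Case4Letter.
Variables (x' : seq letter) (a b c : letter) (z' : seq letter).

Definition target4 (V : option letter -> lmodType K) : lmodType K :=
  prodm (dsum (fun v => guard (x' ++ v :: z' == w) (V (Some v))))
    (tens (V None) (tri x' z' w)).

Definition toL4_letter : {linear spaceL x y z w -> target4 (letterL a b c)} :=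
  lcase
    (dlift (fun u =>
       lpair
         (tdsumr (fun v => dinj v \ol guard_in _ \ol letterL_in a b c (Some v) u
                             \ol tmap lid (guard_out _)) \ol tmap lid lfst)
         (tmap (letterL_in a b c None u) lid \ol tassocV _ _ _ \ol tmap lid lsnd)
       \ol tmap lid (split (x' ++ [:: u]) z x' u c z' w)))
    (linl \ol dinj c \ol guard_in _ \ol letterL_unit a b c \ol tunitr _
       \ol tmap lid (join_out (x' ++ [::]) z w
                       \ol join x' [::] (fun u => tri u z w)))
  \ol expand x y (fun u => tri u z w) x' a b [::].

Definition toR4_letter : {linear spaceR x y z w -> target4 (letterR a b c)} :=
  lcase
    (dlift (fun v =>
       lpair
         (tdsumr (fun d => dinj d \ol guard_in _ \ol letterR_in a b c (Some d) v
                             \ol tmap lid (guard_out _)) \ol tmap lid lfst)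
         (tmap (letterR_in a b c None v) lid \ol tassocV _ _ _ \ol tmap lid lsnd)
       \ol tmap lid (split x (v :: z') x' a v z' w)))
    (linl \ol dinj a \ol guard_in _ \ol letterR_unit a b c \ol tunitr _
       \ol tmap lid (join_out x z' w \ol join [::] z' (fun v => tri x v w)))
  \ol expand y z (fun v => tri x v w) [::] b c z'.

Definition assoc4_letter : {linear spaceL x y z w -> spaceR x y z w} :=
  linv toR4_letter
    \ol lprod (dmap (fun v => guard_in _ \ol letter_assoc a b c (Some v)
                                \ol guard_out _))
              (tmap (letter_assoc a b c None) lid)
    \ol toL4_letter.
End Case4Letter.

Section Case4.
Variables (x' : seq letter) (a b : letter).
Variables (y1 y2 y'' : seq letter) (b' c : letter) (z' : seq letter).

Definition middle4 : lmodType K :=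
  prodm
    (dsum (fun p : letter * letter =>
       guard (x' ++ p.1 :: y'' ++ p.2 :: z' == w)
         (tens (B a b (Some p.1)) (B b' c (Some p.2)))))
    (prodm
      (dsum (fun u => tens (B a b (Some u))
               (tens (B b' c None) (tri (x' ++ u :: y'') z' w))))
      (dsum (fun v => tens (B a b None)
               (tens (B b' c (Some v)) (tri x' (y'' ++ v :: z') w))))).

Definition target4r (V : lmodType K) : lmodType K :=
  prodm middle4 (tens (B a b None) (tens (B b' c None) V)).

Definition psiL (f : {linear spaceL x' y1 z w -> spaceR x' y1 z w}) :
    {linear spaceL x y z w -> target4r (spaceR x' y'' z' w)} :=
  lcase
    (dlift (fun u => linl \ol
       lpair
         (tdsumr (fun v => dinj (u, v) \ol guard_in _
                             \ol tmap lid (guard_out _)) \ol tmap lid lfst)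
         (linl \ol dinj u \ol tmap lid lsnd)
       \ol tmap lid (split (x' ++ u :: y1) z (x' ++ u :: y'') b' c z' w)))
    (lpair
       (linr \ol linr \ol tdsumr (fun v => dinj v) \ol tmap lid lfst)
       (tmap lid lsnd)
     \ol tmap lid (expand y1 z (fun v => tri x' v w) y'' b' c z' \ol f))
  \ol expand x y (fun u => tri u z w) x' a b y1.

Definition psiR (g : {linear spaceR x y2 z' w -> spaceL x y2 z' w}) :
    {linear spaceR x y z w -> target4r (spaceL x' y'' z' w)} :=
  lcase
    (dlift (fun v => linl \ol
       lpair
         (tdsumr (fun u => dinj (u, v) \ol guard_in _ \ol tswap _ _
                             \ol tmap lid (guard_out _)) \ol tmap lid lfst)
         (linr \ol dinj v \ol tflip _ _ _ \ol tmap lid lsnd)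
       \ol tmap lid (split x (y2 ++ v :: z') x' a b (y'' ++ v :: z') w)))
    (lpair
       (linr \ol linl \ol tdsumr (fun u => dinj u \ol tflip _ _ _)
          \ol tmap lid lfst)
       (tflip _ _ _ \ol tmap lid lsnd)
     \ol tmap lid (expand x y2 (fun u => tri u z' w) x' a b y'' \ol g))
  \ol expand y z (fun v => tri x v w) y2 b' c z'.

Definition assoc4 (f : {linear spaceL x' y1 z w -> spaceR x' y1 z w})
    (g : {linear spaceL x y2 z' w -> spaceR x y2 z' w})
    (h : {linear spaceL x' y'' z' w -> spaceR x' y'' z' w}) :
    {linear spaceL x y z w -> spaceR x y z w} :=
  linv (psiR (linv g)) \ol lprod lid (tmap lid (tmap lid (linv h))) \ol psiL f.
End Case4.

End Cases.

Definition unrcons x : option (seq letter * letter) :=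
  if rev x is a :: rx then Some (rev rx, a) else None.

Fixpoint assoc_rec (n : nat) x y z w {struct n} :
    {linear spaceL x y z w -> spaceR x y z w} :=
  if n is n'.+1 then
    match joins x y, joins y z with
    | true, true => assoc1 x y z w
    | true, false =>
        match unrcons y, z with
        | Some ([::], b), c :: z' => assoc2_letter x y z w b c z'
        | Some (y', b), c :: z' => @assoc2 x y z w y' b c z' (assoc_rec n' x y' z' w)
        | _, _ => lzero
        end
    | false, true =>
        match unrcons x, y with
        | Some (x', a), [:: b] => assoc3_letter x y z w x' a b
        | Some (x', a), b :: y' => @assoc3 x y z w x' a b y' (assoc_rec n' x' y' z w)
        | _, _ => lzero
        end
    | false, false =>
        match unrcons x, y, z with
        | Some (x', a), [:: b], c :: z' => assoc4_letter x y z w x' a b c z'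
        | Some (x', a), b :: y1, c :: z' =>
            if unrcons y1 is Some (y'', b') then
              @assoc4 x y z w x' a b y1 (b :: y'') y'' b' c z'
                (assoc_rec n' x' y1 z w)
                (assoc_rec n' x (b :: y'') z' w) (assoc_rec n' x' y'' z' w)
            else lzero
        | _, _, _ => lzero
        end
    end
  else assoc1 x y z w.

Definition free_assoc x y z w : {linear spaceL x y z w -> spaceR x y z w} :=
  assoc_rec (size y) x y z w.

Section Pentagon.
Variables s t u v w : word.

Definition pent_source : lmodType K :=
  dsum (fun i : word * word =>
    tens (tri (val s) (val t) (val i.1)) (tens (tri (val i.1) (val u) (val i.2)) (tri (val i.2) (val v) (val w)))).
Definition pent_target : lmodType K :=
  dsum (fun i : word * word =>
    tens (tri (val u) (val v) (val i.1)) (tens (tri (val t) (val i.1) (val i.2)) (tri (val s) (val i.2) (val w)))).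

Definition pathA : {linear pent_source -> pent_target} :=
  dlift (fun r : word => tdsumr (fun q : word => dinj (r, q)))
  \ol dmap (fun r : word => tmap lid (free_assoc (val s) (val t) (val r) (val w)))
  \ol dlift (fun p : word =>
        tdsumr (fun r : word => dinj r \ol tmap lid (dinj p) \ol tflip _ _ _))
  \ol dmap (fun p : word => tmap lid (free_assoc (val p) (val u) (val v) (val w)))
  \ol dlift (fun i : word * word => dinj i.1 \ol tmap lid (dinj i.2)).

Definition pathB : {linear pent_source -> pent_target} :=
  dlift (fun q : word =>
        tdsuml (fun r : word => dinj (r, q) \ol tassoc _ _ _))
  \ol dmap (fun q : word => tmap (free_assoc (val t) (val u) (val v) (val q)) lid)
  \ol dlift (fun p : word =>
        tdsumr (fun q : word => dinj q \ol tmap (dinj p) lid \ol tassocV _ _ _))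
  \ol dmap (fun p : word => tmap lid (free_assoc (val s) (val p) (val v) (val w)))
  \ol dlift (fun q : word =>
        tdsuml (fun p : word => dinj p \ol tmap lid (dinj q) \ol tassoc _ _ _))
  \ol dmap (fun q : word => tmap (free_assoc (val s) (val t) (val u) (val q)) lid)
  \ol dlift (fun i : word * word =>
        dinj i.2 \ol tmap (dinj i.1) lid \ol tassocV _ _ _).
End Pentagon.

End FreeProduct.

(* Main.v *)
(* The free product acts on a concrete model.  A path ending at a word w is a
   sequence of elementary fusions which builds w from the empty word by letting
   letters of S and T act on the left: acting by a letter a either adds it in
   front, fuses it with the first letter, or cancels that letter.  Because C
   and D are semisimple, every bracket acts on such paths: f in Hom(a (x) b, c)
   replaces the last step, by c, with two steps, by b and then by a, and this
   is compatible with the associativity constraint of C or D by the pentagon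
   and the triangle of that category.  Writing [shift] for the operation of
   letting an operator act below the last step, every f in [x y; z] becomes an
   operator Th(f), built by the recursion defining [x y; z], and the two sides
   of a_{x,y,z,w} are evaluated as
       f (x) g in L  |->  Th(f) Th(g),   f (x) g in R  |->  shift^|x| Th(f) Th(g).
   Following the inductive definition case by case, a_{x,y,z,w} is bijective and
   preserves evaluation on paths carrying the label w.  Hence both composites of
   the pentagon have the same evaluation.  Finally the evaluation of the target
   at the canonical path of w is injective: the outermost label can be read
   off a path one letter at a time. *)

(* A path with labels [a1, ..., an], outermost first, ending at [w] plays the role of a morphism
   [a1 (x) (a2 (x) ...) -> w] of the free product, but is written with steps that live in C or in D
   alone, so no associativity of the free product is presupposed. In this reading an operator
   [Th(f)] is precomposition with [f] and [shift] is tensoring with one letter on the left; this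
   dictates the order of the factors, as [g (f (x) 1)] and [g (1 (x) f)] precompose with [g] first.
   The restriction to paths labelled by [w] is forced by the unit. A bracket [[1 c; d]] is a scalar
   and acts without looking at labels, whereas [[u c; d]] with [u, d <> 1] kills the paths whose
   last label is not [d]; so the two sides of [alpha] are compared on label [d] only. Every identity
   therefore carries the projector [lamW w], and in (B), where the brackets of [a_{s,t,u,q}] act
   after [[q v; w]], one must know that the latter produces paths labelled by [q]. Bijectivity is
   carried through the same induction because the transformations are defined with [linv], which
   inverts only bijective maps. *)
From HB Require Import structures.
From mathcomp Require Import all_boot all_order all_algebra.
From mathcomp Require Import boolp classical_sets functions cardinality fsbigop.
From mathcomp Require Import ring_quotient complex reals.
Require Import Defs.

Set Implicit Arguments.
Unset Strict Implicit.
Unset Printing Implicit Defensive.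

Import GRing.Theory.
Local Open Scope ring_scope.

Arguments lid {K U}.
Arguments lzero {K U V}.
Arguments linl {K U V}.
Arguments linr {K U V}.
Arguments lcomp : simpl never.
Arguments tmap : simpl never.
Arguments tswap : simpl never.
Arguments tassoc : simpl never.
Arguments tassocV : simpl never.
Arguments tflip : simpl never.
Arguments tdsumr : simpl never.
Arguments tdsuml : simpl never.
Arguments dmap : simpl never.
Arguments lprod : simpl never.
Arguments lcase : simpl never.
Arguments lpair : simpl never.
Arguments linl : simpl never.
Arguments linr : simpl never.
Arguments tpure : simpl never.
Arguments tunitl : simpl never.
Arguments tunitr : simpl never.

(** * Linear algebra *)

Section Bij.
Variable K : fieldType.
Implicit Types U V W X : lmodType K.

Lemma linvVK U V (f : {linear U -> V}) : bijective f -> cancel (linv f) f.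
Proof.
move=> h y; have [g fK gK] := h.
by rewrite -[in LHS](gK y) (linvK h) gK.
Qed.

Lemma linv_bij U V (f : {linear U -> V}) : bijective f -> bijective (linv f).
Proof. by move=> h; exists f; [exact: linvVK | exact: linvK]. Qed.

Lemma bij_lid U : bijective (@lid K U).
Proof. by exists id. Qed.

Lemma bij_lcomp U V W (g : {linear V -> W}) (f : {linear U -> V}) :
  bijective g -> bijective f -> bijective (g \ol f).
Proof. exact: bij_comp. Qed.

Lemma lidE U (u : U) : (lid : {linear U -> U}) u = u. Proof. by []. Qed.
Lemma lpairE U V W (f : {linear W -> U}) (g : {linear W -> V}) w :
  lpair f g w = (f w, g w). Proof. by []. Qed.
Lemma lprodE U V U' V' (f : {linear U -> U'}) (g : {linear V -> V'}) p :
  lprod f g p = (f p.1, g p.2). Proof. by []. Qed.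
Lemma linlE U V (u : U) : linl u = (u, 0) :> prodm U V. Proof. by []. Qed.
Lemma linrE U V (v : V) : linr v = (0, v) :> prodm U V. Proof. by []. Qed.
Lemma lcaseE U V W (f : {linear U -> W}) (g : {linear V -> W}) p :
  lcase f g p = f p.1 + g p.2. Proof. by []. Qed.
Lemma lcase_inl U V W (f : {linear U -> W}) (g : {linear V -> W}) u :
  lcase f g (linl u) = f u.
Proof. by rewrite lcaseE /= linear0 addr0. Qed.
Lemma lcase_inr U V W (f : {linear U -> W}) (g : {linear V -> W}) u :
  lcase f g (linr u) = g u.
Proof. by rewrite lcaseE /= linear0 add0r. Qed.
Lemma lprod_inl U V U' V' (f : {linear U -> U'}) (g : {linear V -> V'}) u :
  lprod f g (linl u) = linl (f u).
Proof. by rewrite lprodE !linlE /= linear0. Qed.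
Lemma lprod_inr U V U' V' (f : {linear U -> U'}) (g : {linear V -> V'}) u :
  lprod f g (linr u) = linr (g u).
Proof. by rewrite lprodE !linrE /= linear0. Qed.

Lemma prodm_ext U V W (f g : {linear prodm U V -> W}) :
  (forall u, f (linl u) = g (linl u)) -> (forall v, f (linr v) = g (linr v)) ->
  f =1 g.
Proof.
move=> hl hr [u v].
have -> : (u, v) = linl u + linr v :> prodm U V.
  by rewrite linlE linrE; congr pair; rewrite /= ?addr0 ?add0r.
by rewrite !linearD hl hr.
Qed.

Lemma bij_tmap U V U' V' (f : {linear U -> U'}) (g : {linear V -> V'}) :
  bijective f -> bijective g -> bijective (tmap f g).
Proof.
move=> hf hg; exists (tmap (linv f) (linv g)) => x.
- apply: (@tens_ext _ _ _ _ (tmap (linv f) (linv g) \ol tmap f g) lid) => u v.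
  by rewrite lcompE !tmapE !linvK.
- apply: (@tens_ext _ _ _ _ (tmap f g \ol tmap (linv f) (linv g)) lid) => u v.
  by rewrite lcompE !tmapE !linvVK.
Qed.

Lemma dmap_inj (I : choiceType) (V W : I -> lmodType K)
  (f : forall i, {linear V i -> W i}) i v : dmap f (dinj i v) = dinj i (f i v).
Proof. by rewrite /dmap dlift_inj lcompE. Qed.

Lemma bij_dmap (I : choiceType) (V W : I -> lmodType K)
  (f : forall i, {linear V i -> W i}) :
  (forall i, bijective (f i)) -> bijective (dmap f).
Proof.
move=> h; exists (dmap (fun i => linv (f i))) => x.
- apply: (@dsum_ext _ _ _ _ (dmap (fun i => linv (f i)) \ol dmap f) lid) => i v.
  by rewrite lcompE !dmap_inj linvK.
- apply: (@dsum_ext _ _ _ _ (dmap f \ol dmap (fun i => linv (f i))) lid) => i v.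
  by rewrite lcompE !dmap_inj linvVK.
Qed.

Lemma bij_lprod U V U' V' (f : {linear U -> U'}) (g : {linear V -> V'}) :
  bijective f -> bijective g -> bijective (lprod f g).
Proof.
move=> hf hg; exists (lprod (linv f) (linv g)) => -[x y].
- by rewrite !lprodE /= !linvK.
- by rewrite !lprodE /= !linvVK.
Qed.

Lemma bij_cancel U V (f : {linear U -> V}) (g : {linear V -> U}) :
  g \ol f =1 lid -> f \ol g =1 lid -> bijective f.
Proof. by move=> h1 h2; exists g => x; [exact: h1 | exact: h2]. Qed.

Lemma bij_triv U V (f : {linear U -> V}) :
  (forall u : U, u = 0) -> (forall v : V, v = 0) -> bijective f.
Proof.
move=> hu hv; exists (fun _ => 0) => x; first by rewrite [RHS]hu.
by rewrite [RHS]hv linear0.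
Qed.

Lemma eq_bij_lin U V (f g : {linear U -> V}) : f =1 g -> bijective g -> bijective f.
Proof. by move=> e h; apply: eq_bij h _ _ => x; rewrite e. Qed.

Lemma tens0l U V : (forall u : U, u = 0) -> forall t : tens U V, t = 0.
Proof.
move=> h; apply: (@tens_ext _ _ _ _ lid lzero) => u v.
by rewrite (h u) -[tpure 0 v]/(tpurel U v 0) linear0.
Qed.

Lemma tens0r U V : (forall v : V, v = 0) -> forall t : tens U V, t = 0.
Proof.
move=> h; apply: (@tens_ext _ _ _ _ lid lzero) => u v.
by rewrite (h v) -[tpure u 0]/(tpurer V u 0) linear0.
Qed.

Lemma dsum_triv (I : choiceType) (V : I -> lmodType K) :
  (forall i (v : V i), v = 0) -> forall t : dsum V, t = 0.
Proof.
move=> h; apply: (@dsum_ext _ _ _ _ lid lzero) => i v.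
by rewrite (h i v) linear0.
Qed.

Lemma prodm0 U V : (forall u : U, u = 0) -> (forall v : V, v = 0) ->
  forall p : prodm U V, p = 0.
Proof. by move=> hu hv [u v]; rewrite (hu u) (hv v). Qed.

Lemma null0 (u : @null K) : u = 0.
Proof. by apply/rowP => -[]. Qed.

Lemma guard0 (b : bool) V (u : guard b V) : ~~ b -> u = 0.
Proof. by case: b u => // u _; exact: null0. Qed.

Lemma guard_inK (b : bool) V : b -> cancel (@guard_in K b V) (@guard_out K b V).
Proof. by case: b. Qed.
Lemma guard_outK (b : bool) V : cancel (@guard_out K b V) (@guard_in K b V).
Proof. by case: b => //= u; rewrite [RHS]null0. Qed.
Lemma guard_out_in (b : bool) V (v : V) : guard_out b (guard_in b v) = if b then v else 0.
Proof. by case: b. Qed.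
Lemma guard_in_bij (b : bool) V : b -> bijective (@guard_in K b V).
Proof. by move=> h; exists (guard_out b); [exact: guard_inK | exact: guard_outK]. Qed.
Lemma guard_out_bij (b : bool) V : b -> bijective (@guard_out K b V).
Proof. by move=> h; exists (guard_in b); [exact: guard_outK | exact: guard_inK]. Qed.

Lemma tpureDr U V (u : U) (v v' : V) : tpure u (v + v') = tpure u v + tpure u v'.
Proof. exact: (linearD (tpurer V u)). Qed.
Lemma tpureZl U V k (u : U) (v : V) : tpure (k *: u) v = k *: tpure u v.
Proof. exact: (linearZZ (tpurel U v)). Qed.
Lemma tpureZr U V k (u : U) (v : V) : tpure u (k *: v) = k *: tpure u v.
Proof. exact: (linearZZ (tpurer V u)). Qed.
Lemma tpure0l U V (v : V) : tpure (0 : U) v = 0.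
Proof. exact: (linear0 (tpurel U v)). Qed.
Lemma tpure0r U V (u : U) : tpure u (0 : V) = 0.
Proof. exact: (linear0 (tpurer V u)). Qed.
Lemma tpure_suml U V I (r : seq I) (F : I -> U) (v : V) :
  tpure (\sum_(i <- r) F i) v = \sum_(i <- r) tpure (F i) v.
Proof. exact: (linear_sum (tpurel U v)). Qed.

Lemma tunitlE V (k : K^o) (v : V) : tunitl V (tpure k v) = (k : K) *: v.
Proof. exact: tliftE. Qed.
Lemma tunitrE V (k : K^o) (v : V) : tunitr V (tpure v k) = (k : K) *: v.
Proof. by rewrite /tunitr lcompE tswapE tunitlE. Qed.

Lemma tunitr_bij V : bijective (tunitr V).
Proof.
apply: (@bij_cancel _ _ _ (tpurel V (1 : K^o))).
- apply: tens_ext => v k; rewrite lcompE tunitrE lidE /= -/(tpure _ _).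
  by rewrite tpureZl -tpureZr /GRing.scale /= mulr1.
- by move=> v; rewrite lcompE -[tpurel _ _ _]/(tpure _ _) tunitrE scale1r.
Qed.

Lemma transportE (I : eqType) (V : I -> lmodType K) i (v : V i) :
  transport V i i v = v.
Proof.
rewrite /transport; case: eqP => // e.
by rewrite (eq_irrelevance e erefl).
Qed.

Lemma transport_bij (I : eqType) (V : I -> lmodType K) i j :
  i = j -> bijective (transport V i j).
Proof.
by move=> <-; apply: eq_bij_lin (bij_lid _) => v; rewrite transportE.
Qed.


Lemma bij_inj_surj U V (f : {linear U -> V}) :
  (forall u, f u = 0 -> u = 0) -> (forall v, exists u, f u = v) -> bijective f.
Proof.
move=> hi hs; have [g gK] := choice hs; exists g => // u.
apply/eqP; rewrite -subr_eq0; apply/eqP/hi.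
by rewrite linearB gK subrr.
Qed.

End Bij.

Lemma dtens_ext (K : fieldType) (I : choiceType) (U V : I -> lmodType K)
    (W : lmodType K) (f g : {linear dsum (fun i => tens (U i) (V i)) -> W}) :
  (forall i u v, f (dinj i (tpure u v)) = g (dinj i (tpure u v))) -> f =1 g.
Proof.
move=> e; apply: dsum_ext => i t.
by apply: (@tens_ext _ _ _ _ (f \ol dinj i) (g \ol dinj i)) => u v; exact: e.
Qed.

Lemma tens3_ext (K : fieldType) (U V W X : lmodType K)
    (f g : {linear tens U (tens V W) -> X}) :
  (forall u v w, f (tpure u (tpure v w)) = g (tpure u (tpure v w))) -> f =1 g.
Proof.
move=> e; apply: tens_ext => u t.
by apply: (@tens_ext _ _ _ _ (f \ol tpurer _ u) (g \ol tpurer _ u)) => v w; exact: e.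
Qed.

(** * The module of linear maps between two modules *)

Section Lin.
Variables (K : fieldType) (U V : lmodType K).

(** A record whose linearity proof is irrelevant, so that pointwise equal maps are equal and the
    maps from [U] to [V] form a module. Operators on paths and unrolled morphisms take their values
    there. *)
Record lin_of := Lin { lin_raw : U -> V; lin_rawP : linear lin_raw }.
HB.instance Definition _ := gen_eqMixin lin_of.
HB.instance Definition _ := gen_choiceMixin lin_of.

Definition lin_fun (f : lin_of) : {linear U -> V} := mklin (lin_rawP f).

Lemma linP (f g : lin_of) : (forall u, lin_fun f u = lin_fun g u) -> f = g.
Proof.
case: f g => [f hf] [g hg] e.
have {}e : f = g by apply: functional_extensionality_dep.
by case: g / e hg => hg; congr Lin; exact: Prop_irrelevance.
Qed.

Lemma lin0_subproof : linear (fun _ : U => 0 : V).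
Proof. by move=> k u v; rewrite scaler0 addr0. Qed.
Definition lin0 := Lin lin0_subproof.
Lemma linN_subproof (f : lin_of) : linear (fun u : U => - lin_fun f u).
Proof. by move=> k u v; rewrite linearP opprD scalerN. Qed.
Definition linN f := Lin (linN_subproof f).
Lemma linD_subproof (f g : lin_of) : linear (fun u : U => lin_fun f u + lin_fun g u).
Proof. by move=> k u v; rewrite !linearP scalerDr addrACA. Qed.
Definition linD f g := Lin (linD_subproof f g).
Lemma linZ_subproof k (f : lin_of) : linear (fun u : U => k *: lin_fun f u).
Proof. by move=> a u v; rewrite linearP scalerDr !scalerA mulrC. Qed.
Definition linZ k f := Lin (linZ_subproof k f).

Let linDA : associative linD.
Proof. by move=> *; apply: linP => u /=; rewrite addrA. Qed.
Let linDC : commutative linD.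
Proof. by move=> *; apply: linP => u /=; rewrite addrC. Qed.
Let linD0 : left_id lin0 linD.
Proof. by move=> *; apply: linP => u /=; rewrite add0r. Qed.
Let linDN : left_inverse lin0 linN linD.
Proof. by move=> *; apply: linP => u /=; rewrite addNr. Qed.
HB.instance Definition _ := GRing.isZmodule.Build lin_of linDA linDC linD0 linDN.

Let linZA a b s : linZ a (linZ b s) = linZ (a * b) s.
Proof. by apply: linP => u /=; rewrite scalerA. Qed.
Let linZ1 : left_id 1 linZ.
Proof. by move=> *; apply: linP => u /=; rewrite scale1r. Qed.
Let linZDr : right_distributive linZ +%R.
Proof. by move=> *; apply: linP => u /=; rewrite scalerDr. Qed.
Let linZDl s : {morph linZ^~ s : a b / a + b}.
Proof. by move=> *; apply: linP => u /=; rewrite scalerDl. Qed.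
HB.instance Definition _ :=
  GRing.Zmodule_isLmodule.Build K lin_of linZA linZ1 linZDr linZDl.

Definition lin : lmodType K := lin_of.

Lemma linDE (f g : lin) u : lin_fun (f + g) u = lin_fun f u + lin_fun g u.
Proof. by []. Qed.
Lemma linZE k (f : lin) u : lin_fun (k *: f) u = k *: lin_fun f u.
Proof. by []. Qed.

Lemma mkLin_subproof (f : {linear U -> V}) : linear f.
Proof. exact: linearP. Qed.
Definition mkLin (f : {linear U -> V}) : lin := Lin (mkLin_subproof f).
Lemma mkLinE f u : lin_fun (mkLin f) u = f u. Proof. by []. Qed.

Lemma lin_at_subproof (u : U) : linear (fun f : lin => lin_fun f u).
Proof. by []. Qed.
Definition lin_at u : {linear lin -> V} := mklin (lin_at_subproof u).
End Lin.
Arguments lin_fun : simpl never.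
Arguments mkLin : simpl never.

Section LinOps.
Variable K : fieldType.
Implicit Types U V W X : lmodType K.

Lemma tuncurry_subproof U V W (f : {linear U -> lin V W}) v :
  linear (fun u => lin_fun (f u) v).
Proof. by move=> k u u'; rewrite linearP. Qed.
Definition tuncurry U V W (f : {linear U -> lin V W}) : {linear tens U V -> W} :=
  tlift (tuncurry_subproof f).
Lemma tuncurryE U V W (f : {linear U -> lin V W}) u v :
  tuncurry f (tpure u v) = lin_fun (f u) v.
Proof. exact: tliftE. Qed.

Lemma tcurry_subproof U V W (f : {linear tens U V -> W}) :
  linear (fun u => mkLin (f \ol tpurer V u)).
Proof.
move=> k u u'; apply: linP => v; rewrite linDE linZE !mkLinE !lcompE.
by rewrite -linearP -tpure_linl.
Qed.
Definition tcurry U V W (f : {linear tens U V -> W}) : {linear U -> lin V W} :=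
  mklin (tcurry_subproof f).
Lemma tcurryE U V W (f : {linear tens U V -> W}) u v :
  lin_fun (tcurry f u) v = f (tpure u v).
Proof. by []. Qed.

Lemma lin_compl_subproof U V W (g : {linear V -> W}) :
  linear (fun f : lin U V => mkLin (g \ol lin_fun f)).
Proof.
move=> k f f'; apply: linP => u; rewrite linDE linZE !mkLinE !lcompE.
by rewrite -linearP.
Qed.
Definition lin_compl U V W (g : {linear V -> W}) : {linear lin U V -> lin U W} :=
  mklin (@lin_compl_subproof U V W g).
Lemma lin_compr_subproof U V W (f : {linear U -> V}) :
  linear (fun g : lin V W => mkLin (lin_fun g \ol f)).
Proof. by move=> k g g'; apply: linP => u. Qed.
Definition lin_compr U V W (f : {linear U -> V}) : {linear lin V W -> lin U W} :=
  mklin (@lin_compr_subproof U V W f).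
End LinOps.
Arguments tuncurry : simpl never.
Arguments tcurry : simpl never.
Arguments lin_compl : simpl never.
Arguments lin_compr : simpl never.

(** * Coherence and semisimplicity *)

Declare Scope tcat_scope.
Notation "g \oc f" := (mcomp g f) (at level 40, left associativity) : tcat_scope.
Notation "f \ot g" := (mten f g) (at level 35, right associativity) : tcat_scope.
Local Open Scope tcat_scope.

Section Coherence.
Variables (K : fieldType) (C : tensorCategory K).
Implicit Types x y z t : obj C.

Lemma mtenl x x' x'' (y : obj C) (f' : hom C x' x'') (f : hom C x x') :
  (f' \oc f) \ot idm y = (f' \ot idm y) \oc (f \ot idm y).
Proof. by rewrite -mten_comp comp1m. Qed.
Lemma mtenr x x' x'' (y : obj C) (f' : hom C x' x'') (f : hom C x x') :
  idm y \ot (f' \oc f) = (idm y \ot f') \oc (idm y \ot f).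
Proof. by rewrite -mten_comp comp1m. Qed.
Lemma mten_lr x x' y y' (f : hom C x x') (g : hom C y y') :
  (f \ot idm y') \oc (idm x \ot g) = f \ot g.
Proof. by rewrite -mten_comp compm1 comp1m. Qed.
Lemma mten_rl x x' y y' (f : hom C x x') (g : hom C y y') :
  (idm x' \ot g) \oc (f \ot idm y) = f \ot g.
Proof. by rewrite -mten_comp compm1 comp1m. Qed.

Lemma iso_epi x y (e : hom C x y) (e' : hom C y x) : e \oc e' = idm y ->
  forall z (f g : hom C y z), f \oc e = g \oc e -> f = g.
Proof.
by move=> E z f g h; rewrite -(compm1 f) -(compm1 g) -E !compA h.
Qed.
Lemma iso_mono x y (e : hom C x y) (e' : hom C y x) : e' \oc e = idm x ->
  forall z (f g : hom C z x), e \oc f = e \oc g -> f = g.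
Proof.
by move=> E z f g h; rewrite -(comp1m f) -(comp1m g) -E -!compA h.
Qed.

Lemma assocV_nat x x' y y' z z' (f : hom C x x') (g : hom C y y') (h : hom C z z') :
  assocV x' y' z' \oc (f \ot (g \ot h)) = ((f \ot g) \ot h) \oc assocV x y z.
Proof.
apply: (iso_mono (assocK x' y' z')); rewrite !compA assocVK comp1m.
by rewrite assoc_nat -compA assocVK compm1.
Qed.

(** Both sides are inverse to the two composites of the pentagon axiom; [E] is the shorter
    composite, and one-sided cancellation of it identifies the inverses. *)
Lemma pentagonV x y z t :
  assocV (oten x y) z t \oc assocV x y (oten z t) =
  (assocV x y z \ot idm t) \oc assocV x (oten y z) t \oc (idm x \ot assocV y z t).
Proof.
set E := assoc x y (oten z t) \oc assoc (oten x y) z t.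
have e1 : E \oc (assocV (oten x y) z t \oc assocV x y (oten z t)) = idm _.
  by rewrite /E -compA (compA (assoc (oten x y) z t)) assocVK comp1m assocVK.
have e2 : assocV (oten x y) z t \oc assocV x y (oten z t) \oc E = idm _.
  by rewrite /E -compA (compA (assocV x y (oten z t))) assocK comp1m assocK.
apply: (iso_mono e2); rewrite e1 /E pentagon -!compA.
rewrite (compA (assoc x y z \ot _)) -mtenl assocVK mten1 comp1m.
by rewrite (compA (assoc x (oten y z) t)) assocVK comp1m -mtenr assocVK mten1.
Qed.

(** The functor [1 (x) -] is isomorphic to the identity through [lunit], hence faithful; coherence
    identities may thus be checked after tensoring with the unit. *)
Lemma unitl_faithful x y (f g : hom C x y) :
  idm (ounit C) \ot f = idm (ounit C) \ot g -> f = g.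
Proof.
move=> h; apply: (iso_epi (lunitVK x)); by rewrite -!lunit_nat h.
Qed.
Lemma unitr_faithful x y (f g : hom C x y) :
  f \ot idm (ounit C) = g \ot idm (ounit C) -> f = g.
Proof.
move=> h; apply: (iso_epi (runitVK x)); by rewrite -!runit_nat h.
Qed.

(** Kelly's argument: after tensoring with [1] on the left and precomposing with an isomorphism, the
    claim is read off the pentagon for [1, 1, x, y] together with the triangle. *)
Lemma lunit_oten x y :
  lunit (oten x y) \oc assoc (ounit C) x y = lunit x \ot idm y.
Proof.
apply: unitl_faithful.
have e : (assoc (ounit C) (oten (ounit C) x) y \oc (assoc (ounit C) (ounit C) x \ot idm y)) \oc
   ((assocV (ounit C) (ounit C) x \ot idm y) \oc assocV (ounit C) (oten (ounit C) x) y) = idm _.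
  rewrite -compA (compA (assoc _ _ x \ot _)) -mtenl assocVK mten1 comp1m.
  exact: assocVK.
apply: (iso_epi e); rewrite mtenr -(compA (idm _ \ot lunit _)) -pentagon compA (triangle (ounit C) (oten x y)).
rewrite -(mten1 x y) -assoc_nat -(triangle (ounit C) x) mtenl compA assoc_nat.
by rewrite -!compA.
Qed.

Lemma runit_oten x y :
  runit (oten x y) = (idm x \ot runit y) \oc assoc x y (ounit C).
Proof.
apply: unitr_faithful.
apply: (iso_mono (assocK x y (ounit C))).
rewrite -(triangle (oten x y) (ounit C)) -(mten1 x y) compA assoc_nat -compA pentagon.
rewrite compA -mtenr (triangle y (ounit C)) mtenl !compA assoc_nat.
by rewrite -!compA.
Qed.

(** Naturality of [lunit] at [lunit 1] gives [1 (x) lunit 1 = lunit (1 (x) 1)], after which the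
    triangle compares the two unit constraints. *)
Lemma lunit_runit : lunit (ounit C) = runit (ounit C).
Proof.
apply: unitr_faithful.
rewrite -lunit_oten -(triangle (ounit C) (ounit C)); congr (_ \oc _).
apply: (iso_mono (lunitK (ounit C))); exact/esym/lunit_nat.
Qed.

Lemma lunit_otenV x y :
  (lunit x \ot idm y) \oc assocV (ounit C) x y = lunit (oten x y).
Proof. by rewrite -lunit_oten -compA assocVK compm1. Qed.
Lemma triangleV x y :
  (runit x \ot idm y) \oc assocV x (ounit C) y = idm x \ot lunit y.
Proof. by rewrite -(triangle x y) -compA assocVK compm1. Qed.
Lemma runit_otenV x y :
  runit (oten x y) \oc assocV x y (ounit C) = idm x \ot runit y.
Proof. by rewrite runit_oten -compA assocVK compm1. Qed.

Lemma mcompDl x y z (g g' : hom C y z) (f : hom C x y) :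
  (g + g') \oc f = g \oc f + g' \oc f.
Proof. exact: (linearD (mklin (comp_linear_l (z := z) f))). Qed.
Lemma mcompZl x y z k (g : hom C y z) (f : hom C x y) :
  (k *: g) \oc f = k *: (g \oc f).
Proof. exact: (linearZZ (mklin (comp_linear_l (z := z) f))). Qed.
Lemma mcomp0l x y z (f : hom C x y) : (0 : hom C y z) \oc f = 0.
Proof. exact: (linear0 (mklin (comp_linear_l (z := z) f))). Qed.
Lemma mcompZr x y z k (g : hom C y z) (f : hom C x y) :
  g \oc (k *: f) = k *: (g \oc f).
Proof. exact: (linearZZ (mklin (comp_linear_r (x := x) g))). Qed.
Lemma mcomp0r x y z (g : hom C y z) : g \oc (0 : hom C x y) = 0.
Proof. exact: (linear0 (mklin (comp_linear_r (x := x) g))). Qed.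
Lemma mcomp_sumr x y z I (r : seq I) (F : I -> hom C x y) (g : hom C y z) :
  g \oc (\sum_(i <- r) F i) = \sum_(i <- r) (g \oc F i).
Proof. exact: (linear_sum (mklin (comp_linear_r (x := x) g))). Qed.
End Coherence.

(** * Schur's lemma and factorisation through the spectrum *)

Section Schur.
Variables (K : fieldType) (C : tensorCategory K) (S : spectrum C).
Hypothesis ssC : semisimple C.
Hypothesis End_simple :
  forall (x : obj C) (f : hom C x x), simple x -> exists k, f = k *: idm x.
Local Notation so := (@spec_obj K C S).

Lemma schurN (a b : option S) (f : hom C (so a) (so b)) : a <> b -> f = 0.
Proof.
move=> ne; apply: contrapT => nz; apply: ne; apply: spec_inj.
case: ssC => _ _ h; exists f; apply: h nz; exact: spec_simple.
Qed.
Lemma schur1 (a : option S) (f : hom C (so a) (so a)) : exists k, f = k *: idm _.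
Proof. apply: End_simple; exact: spec_simple. Qed.

(** The semisimple decomposition of [x] moved to the chosen representatives. The resulting
    resolution of the identity is what cuts a morphism out of [x] into pieces through simple
    objects. *)
Lemma spec_decomposition (x : obj C) : exists n (v : 'I_n -> option S)
   (inc : forall i, hom C (so (v i)) x) (prj : forall i, hom C x (so (v i))),
   \sum_i (inc i \oc prj i) = idm x.
Proof.
case: ssC => _ /(_ x) [n [s [hs [inc [prj [_ _ h]]]]]] _.
pose P i (v : option S) := isomorphic (s i) (so v).
have /choice [v hv] i : exists v, P i v by exact: spec_surj (hs i).
pose Q i (e : hom C (s i) (so (v i)) * hom C (so (v i)) (s i)) :=
  e.2 \oc e.1 = idm _.
have [e he] : exists e, forall i, Q i (e i).
  have H i : {e | Q i e}.
    by apply: cid; have [f [g [h1 h2]]] := hv i; exists (f, g).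
  by exists (fun i => sval (H i)) => i; exact: svalP.
exists n, v, (fun i => inc i \oc (e i).2), (fun i => (e i).1 \oc prj i).
rewrite -h; apply: eq_bigr => i _.
by rewrite -compA (compA (e i).2) he comp1m.
Qed.

Section Eval.
Variables (F : obj C -> obj C) (Fm : forall x y, hom C x y -> hom C (F x) (F y)).
Hypothesis Fm_lin : forall x y, linear (@Fm x y).
Hypothesis Fm1 : forall x, Fm (idm x) = idm (F x).
Hypothesis FmM : forall x y z (g : hom C y z) (f : hom C x y),
  Fm (g \oc f) = Fm g \oc Fm f.
Variables (Y e : obj C).

Definition ev_sum : lmodType K :=
  dsum (fun v : option S => tens (hom C Y (so v)) (hom C (F (so v)) e)).

Lemma evF_subproof v (g : hom C (F (so v)) e) :
  linear (fun f : hom C Y (so v) => mklin (comp_linear_l (z := e) (Fm f)) g).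
Proof. by move=> k f f' /=; rewrite Fm_lin comp_linear_r. Qed.
(** The comparison [(+)_v Hom(Y,v) (x) Hom(F v,e) -> Hom(F Y,e)] for a linear functor [F], a
    co-Yoneda map over the simple objects. With [F = - (x) c] and [F = a (x) -] it yields the two
    identifications that define [alpha]; the second one also serves to unroll morphisms into
    steps. *)
Definition evF : {linear ev_sum -> hom C (F Y) e} :=
  dlift (fun v => tlift (@evF_subproof v)).
Lemma evFE v (f : hom C Y (so v)) (g : hom C (F (so v)) e) :
  evF (dinj v (tpure f g)) = g \oc Fm f.
Proof. by rewrite /evF dlift_inj tliftE. Qed.

(** By Schur a morphism between representatives is zero or a scalar, and scalars pass through the
    tensor sign. *)
Lemma dinj_slide v v' (p : hom C Y (so v')) (i : hom C (so v') (so v))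
   (g : hom C (F (so v)) e) :
  dinj v' (tpure p (g \oc Fm i)) = dinj v (tpure (i \oc p) g) :> ev_sum.
Proof.
have [E|ne] := pselect (v' = v); last first.
  rewrite (schurN i ne) mcomp0l tpure0l (linear0 (dinj v)).
  have -> : Fm (0 : hom C (so v') (so v)) = 0.
    by have := @Fm_lin (so v') (so v) (-1) 0 0; rewrite scaler0 addr0 scaleN1r addNr.
  by rewrite mcomp0r tpure0r linear0.
subst v'; have [k ->] := schur1 i.
have -> : Fm (k *: idm (so v)) = k *: idm _.
  by rewrite -Fm1; exact: (linearZZ (mklin (@Fm_lin (so v) (so v)))).
by rewrite mcompZr compm1 mcompZl comp1m tpureZr tpureZl.
Qed.

(** The inverse cuts [phi] along a resolution of the identity of [Y]. Sliding [f inc] across the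
    tensor sign brings the pieces of [g (F f)] back into the summand of [f], where they add up. *)
Lemma evF_bij : bijective evF.
Proof.
have [n [v [inc [prj h]]]] := spec_decomposition Y.
have lin_inv : linear (fun phi : hom C (F Y) e =>
    \sum_i dinj (v i) (tpure (prj i) (phi \oc Fm (inc i))) : ev_sum).
  move=> k f f'; rewrite scaler_sumr -big_split; apply: eq_bigr => i _.
  by rewrite mcompDl mcompZl tpureDr tpureZr linearP.
apply: (@bij_cancel _ _ _ _ (mklin lin_inv)).
- apply: dtens_ext => u f g; rewrite lcompE evFE mklinE lidE.
  rewrite (eq_bigr (fun i => dinj u (tpure (f \oc inc i \oc prj i) g))).
    rewrite -linear_sum -tpure_suml.
    rewrite (eq_bigr (fun i => f \oc (inc i \oc prj i))).
      by rewrite -mcomp_sumr h compm1.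
    by move=> i _; rewrite compA.
  by move=> i _; rewrite -compA -FmM dinj_slide.
- move=> phi; rewrite lcompE mklinE linear_sum lidE.
  rewrite (eq_bigr (fun i => phi \oc Fm (inc i \oc prj i))); last first.
    by move=> i _; rewrite evFE FmM compA.
  rewrite -mcomp_sumr -[in RHS](compm1 phi) -Fm1 -h.
  by rewrite -[Fm (\sum_i _)]/(mklin (@Fm_lin _ _) _) linear_sum.
Qed.
End Eval.

Lemma evalR_pure a b c d v (f : bracket b c v) (g : bracket a v d) :
  evalR a b c d (baseR_in a b c d v (tpure f g)) = g \oc (idm (so a) \ot f).
Proof. by rewrite /evalR /baseR_in dlift_inj tliftE. Qed.
Lemma evalL_pure a b c d u (f : bracket a b u) (g : bracket u c d) :
  evalL a b c d (baseL_in a b c d u (tpure f g)) = g \oc (f \ot idm (so c)).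
Proof. by rewrite /evalL /baseL_in dlift_inj tliftE. Qed.

Lemma evalR_bij a b c d : bijective (@evalR K C S a b c d).
Proof.
have h := @evF_bij (oten (so a)) (fun x y f => idm (so a) \ot f)
  (fun x y => mten_linear_r _) (fun x => mten1 _ _) (fun x y z g f => mtenr _ g f)
  (oten (so b) (so c)) (so d).
apply: eq_bij_lin h; apply: dtens_ext => v f g.
rewrite evFE; exact: evalR_pure.
Qed.
Lemma evalL_bij a b c d : bijective (@evalL K C S a b c d).
Proof.
have h := @evF_bij (fun x => oten x (so c)) (fun x y f => f \ot idm (so c))
  (fun x y => mten_linear_l _) (fun x => mten1 _ _) (fun x y z g f => mtenl _ g f)
  (oten (so a) (so b)) (so d).
apply: eq_bij_lin h; apply: dtens_ext => v f g.
rewrite evFE; exact: evalL_pure.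
Qed.

Lemma base_assocP a b c d (m : baseL a b c d) :
  evalR a b c d (base_assoc a b c d m) = evalL a b c d m \oc assocV (so a) (so b) (so c).
Proof. by rewrite /base_assoc 2!lcompE linvVK //; exact: evalR_bij. Qed.

Lemma base_assoc_bij a b c d : bijective (@base_assoc K C S a b c d).
Proof.
rewrite /base_assoc; apply: bij_lcomp; last exact: evalL_bij.
apply: bij_lcomp; first by apply: linv_bij; exact: evalR_bij.
exists (fun f => f \oc assoc _ _ _) => f /=.
  by rewrite -compA assocK compm1.
by rewrite -compA assocVK compm1.
Qed.

(** This lemma and the next three are the identifications of [[1 b; c]] and [[a 1; c]] with a line
    or zero by means of the unit constraints. *)
Lemma bracket_lunitN (b c : option S) (f : bracket None b c) : b <> c -> f = 0.
Proof.
move=> ne; have <- : (f \oc lunitV (so b)) \oc lunit (so b) = f by rewrite -compA lunitK compm1.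
by rewrite (schurN (f \oc lunitV (so b)) ne) mcomp0l.
Qed.
Lemma bracket_lunit1 (b : option S) (f : bracket None b b) :
  exists k, f = k *: lunit (so b).
Proof.
have [k e] := schur1 (f \oc lunitV (so b)); exists k.
have <- : (f \oc lunitV (so b)) \oc lunit (so b) = f by rewrite -compA lunitK compm1.
by rewrite e mcompZl comp1m.
Qed.
Lemma bracket_runitN (a c : option S) (f : bracket a None c) : a <> c -> f = 0.
Proof.
move=> ne; have <- : (f \oc runitV (so a)) \oc runit (so a) = f by rewrite -compA runitK compm1.
by rewrite (schurN (f \oc runitV (so a)) ne) mcomp0l.
Qed.
Lemma bracket_runit1 (a : option S) (f : bracket a None a) :
  exists k, f = k *: runit (so a).
Proof.
have [k e] := schur1 (f \oc runitV (so a)); exists k.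
have <- : (f \oc runitV (so a)) \oc runit (so a) = f by rewrite -compA runitK compm1.
by rewrite e mcompZl comp1m.
Qed.
Lemma idm_spec_neq0 (a : option S) : idm (so a) <> 0.
Proof. by case: (spec_simple a). Qed.
Lemma lunit_neq0 (a : option S) : lunit (so a) <> 0.
Proof. by move=> e; apply: (@idm_spec_neq0 a); rewrite -lunitVK e mcomp0l. Qed.
Lemma runit_neq0 (a : option S) : runit (so a) <> 0.
Proof. by move=> e; apply: (@idm_spec_neq0 a); rewrite -runitVK e mcomp0l. Qed.
End Schur.

(** * Endomorphisms of simple objects over an algebraically closed field *)

Section ClosedField.
Import VectorInternalTheory.

(** An eigenvalue [a] of left composition by [f] on the finite-dimensional space [End(x)] provides
    [g <> 0] with [(f - a) g = 0]. Hence [f - a] is not invertible, and Schur makes it zero. *)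
Lemma closed_End_simple (F : closedFieldType) (C : tensorCategory F) :
  semisimple C ->
  forall (x : obj C) (f : hom C x x), simple x -> exists k, f = k *: idm x.
Proof.
case=> _ _ schur x f sx; have [id0 _] := sx.
pose L := linfun (mklin (comp_linear_r (x := x) f)).
pose A := lin1_mx (v2r \o L \o r2v).
(* The dimension is positive because [idm x <> 0]; in dimension 0 the characteristic polynomial is
   constant and has no root. *)
have n0 : (0 < dim (hom C x x))%N.
  rewrite lt0n; apply/negP => /eqP n0; apply: id0; apply: (@v2r_inj _ (hom C x x)).
  apply/rowP => i; suff: False by [].
  by case: i => i; rewrite [X in (_ < X)%N]n0.
have [a ra] : exists a, root (char_poly A) a.
  by apply/closed_rootP; rewrite size_char_poly; case: (dim _) n0.
move: ra; rewrite -eigenvalue_root_char => /eigenvalueP[v Av v0].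
exists a; apply: contrapT => ne.
pose g := r2v v : hom C x x.
have fg : (f - a *: idm x) \oc g = 0.
  rewrite mcompDl -scaleN1r mcompZl scaleN1r mcompZl comp1m.
  apply/eqP; rewrite subr_eq0; apply/eqP; apply: (@v2r_inj _ (hom C x x)).
  rewrite linearZ /= /g r2vK -Av /A mul_rV_lin1 /= lfunE /=.
  by [].
have [|h [h1 _]] := schur x x (f - a *: idm x) sx sx.
  by move/eqP; rewrite subr_eq0 => /eqP.
move/negP: v0; apply; apply/eqP.
rewrite -[v](r2vK (vT := hom C x x)) -/g -[g]comp1m -h1 -compA fg mcomp0r.
exact: linear0.
Qed.

End ClosedField.

(** * Paths *)

Section Model.
Variables (K : fieldType) (C D : tensorCategory K) (S : spectrum C) (T : spectrum D).
Local Notation letter := (letter S T).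

Definition tc (sd : bool) : tensorCategory K := if sd then C else D.
Definition sp (sd : bool) : spectrum (tc sd) :=
  if sd return spectrum (tc sd) then S else T.
Local Notation so := spec_obj.

Definition mk (sd : bool) : sp sd -> letter :=
  if sd return sp sd -> letter then fun s => inl s else fun t => inr t.
Definition unmk (sd : bool) (l : letter) : option (sp sd) :=
  match sd return option (sp sd) with
  | true => if l is inl s then Some s else None
  | false => if l is inr t then Some t else None
  end.
Definition hd sd (w : seq letter) : option (sp sd) :=
  if w is l :: _ then unmk sd l else None.
Definition tl sd (w : seq letter) : seq letter :=
  if w is l :: w' then if unmk sd l then w' else w else w.
Definition ocons sd (o : option (sp sd)) (y : seq letter) : seq letter :=
  if o is Some s then mk s :: y else y.
Arguments ocons : clear implicits.
Definition gd sd (y : seq letter) : bool :=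
  if y is l :: _ then ~~ isSome (unmk sd l) else true.

Arguments unmk : clear implicits.
Arguments hd : clear implicits.
Arguments tl : clear implicits.
Lemma mkK sd (s : sp sd) : unmk sd (mk s) = Some s.
Proof. by case: sd s. Qed.
Lemma unmkK sd l s : unmk sd l = Some s -> mk s = l.
Proof. by case: sd s => s; case: l => l //= [->]. Qed.
Lemma ocons_hd_tl sd w : ocons sd (hd sd w) (tl sd w) = w.
Proof.
case: w => //= l w; case e: (unmk sd l) => [s|] //=.
by rewrite (unmkK e).
Qed.
Lemma hd_ocons sd o y : gd sd y -> hd sd (ocons sd o y) = o.
Proof.
case: o => [s|] /=; first by rewrite mkK.
by case: y => //= l y; case: (unmk sd l).
Qed.
Lemma tl_ocons sd o y : gd sd y -> tl sd (ocons sd o y) = y.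
Proof.
case: o => [s|] /=; first by rewrite mkK.
by case: y => //= l y; case: (unmk sd l).
Qed.

Definition lab : choiceType := {sd : bool & sp sd}.
Definition Lb sd (a : sp sd) : lab := Tagged (fun sd => sp sd : Type) a.

(** Adding, fusing and cancelling a letter are the cases ([None], [Some]), ([Some], [Some]) and
    ([Some], [None]) of a single hom space. *)
Definition stp (l : lab) (o o' : option (sp (tag l))) : lmodType K :=
  @bracket K (tc (tag l)) (sp (tag l)) (Some (tagged l)) o o'.
Arguments stp : clear implicits.
Definition jdx (l : lab) : choiceType :=
  (seq letter * option (sp (tag l)) * option (sp (tag l)))%type.

(** The index [j = (y, o, o')] records how the words before and after the last step are cut. The
    guard makes the step end at [w], and [gd] makes the cutting of [w] unique for a given label. *)
Fixpoint pth (n : nat) (w : seq letter) : lmodType K :=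
  match n with
  | 0 => guard (w == [::]) K^o
  | n'.+1 => dsum (fun l : lab => dsum (fun j : jdx l =>
       guard (gd (tag l) j.1.1 && (ocons (tag l) j.2 j.1.1 == w))
         (tens (stp l j.1.2 j.2) (pth n' (ocons (tag l) j.1.2 j.1.1)))))
  end.
Definition pat (w : seq letter) : lmodType K := dsum (fun n => pth n w).

Definition Om : pat [::] := dinj (V := fun n => pth n [::]) 0%N (1 : K^o).

Definition pinj n l w (j : jdx l) :
  {linear tens (stp l j.1.2 j.2) (pth n (ocons (tag l) j.1.2 j.1.1)) -> pat w} :=
  @dinj K nat (fun n => pth n w) n.+1 \ol
  @dinj K lab (fun l : lab => dsum (fun j : jdx l =>
       guard (gd (tag l) j.1.1 && (ocons (tag l) j.2 j.1.1 == w))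
         (tens (stp l j.1.2 j.2) (pth n (ocons (tag l) j.1.2 j.1.1))))) l \ol
  @dinj K (jdx l) (fun j : jdx l =>
       guard (gd (tag l) j.1.1 && (ocons (tag l) j.2 j.1.1 == w))
         (tens (stp l j.1.2 j.2) (pth n (ocons (tag l) j.1.2 j.1.1)))) j \ol
  guard_in _.

(** Defined for every [y], and zero when [gd] fails ([pcons_bad]), so that most formulas about steps
    hold without a side condition. *)
Definition pcons (l : lab) y (o o' : option (sp (tag l))) :
    {linear tens (stp l o o') (pat (ocons (tag l) o y)) -> pat (ocons (tag l) o' y)} :=
  tdsumr (fun n => @pinj n l (ocons (tag l) o' y) (y, o, o')).

Arguments pcons : clear implicits.
Arguments pinj : clear implicits.
Lemma pcons_bad l y (o o' : option (sp (tag l))) t :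
  ~~ gd (tag l) y -> pcons l y o o' t = 0.
Proof.
move=> h; apply: (@tens_ext _ _ _ _ (pcons l y o o') lzero) => g b.
apply: (@dsum_ext _ _ _ _ (pcons l y o o' \ol tpurer _ g) lzero) => n v.
rewrite lcompE [LHS]tdsumrE /pinj 3!lcompE.
have -> : forall x, @guard_in K (gd (tag l) (y, o, o').1.1 &&
    (ocons (tag l) (y, o, o').2 (y, o, o').1.1 == ocons (tag l) o' y)) (tens (stp l o o') (pth n (ocons (tag l) o y))) x = 0.
  by move=> x; apply: guard0; rewrite /= negb_and h.
by rewrite !linear0.
Qed.

Section Elim.
Variables (X : seq letter -> lmodType K) (v0 : X [::]).
Definition stpmap (l : lab) : Type := forall y (o o' : option (sp (tag l))),
  {linear tens (stp l o o') (pat (ocons (tag l) o y)) -> X (ocons (tag l) o' y)}.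
Variable phi : forall l, stpmap l.

(** Case analysis on the last step rather than recursion: [phi] receives the whole path below that
    step. Its extensionality companion is [pat_ext]. *)
Definition telim_n w n : {linear pth n w -> X w} :=
  match n return {linear pth n w -> X w} with
  | 0 => vec (transport X [::] w v0) \ol guard_out _
  | n'.+1 => dlift (fun l => dlift (fun j : jdx l =>
      transport X (ocons (tag l) j.2 j.1.1) w \ol @phi l j.1.1 j.1.2 j.2
        \ol tmap lid (@dinj K nat (fun n => pth n (ocons (tag l) j.1.2 j.1.1)) n') \ol guard_out _))
  end.
Definition telim w : {linear pat w -> X w} := dlift (telim_n w).

Lemma telim_Om : telim [::] Om = v0.
Proof. by rewrite /telim dlift_inj /= transportE scale1r. Qed.

Lemma telim_cons l y (o o' : option (sp (tag l))) t : gd (tag l) y ->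
  telim (ocons (tag l) o' y) (pcons l y o o' t) = @phi l y o o' t.
Proof.
move=> h; move: t; apply: (@tens_ext _ _ _ _ (telim _ \ol pcons l y o o') (@phi l y o o')) => g b.
apply: (@dsum_ext _ _ _ _ (telim _ \ol pcons l y o o' \ol tpurer _ g) (@phi l y o o' \ol tpurer _ g)) => n v.
rewrite 2!lcompE [X in telim _ X]tdsumrE /pinj 3!lcompE.
rewrite /telim dlift_inj dlift_inj dlift_inj 3!lcompE guard_inK; last by rewrite /= h eqxx.
by rewrite tmapE transportE.
Qed.
End Elim.

Lemma pat_ext (X : seq letter -> lmodType K) (f g : forall w, {linear pat w -> X w}) :
  f [::] Om = g [::] Om ->
  (forall l y (o o' : option (sp (tag l))) h t, gd (tag l) y ->
     f _ (pcons l y o o' (tpure h t)) = g _ (pcons l y o o' (tpure h t))) ->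
  forall w, f w =1 g w.
Proof.
move=> h0 h1 w; apply: dsum_ext => -[|n] v.
  have [e|ne] := eqVneq w [::]; last by rewrite [v]guard0 // !linear0.
  subst w; have -> : v = (v : K) *: (1 : K^o) by rewrite /GRing.scale /= mulr1.
  by rewrite [dinj _ _]linearZZ !linearZZ; congr (_ *: _).
move: v; apply: (@dsum_ext _ _ _ _ (f w \ol dinj n.+1) (g w \ol dinj n.+1)) => l v.
move: v; apply: (@dsum_ext _ _ _ _ (f w \ol dinj n.+1 \ol dinj l)
   (g w \ol dinj n.+1 \ol dinj l)) => -[[y o] o'] v.
have [/andP[gy /eqP e]|/negP ne] := pselect (gd (tag l) y && (ocons (tag l) o' y == w) = true); last first.
  by rewrite [v]guard0 // !linear0.
rewrite -[v]guard_outK; move: (guard_out _ v) => {}v /=.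
move: v; apply: (@tens_ext _ _ _ _ (f w \ol pinj n l w (y, o, o')) (g w \ol pinj n l w (y, o, o'))) => a b.
subst w; have := h1 l y o o' a (dinj n b) gy.
by rewrite tdsumrE.
Qed.

End Model.
Arguments tc {K} C D sd.
Arguments sp {K C D} S T sd.
Arguments mk {K C D S T} sd s.
Arguments unmk {K C D S T} sd l.
Arguments hd {K C D S T} sd w.
Arguments tl {K C D S T} sd w.
Arguments gd {K C D S T} sd y.
Arguments ocons {K C D S T} sd o y.
Arguments Lb {K C D S T} sd a.
Arguments stp {K C D S T} l o o'.
Arguments pcons {K C D S T} l y o o'.
Arguments Om {K C D S T}.

(** * Operators on paths *)

Section Operators.
Variables (K : fieldType) (C D : tensorCategory K) (S : spectrum C) (T : spectrum D).
Local Notation letter := (letter S T).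
Local Notation pat := (@pat K C D S T).




Local Notation lab := (@lab K C D S T).


(* The scalar prescribes the action of [shift O] on the empty path, so that    *)
(* [shift] is linear and unital.                                               *)
Record op_of := Op { opr : forall w, lin (pat w) (pat w); opc : K }.
HB.instance Definition _ := gen_eqMixin op_of.
HB.instance Definition _ := gen_choiceMixin op_of.

Definition oact (O : op_of) w : {linear pat w -> pat w} := lin_fun (opr O w).

Lemma opP (O O' : op_of) : (forall w, oact O w =1 oact O' w) -> opc O = opc O' -> O = O'.
Proof.
case: O O' => [f c] [f' c'] /= e ->; congr Op.
by apply: functional_extensionality_dep => w; apply: linP => t; exact: e.
Qed.

Let oadd (O O' : op_of) := Op (fun w => opr O w + opr O' w) (opc O + opc O').
Let oopp (O : op_of) := Op (fun w => - opr O w) (- opc O).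
Let ozero := Op (fun w => 0) 0.
Let oscale k (O : op_of) := Op (fun w => k *: opr O w) (k * opc O).
Let eqop (O O' : op_of) : (forall w, opr O w = opr O' w) -> opc O = opc O' -> O = O'.
Proof. by move=> e; apply: opP => w t; rewrite /oact e. Qed.
Let oaddA : associative oadd.
Proof. by move=> *; apply: eqop => [w|] /=; rewrite addrA. Qed.
Let oaddC : commutative oadd.
Proof. by move=> *; apply: eqop => [w|] /=; rewrite addrC. Qed.
Let oadd0 : left_id ozero oadd.
Proof. by move=> *; apply: eqop => [w|] /=; rewrite add0r. Qed.
Let oaddN : left_inverse ozero oopp oadd.
Proof. by move=> *; apply: eqop => [w|] /=; rewrite addNr. Qed.
HB.instance Definition _ := GRing.isZmodule.Build op_of oaddA oaddC oadd0 oaddN.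
Let oscaleA a b O : oscale a (oscale b O) = oscale (a * b) O.
Proof. by apply: eqop => [w|] /=; rewrite ?scalerA ?mulrA. Qed.
Let oscale1 : left_id 1 oscale.
Proof. by move=> *; apply: eqop => [w|] /=; rewrite ?scale1r ?mul1r. Qed.
Let oscaleDr : right_distributive oscale +%R.
Proof. by move=> *; apply: eqop => [w|] /=; rewrite ?scalerDr ?mulrDr. Qed.
Let oscaleDl s : {morph oscale^~ s : a b / a + b}.
Proof. by move=> *; apply: eqop => [w|] /=; rewrite ?scalerDl ?mulrDl. Qed.
HB.instance Definition _ :=
  GRing.Zmodule_isLmodule.Build K op_of oscaleA oscale1 oscaleDr oscaleDl.
Definition op : lmodType K := op_of.

Lemma oactP k (O O' : op) w t : oact (k *: O + O') w t = k *: oact O w t + oact O' w t.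
Proof. by []. Qed.
Lemma opcP k (O O' : op) : opc (k *: O + O') = k * opc O + opc O'.
Proof. by []. Qed.

Definition oid : op := Op (fun w => mkLin lid) 1.
Definition ocomp (O O' : op) : op :=
  Op (fun w => mkLin (oact O w \ol oact O' w)) (opc O * opc O').

Lemma oact_id w t : oact oid w t = t. Proof. by []. Qed.
Lemma oact_comp O O' w t : oact (ocomp O O') w t = oact O w (oact O' w t).
Proof. by []. Qed.

Lemma ocompA O1 O2 O3 : ocomp O1 (ocomp O2 O3) = ocomp (ocomp O1 O2) O3.
Proof. by apply: opP => //=; rewrite mulrA. Qed.
Lemma ocomp1l O : ocomp oid O = O.
Proof. by apply: opP => //=; rewrite mul1r. Qed.
Lemma ocomp1r O : ocomp O oid = O.
Proof. by apply: opP => //=; rewrite mulr1. Qed.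
Lemma ocomp_linl O' : linear (fun O => ocomp O O').
Proof. by move=> k f g; apply: opP => //=; rewrite mulrDl mulrA. Qed.
Lemma ocomp_linr O : linear (ocomp O).
Proof.
move=> k f g; apply: opP => [w t|/=].
  by rewrite oactP !oact_comp oactP linearP.
by rewrite mulrDr !mulrA [_ * k]mulrC.
Qed.
Definition ocompl O : {linear op -> op} := mklin (ocomp_linr O).
Definition ocompr O' : {linear op -> op} := mklin (ocomp_linl O').
Lemma ocomp0l O : ocomp 0 O = 0.
Proof. exact: (linear0 (ocompr O)). Qed.
Lemma ocomp0r O : ocomp O 0 = 0.
Proof. exact: (linear0 (ocompl O)). Qed.
Lemma ocompZl k O O1 : ocomp (k *: O) O1 = k *: ocomp O O1.
Proof. exact: (linearZZ (ocompr O1)). Qed.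
Lemma ocompZr k O O1 : ocomp O1 (k *: O) = k *: ocomp O1 O.
Proof. exact: (linearZZ (ocompl O1)). Qed.

Definition shift_fun (O : op) : op :=
  Op (fun w => mkLin (telim (X := pat) (opc O *: Om)
        (fun l y o o' => pcons l y o o' \ol tmap lid (oact O (ocons (tag l) o y))) w))
     (opc O).
Let shift_fun_Om O : oact (shift_fun O) [::] Om = opc O *: Om.
Proof. by rewrite /oact mkLinE telim_Om. Qed.
Let shift_fun_cons O l y (o o' : option (sp S T (tag l))) h t :
  oact (shift_fun O) _ (pcons l y o o' (tpure h t)) =
  pcons l y o o' (tpure h (oact O _ t)).
Proof.
have [g|g] := boolP (gd (tag l) y); last by rewrite !pcons_bad // linear0.
by rewrite /oact mkLinE telim_cons // lcompE tmapE.
Qed.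
Lemma shift_lin : linear shift_fun.
Proof.
move=> k O O'; apply: opP => // w.
apply: (@pat_ext K C D S T pat (oact (shift_fun (k *: O + O'))) (oact (k *: (shift_fun O : op) + (shift_fun O')))) w.
  by rewrite oactP !shift_fun_Om opcP scalerDl scalerA.
move=> l y o o' h t g; rewrite oactP !shift_fun_cons oactP.
by rewrite tpureDr tpureZr linearP.
Qed.
(* Hidden behind a [Qed] so that conversion does not unfold [shift]. *)
Fact shift_key : {f : {linear op -> op} | forall O, f O = shift_fun O}.
Proof. by exists (mklin shift_lin). Qed.
Definition shift : {linear op -> op} := sval shift_key.
Let shiftE O : shift O = shift_fun O. Proof. exact: (svalP shift_key). Qed.
Lemma shift_Om O : oact (shift O) [::] Om = opc O *: Om.
Proof. by rewrite shiftE shift_fun_Om. Qed.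
Lemma shift_opc O : opc (shift O) = opc O. Proof. by rewrite shiftE. Qed.
Lemma shift_cons O l y (o o' : option (sp S T (tag l))) h t :
  oact (shift O) _ (pcons l y o o' (tpure h t)) = pcons l y o o' (tpure h (oact O _ t)).
Proof. by rewrite shiftE shift_fun_cons. Qed.
Fact shiftn_key : {f : nat -> {linear op -> op} |
  (forall O, f 0%N O = O) /\ forall n O, f n.+1 O = shift (f n O)}.
Proof. by exists (fun n => iter n (fun f => shift \ol f) lid). Qed.
Definition shiftn : nat -> {linear op -> op} := sval shiftn_key.
Lemma shiftn0 O : shiftn 0 O = O.
Proof. by have [h _] := svalP shiftn_key; exact: h. Qed.
Lemma shiftnS n O : shiftn n.+1 O = shift (shiftn n O).
Proof. by have [_ h] := svalP shiftn_key; exact: h. Qed.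

Lemma shift1 : shift oid = oid.
Proof.
apply: opP => [w|]; last by rewrite shift_opc.
apply: (@pat_ext K C D S T pat (oact (shift oid)) (oact oid)) w.
  by rewrite shift_Om scale1r.
by move=> l y o o' h t g; rewrite shift_cons.
Qed.
Lemma shiftM O O' : shift (ocomp O O') = ocomp (shift O) (shift O').
Proof.
apply: opP => [w|]; last by rewrite /= !shift_opc.
apply: (@pat_ext K C D S T pat (oact (shift (ocomp O O')))
   (oact (ocomp (shift O) (shift O')))) w.
  by rewrite oact_comp !shift_Om linearZZ shift_Om scalerA mulrC.
by move=> l y o o' h t g; rewrite oact_comp !shift_cons oact_comp.
Qed.

Lemma shiftnSr n O : shiftn n.+1 O = shiftn n (shift O).
Proof.
elim: n => [|n ih]; first by rewrite shiftnS !shiftn0.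
by rewrite shiftnS ih -shiftnS. Qed.
Lemma shiftnD m n O : shiftn (m + n) O = shiftn m (shiftn n O).
Proof. elim: m => [|m ih]; first by rewrite add0n shiftn0.
by rewrite addSn !shiftnS ih. Qed.
Lemma shiftn_id n : shiftn n oid = oid.
Proof. by elim: n => [|n ih]; rewrite ?shiftn0 ?shiftnS ?ih ?shift1. Qed.
Lemma shiftnM n O O' : shiftn n (ocomp O O') = ocomp (shiftn n O) (shiftn n O').
Proof. by elim: n => [|n ih]; rewrite ?shiftn0 ?shiftnS ?ih ?shiftM. Qed.

Lemma omul_subproof (U V : lmodType K) (f : {linear U -> op}) (g : {linear V -> op}) v :
  linear (fun u => (ocompl (f u) \ol g) v).
Proof. by move=> k u u'; rewrite lcompE linearP; exact: ocomp_linl. Qed.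
Definition omul (U V : lmodType K) (f : {linear U -> op}) (g : {linear V -> op}) :
  {linear tens U V -> op} := tlift (omul_subproof f g).
Lemma omulE (U V : lmodType K) (f : {linear U -> op}) (g : {linear V -> op}) u v :
  omul f g (tpure u v) = ocomp (f u) (g v).
Proof. exact: tliftE. Qed.

(** Extends a rule for steps labelled [l] by zero to all labels. The type of a step depends on its
    label, so the rule has to be transported along the equality of labels. *)
Definition at_lab (X : seq letter -> lmodType K) (l : lab) (phi : stpmap (S:=S) (T:=T) X l) (l' : lab) :
   stpmap X l' :=
  match l =P l' with
  | ReflectT e => eq_rect l (stpmap X) phi l' e
  | ReflectF _ => fun y o o' => lzero
  end.
Lemma at_labE X l (phi : stpmap X l) y o o' : at_lab phi y o o' = phi y o o'.
Proof. by rewrite /at_lab; case: eqP => // e; rewrite (eq_irrelevance e erefl). Qed.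
Lemma at_labN X l (phi : stpmap X l) l' y (o o' : option (sp S T (tag l'))) :
  l <> l' -> at_lab phi y o o' = lzero.
Proof. by rewrite /at_lab; case: eqP. Qed.

(** The projector onto paths whose last label is [l]. The empty path has no label and is killed,
    hence the scalar 0. *)
Definition lam (l : lab) : op :=
  Op (fun w => mkLin (telim (X := pat) 0 (at_lab (fun y o o' => pcons l y o o')) w)) 0.
Lemma lam_Om l : oact (lam l) [::] Om = 0.
Proof. by rewrite /oact mkLinE telim_Om. Qed.
Lemma lam_cons l y (o o' : option (sp S T (tag l))) t :
  oact (lam l) _ (pcons l y o o' t) = pcons l y o o' t.
Proof.
have [g|g] := boolP (gd (tag l) y); last by rewrite !pcons_bad // linear0.
by rewrite /oact mkLinE telim_cons // at_labE.
Qed.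
Lemma lam_consN l l' y (o o' : option (sp S T (tag l'))) t :
  l <> l' -> oact (lam l) _ (pcons l' y o o' t) = 0.
Proof.
move=> ne.
have [g|g] := boolP (gd (tag l') y); last by rewrite !pcons_bad // linear0.
by rewrite /oact mkLinE telim_cons // at_labN.
Qed.
(** One factor looks only at the last label, the other acts only below it. *)
Lemma lam_shift l O : ocomp (lam l) (shift O) = ocomp (shift O) (lam l).
Proof.
apply: opP => [w|/=]; last by rewrite mul0r mulr0.
apply: (@pat_ext K C D S T pat (oact (ocomp (lam l) (shift O)))
   (oact (ocomp (shift O) (lam l)))) w.
  by rewrite !oact_comp !shift_Om linearZZ !lam_Om ?linear0 ?scaler0.
move=> l' y o o' h t g; rewrite !oact_comp shift_cons.
have [e|ne] := pselect (l = l'); last by rewrite !lam_consN // linear0.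
by subst l'; rewrite !lam_cons shift_cons.
Qed.
Lemma lam_idem l : ocomp (lam l) (lam l) = lam l.
Proof.
apply: opP => [w|/=]; last by rewrite mulr0.
apply: (@pat_ext K C D S T pat (oact (ocomp (lam l) (lam l))) (oact (lam l))) w.
  by rewrite !oact_comp !lam_Om linear0.
move=> l' y o o' h t g; rewrite !oact_comp.
have [e|ne] := pselect (l = l'); last by rewrite !lam_consN // linear0.
by subst l'; rewrite !lam_cons.
Qed.
End Operators.
Arguments shift {K C D S T}.
Arguments shiftn {K C D S T} n.
Arguments ocomp {K C D S T} : simpl never.
Arguments oid {K C D S T} : simpl never.
Arguments omul {K C D S T U V} : simpl never.

(** * The action of letters *)

Section Theta.
Variables (K : fieldType) (C D : tensorCategory K) (S : spectrum C) (T : spectrum D).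
Hypotheses (ssC : semisimple C) (ssD : semisimple D).
Hypothesis EndC :
  forall (x : obj C) (f : hom C x x), simple x -> exists k, f = k *: idm x.
Hypothesis EndD :
  forall (x : obj D) (f : hom D x x), simple x -> exists k, f = k *: idm x.
Local Notation letter := (letter S T).
Local Notation pat := (@pat K C D S T).
Local Notation lab := (@lab K C D S T).
Local Notation op := (@op K C D S T).
Local Notation tc := (@tc K C D).
Local Notation sp := (@sp K C D S T).
Local Notation so sd o := (@spec_obj K (tc sd) (sp sd) o).
Local Notation osp sd := (option (sp sd)).

Lemma sstc sd : semisimple (tc sd).
Proof. by case: sd. Qed.
Lemma Endtc sd (x : obj (tc sd)) (f : hom (tc sd) x x) :
  simple x -> exists k, f = k *: idm x.
Proof. by case: sd x f => x f; [exact: EndC | exact: EndD]. Qed.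

Section OneSide.
Variable sd : bool.
Implicit Types (a b c : sp sd) (o e d v : osp sd) (Y : obj (tc sd)).

Lemma shift_consL O a y o o' h t :
  oact (shift O) (ocons sd o' y) (pcons (Lb sd a) y o o' (tpure h t)) =
  pcons (Lb sd a) y o o' (tpure h (oact O (ocons sd o y) t)).
Proof. exact: (@shift_cons K C D S T O (Lb sd a)). Qed.
Lemma lam_consL a y o o' t :
  oact (lam (Lb sd a)) (ocons sd o' y) (pcons (Lb sd a) y o o' t) =
  pcons (Lb sd a) y o o' t.
Proof. exact: (@lam_cons K C D S T (Lb sd a)). Qed.

Definition evX a Y e :=
  @evF K (tc sd) (sp sd) (fun x => oten (so sd (Some a)) x)
    (fun x y f => idm (so sd (Some a)) \ot f)
    (fun x y => mten_linear_r _) Y (so sd e).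

Lemma evX_bij a Y e : bijective (evX a Y e).
Proof.
apply: evF_bij; [exact: sstc | exact: Endtc | exact: mten1 | ].
by move=> x y z g f; exact: mtenr.
Qed.

(** By semisimplicity every morphism out of [a (x) Y] is a sum of morphisms [g (1 (x) f)] factoring
    through simple objects; identities between unrolled operators are tested on these. *)
Lemma hom_oten_ext a Y e (W : lmodType K)
    (F G : {linear hom (tc sd) (oten (so sd (Some a)) Y) (so sd e) -> W}) :
  (forall v (f : hom (tc sd) Y (so sd v)) (g : hom (tc sd) (oten (so sd (Some a)) (so sd v)) (so sd e)),
    F (g \oc (idm _ \ot f)) = G (g \oc (idm _ \ot f))) -> F =1 G.
Proof.
move=> h phi; have [ev' _ evK] := evX_bij a Y e.
rewrite -(evK phi); move: (ev' phi).
apply: (@dtens_ext _ _ _ _ _ (F \ol evX a Y e) (G \ol evX a Y e)) => v f g.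
by rewrite !lcompE !evFE.
Qed.

Section Unroll.
Variables (y : seq letter) (a : sp sd) (o : osp sd) (Y : obj (tc sd)).
Variable u : forall v, {linear hom (tc sd) Y (so sd v) ->
  lin (pat (ocons sd o y)) (pat (ocons sd v y))}.
Variable e : osp sd.

Definition unroll_in v : {linear tens (hom (tc sd) Y (so sd v))
     (hom (tc sd) (oten (so sd (Some a)) (so sd v)) (so sd e)) ->
   lin (pat (ocons sd o y)) (pat (ocons sd e y))} :=
  tcurry (pcons (Lb sd a) y v e \ol tmap lid (tuncurry (u v)) \ol tassoc _ _ _
    \ol tmap (tswap _ _) lid).

(** Unrolling puts a last step labelled [a] on top of what [u] makes of [Y]. The inverse of [evX]
    writes the given morphism as a sum of [g (1 (x) f)], and this equation on the summands is all
    that is used afterwards. *)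
Fact unroll_key : {U : {linear hom (tc sd) (oten (so sd (Some a)) Y) (so sd e) ->
     lin (pat (ocons sd o y)) (pat (ocons sd e y))} |
  forall v (f : hom (tc sd) Y (so sd v)) (g : hom (tc sd) (oten (so sd (Some a)) (so sd v)) (so sd e)) t,
   lin_fun (U (g \oc (idm _ \ot f))) t = pcons (Lb sd a) y v e (tpure g (lin_fun (u v f) t))}.
Proof.
exists (dlift unroll_in \ol linv (evX a Y e)) => v f g t.
have -> : g \oc (idm _ \ot f) = evX a Y e (dinj v (tpure f g)) by rewrite evFE.
rewrite lcompE linvK; last exact: evX_bij.
by rewrite dlift_inj /unroll_in tcurryE 3!lcompE tmapE tswapE tassocE tmapE tuncurryE.
Qed.
Definition unroll := sval unroll_key.
Lemma unrollE v (f : hom (tc sd) Y (so sd v)) (g : hom (tc sd) (oten (so sd (Some a)) (so sd v)) (so sd e)) t :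
  lin_fun (unroll (g \oc (idm _ \ot f))) t = pcons (Lb sd a) y v e (tpure g (lin_fun (u v f) t)).
Proof. exact: (svalP unroll_key). Qed.

Lemma unroll_bad phi t : ~~ gd sd y -> lin_fun (unroll phi) t = 0.
Proof.
move=> h; move: phi; apply: (@hom_oten_ext _ _ _ _ (lin_at _ t \ol unroll) lzero) => v f g.
by rewrite lcompE [LHS]unrollE pcons_bad.
Qed.
End Unroll.

(** Morphisms out of [b (x) o], [a (x) (b (x) o)] and [a (x) (b (x) (c (x) o))] act on paths as one,
    two and three steps. *)
Definition unroll1 y b o v : {linear hom (tc sd) (oten (so sd (Some b)) (so sd o)) (so sd v) ->
   lin (pat (ocons sd o y)) (pat (ocons sd v y))} := tcurry (pcons (Lb sd b) y o v).
Definition unroll2 y a b o e := unroll a (unroll1 y b o) e.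
Definition unroll3 y a b c o e := unroll a (unroll2 y b c o) e.
Lemma unroll1E y b o v h t : lin_fun (unroll1 y b o v h) t = pcons (Lb sd b) y o v (tpure h t).
Proof. exact: tcurryE. Qed.

Lemma unroll2_shift y a b o e phi t O :
  oact (shift (shift O)) _ (lin_fun (unroll2 y a b o e phi) t) =
  lin_fun (unroll2 y a b o e phi) (oact O _ t).
Proof.
move: phi; apply: (@hom_oten_ext _ _ _ _
  (oact (shift (shift O)) _ \ol lin_at _ t \ol unroll2 y a b o e)
  (lin_at _ (oact O _ t) \ol unroll2 y a b o e)) => v f g.
rewrite !lcompE -!/(lin_fun _ _) [lin_at _ _ _]unrollE [RHS]unrollE.
by rewrite !unroll1E !shift_consL.
Qed.

(** Stacking steps is composition of morphisms under the outer letters, by functoriality of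
    [a (x) -] on each summand. *)
Lemma unroll2_unroll1 y a b c o v e phi h t :
  lin_fun (unroll2 y a b v e phi) (lin_fun (unroll1 y c o v h) t) =
  lin_fun (unroll3 y a b c o e (phi \oc (idm _ \ot (idm _ \ot h)))) t.
Proof.
move: phi; apply: (@hom_oten_ext _ _ _ _
  (lin_at _ (lin_fun (unroll1 y c o v h) t) \ol unroll2 y a b v e)
  (lin_at _ t \ol unroll3 y a b c o e \ol mklin (comp_linear_l (z := so sd e) (idm _ \ot (idm _ \ot h))))) => v' f g.
rewrite !lcompE [LHS]unrollE [RHS](_ : _ = lin_fun (unroll3 y a b c o e (g \oc (idm _ \ot (f \oc (idm _ \ot h))))) t); last first.
  by rewrite [LHS]/= -compA -mtenr.
by rewrite [RHS]unrollE unrollE unroll1E.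
Qed.

Lemma unroll2_lam y a b o e phi t :
  oact (lam (Lb sd a)) _ (lin_fun (unroll2 y a b o e phi) t) = lin_fun (unroll2 y a b o e phi) t.
Proof.
move: phi; apply: (@hom_oten_ext _ _ _ _
  (oact (lam (Lb sd a)) _ \ol lin_at _ t \ol unroll2 y a b o e)
  (lin_at _ t \ol unroll2 y a b o e)) => v f g.
by rewrite !lcompE [lin_at _ _ _]unrollE lam_consL.
Qed.
Lemma unroll2_shift_lam y a b o e phi t :
  oact (shift (lam (Lb sd b))) _ (lin_fun (unroll2 y a b o e phi) t) = lin_fun (unroll2 y a b o e phi) t.
Proof.
move: phi; apply: (@hom_oten_ext _ _ _ _
  (oact (shift (lam (Lb sd b))) _ \ol lin_at _ t \ol unroll2 y a b o e)
  (lin_at _ t \ol unroll2 y a b o e)) => v f g.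
by rewrite !lcompE [lin_at _ _ _]unrollE unroll1E shift_consL lam_consL.
Qed.

Lemma prea_subproof a b v Y : linear (fun f : bracket (Some a) (Some b) v =>
  (f \ot idm Y) \oc assocV (so sd (Some a)) (so sd (Some b)) Y).
Proof. by move=> k f f'; rewrite mten_linear_l mcompDl mcompZl. Qed.
(** Fuses [a] and [b] in front of [Y], starting from the right-nested product in which paths are
    written. *)
Definition prea a b v Y (f : bracket (Some a) (Some b) v) :=
  (f \ot idm Y) \oc assocV (so sd (Some a)) (so sd (Some b)) Y.
Lemma preaP k a b v Y (f f' : bracket (Some a) (Some b) v) :
  prea Y (k *: f + f') = k *: prea Y f + prea Y f'.
Proof. exact: prea_subproof. Qed.
Lemma prea_nat a b v Y Y' (f : bracket (Some a) (Some b) v) (h : hom (tc sd) Y Y') :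
  prea Y' f \oc (idm _ \ot (idm _ \ot h)) = (idm _ \ot h) \oc prea Y f.
Proof.
by rewrite /prea -compA assocV_nat mten1 !compA mten_lr mten_rl.
Qed.
Definition prec Y Y' Z (q : hom (tc sd) Y Y') : {linear hom (tc sd) Y' Z -> hom (tc sd) Y Z} :=
  mklin (comp_linear_l (z := Z) q).

(** A last step [h : c (x) o -> o'] is precomposed with [f (x) 1], and the result is unrolled into
    the two steps [b] and [a]. *)
Definition theta_step a b c (f : bracket (Some a) (Some b) (Some c)) : stpmap pat (Lb sd c) :=
  fun y o o' => tuncurry (unroll2 y a b o o' \ol prec _ (prea (so sd o) f)).
Definition thetas_fun a b c (f : bracket (Some a) (Some b) (Some c)) : op :=
  Op (fun w => mkLin (telim (X := pat) 0 (at_lab (theta_step f)) w)) 0.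
Lemma thetas_Om a b c (f : bracket (Some a) (Some b) (Some c)) :
  oact (thetas_fun f) [::] Om = 0.
Proof. by rewrite /oact mkLinE telim_Om. Qed.
Let thetas_fun_cons a b c (f : bracket (Some a) (Some b) (Some c)) y o o' h t :
  oact (thetas_fun f) _ (pcons (Lb sd c) y o o' (tpure h t)) =
  lin_fun (unroll2 y a b o o' (h \oc prea (so sd o) f)) t.
Proof.
have [g|g] := boolP (gd sd y); last first.
  by rewrite pcons_bad // linear0 [RHS]unroll_bad.
by rewrite /oact mkLinE telim_cons // at_labE tuncurryE.
Qed.
Let thetas_fun_consN a b c (f : bracket (Some a) (Some b) (Some c)) l y (o o' : option (sp (tag l))) t :
  Lb sd c <> l -> oact (thetas_fun f) _ (pcons l y o o' t) = 0.
Proof.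
move=> ne; have [g|g] := boolP (gd (tag l) y); last by rewrite pcons_bad // linear0.
by rewrite /oact mkLinE telim_cons // at_labN.
Qed.
Lemma thetas_lin a b c : linear (@thetas_fun a b c).
Proof.
move=> k f f'; apply: opP => [w|/=]; last by rewrite mulr0 addr0.
apply: (@pat_ext K C D S T pat (oact (thetas_fun (k *: f + f')))
  (oact (k *: (thetas_fun f : op) + thetas_fun f'))) w.
  by rewrite oactP !thetas_Om scaler0 addr0.
move=> l y o o' h t g; rewrite oactP.
have [e|ne] := pselect (Lb sd c = l); last first.
  by rewrite !thetas_fun_consN // scaler0 addr0.
subst l; rewrite !thetas_fun_cons preaP.
by rewrite comp_linear_r linearP.
Qed.
Fact thetas_key a b c : {F : {linear @bracket K (tc sd) (sp sd) (Some a) (Some b) (Some c) -> op} |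
  forall f, F f = thetas_fun f}.
Proof. by exists (mklin (@thetas_lin a b c)). Qed.
Definition thetas a b c := sval (thetas_key a b c).
Let thetasE a b c f : thetas a b c f = thetas_fun f.
Proof. exact: (svalP (thetas_key a b c)). Qed.
Lemma thetas_cons a b c f y o o' h t :
  oact (thetas a b c f) _ (pcons (Lb sd c) y o o' (tpure h t)) =
  lin_fun (unroll2 y a b o o' (h \oc prea (so sd o) f)) t.
Proof. by rewrite thetasE thetas_fun_cons. Qed.
Lemma thetas_consN a b c f l y (o o' : option (sp (tag l))) t :
  Lb sd c <> l -> oact (thetas a b c f) _ (pcons l y o o' t) = 0.
Proof. by move=> ne; rewrite thetasE thetas_fun_consN. Qed.
Lemma thetas_opc a b c f : opc (thetas a b c f) = 0.
Proof. by rewrite thetasE. Qed.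
Lemma thetas_Om0 a b c f : oact (thetas a b c f) [::] Om = 0.
Proof. by rewrite thetasE thetas_Om. Qed.

(** The morphism [a (x) (b (x) o) -> 1 (x) o -> o] is unrolled on top of the path. No step is
    consumed, so this acts on all paths, the empty one included, without regard to their labels. *)
Definition thetan_at a b (f : bracket (Some a) (Some b) None) o y :
   {linear pat (ocons sd o y) -> pat (ocons sd o y)} :=
  lin_fun (unroll2 y a b o o (lunit (so sd o) \oc prea (so sd o) f)).
Definition thetan_fun a b (f : bracket (Some a) (Some b) None) : op :=
  Op (fun w => mkLin (transport pat (ocons sd (hd sd w) (tl sd w)) w
    \ol thetan_at f (hd sd w) (tl sd w)
    \ol transport pat w (ocons sd (hd sd w) (tl sd w)))) 0.
Let thetan_fun_at a b (f : bracket (Some a) (Some b) None) o y t :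
  hd sd (ocons sd o y) = o -> tl sd (ocons sd o y) = y ->
  oact (thetan_fun f) (ocons sd o y) t =
  lin_fun (unroll2 y a b o o (lunit (so sd o) \oc prea (so sd o) f)) t.
Proof.
move=> ho hy; rewrite /oact mkLinE ho hy !lcompE.
by rewrite !(@transportE _ _ pat).
Qed.
(** Weaker than cutting [w] with [gd sd y], which may fail when [w] does not alternate: operators
    are defined on all sequences, so the identities have to hold there too. *)
Lemma hd_tl_ind (P : seq letter -> Prop) :
  (forall o y, hd sd (ocons sd o y) = o -> tl sd (ocons sd o y) = y -> P (ocons sd o y)) ->
  forall w, P w.
Proof. by move=> h w; rewrite -(ocons_hd_tl sd w); apply: h; rewrite ocons_hd_tl. Qed.
Lemma thetan_lin a b : linear (@thetan_fun a b).
Proof.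
move=> k f f'; apply: opP => [w|/=]; last by rewrite mulr0 addr0.
move: w; apply: hd_tl_ind => o y ho hy t.
rewrite oactP !thetan_fun_at // preaP.
by rewrite comp_linear_r linearP.
Qed.
Fact thetan_key a b : {F : {linear @bracket K (tc sd) (sp sd) (Some a) (Some b) None -> op} |
  forall f, F f = thetan_fun f}.
Proof. by exists (mklin (@thetan_lin a b)). Qed.
Definition thetan a b := sval (thetan_key a b).
Let thetanE a b f : thetan a b f = thetan_fun f.
Proof. exact: (svalP (thetan_key a b)). Qed.
Lemma thetan_at_ocons a b f o y t :
  hd sd (ocons sd o y) = o -> tl sd (ocons sd o y) = y ->
  oact (thetan a b f) (ocons sd o y) t =
  lin_fun (unroll2 y a b o o (lunit (so sd o) \oc prea (so sd o) f)) t.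
Proof. by move=> ho hy; rewrite thetanE thetan_fun_at. Qed.
Lemma thetan_gd a b f o y t : gd sd y ->
  oact (thetan a b f) (ocons sd o y) t =
  lin_fun (unroll2 y a b o o (lunit (so sd o) \oc prea (so sd o) f)) t.
Proof. by move=> g; rewrite thetan_at_ocons ?hd_ocons ?tl_ocons. Qed.
Lemma thetan_opc a b f : opc (thetan a b f) = 0.
Proof. by rewrite thetanE. Qed.

(** One step is replaced by two, so whatever lay one step below the end lies two steps below it
    afterwards. *)
Lemma thetas_shift a b c f O :
  ocomp (thetas a b c f) (shift O) = ocomp (shift (shift O)) (thetas a b c f).
Proof.
apply: opP => [w|/=]; last by rewrite thetas_opc mul0r mulr0.
apply: (@pat_ext K C D S T pat (oact (ocomp (thetas a b c f) (shift O)))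
   (oact (ocomp (shift (shift O)) (thetas a b c f)))) w.
  by rewrite !oact_comp !shift_Om linearZZ !thetas_Om0 ?scaler0 ?linear0.
move=> l y o o' h t g; rewrite !oact_comp shift_cons.
have [e|ne] := pselect (Lb sd c = l); last by rewrite !thetas_consN // linear0.
by subst l; rewrite !thetas_cons unroll2_shift.
Qed.
(** Two steps are inserted and none is consumed, so the entire path ends up two steps below the
    end. *)
Lemma thetan_shift a b f O :
  ocomp (thetan a b f) O = ocomp (shift (shift O)) (thetan a b f).
Proof.
apply: opP => [w|/=]; last by rewrite thetan_opc mul0r mulr0.
move: w; apply: hd_tl_ind => o y ho hy t.
by rewrite !oact_comp !thetan_at_ocons // unroll2_shift.
Qed.

(** The steps produced carry the labels [a] on top of [b]. This lemma and the next three record the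
    fact in terms of projectors. *)
Lemma lam_thetas a b c f : ocomp (lam (Lb sd a)) (thetas a b c f) = thetas a b c f.
Proof.
apply: opP => [w|/=]; last by rewrite thetas_opc mulr0.
apply: (@pat_ext K C D S T pat (oact (ocomp (lam (Lb sd a)) (thetas a b c f)))
  (oact (thetas a b c f))) w.
  by rewrite oact_comp thetas_Om0 linear0.
move=> l y o o' h t g; rewrite oact_comp.
have [e|ne] := pselect (Lb sd c = l); last by rewrite thetas_consN // linear0.
by subst l; rewrite thetas_cons unroll2_lam.
Qed.
Lemma shift_lam_thetas a b c f :
  ocomp (shift (lam (Lb sd b))) (thetas a b c f) = thetas a b c f.
Proof.
apply: opP => [w|/=]; last by rewrite thetas_opc mulr0.
apply: (@pat_ext K C D S T pat (oact (ocomp (shift (lam (Lb sd b))) (thetas a b c f)))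
  (oact (thetas a b c f))) w.
  by rewrite oact_comp thetas_Om0 linear0.
move=> l y o o' h t g; rewrite oact_comp.
have [e|ne] := pselect (Lb sd c = l); last by rewrite thetas_consN // linear0.
by subst l; rewrite thetas_cons unroll2_shift_lam.
Qed.
Lemma lam_thetan a b f : ocomp (lam (Lb sd a)) (thetan a b f) = thetan a b f.
Proof.
apply: opP => [w|/=]; last by rewrite thetan_opc mulr0.
move: w; apply: hd_tl_ind => o y ho hy t.
by rewrite oact_comp !thetan_at_ocons // unroll2_lam.
Qed.
Lemma shift_lam_thetan a b f :
  ocomp (shift (lam (Lb sd b))) (thetan a b f) = thetan a b f.
Proof.
apply: opP => [w|/=]; last by rewrite thetan_opc mulr0.
move: w; apply: hd_tl_ind => o y ho hy t.
by rewrite oact_comp !thetan_at_ocons // unroll2_shift_lam.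
Qed.
End OneSide. End Theta.

(** * Letter operators and the associator of one category *)

Section LetterRel.
Variables (K : fieldType) (C D : tensorCategory K) (S : spectrum C) (T : spectrum D).
Hypotheses (ssC : semisimple C) (ssD : semisimple D).
Hypothesis EndC :
  forall (x : obj C) (f : hom C x x), simple x -> exists k, f = k *: idm x.
Hypothesis EndD :
  forall (x : obj D) (f : hom D x x), simple x -> exists k, f = k *: idm x.
Local Notation letter := (letter S T).
Local Notation pat := (@pat K C D S T).
Local Notation lab := (@lab K C D S T).
Local Notation op := (@op K C D S T).
Local Notation tc := (@tc K C D).
Local Notation sp := (@sp K C D S T).
Local Notation so sd o := (@spec_obj K (tc sd) (sp sd) o).
Local Notation osp sd := (option (sp sd)).
Local Notation thetas := (@thetas K C D S T ssC ssD EndC EndD _).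
Local Notation thetan := (@thetan K C D S T ssC ssD EndC EndD _).
Local Notation unroll2 := (@unroll2 K C D S T ssC ssD EndC EndD _).
Local Notation unroll3 := (@unroll3 K C D S T ssC ssD EndC EndD _).
Local Notation sstc := (@sstc K C D ssC ssD).
Local Notation Endtc := (@Endtc K C D EndC EndD).

Section OneSide.
Variable sd : bool.
Implicit Types (a b c : sp sd) (o e d : osp sd) (Y : obj (tc sd)).
Local Notation br a b d := (@bracket K (tc sd) (sp sd) a b d).

(** This justifies regarding [thetas f] as precomposition with [f]: naturality of [prea] lets the
    upper step be replaced while the lower one stays inside a single morphism out of three
    letters. *)
Lemma thetas_unroll2 a b u c y o e (f : br (Some a) (Some b) (Some u))
    (phi : hom (tc sd) (oten (so sd (Some u)) (oten (so sd (Some c)) (so sd o))) (so sd e)) t :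
  oact (thetas a b u f) _ (lin_fun (unroll2 y u c o e phi) t) =
  lin_fun (unroll3 y a b c o e (phi \oc prea _ f)) t.
Proof.
move: phi; apply: (@hom_oten_ext K C D S T ssC ssD EndC EndD sd _ _ _ _
  (oact (thetas a b u f) _ \ol lin_at _ t \ol unroll2 y u c o e)
  (lin_at _ t \ol unroll3 y a b c o e \ol prec _ (prea _ f))) => v k g.
rewrite !lcompE [lin_at _ _ _]unrollE [LHS]thetas_cons.
rewrite unroll2_unroll1 -compA prea_nat compA.
by [].
Qed.

Lemma shift_thetas_unroll2 a b c v y o e (f : br (Some b) (Some c) (Some v))
    (phi : hom (tc sd) (oten (so sd (Some a)) (oten (so sd (Some v)) (so sd o))) (so sd e)) t :
  oact (shift (thetas b c v f)) _ (lin_fun (unroll2 y a v o e phi) t) =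
  lin_fun (unroll3 y a b c o e (phi \oc (idm _ \ot prea _ f))) t.
Proof.
move: phi; apply: (@hom_oten_ext K C D S T ssC ssD EndC EndD sd _ _ _ _
  (oact (shift (thetas b c v f)) _ \ol lin_at _ t \ol unroll2 y a v o e)
  (lin_at _ t \ol unroll3 y a b c o e \ol prec _ (idm _ \ot prea _ f))) => v' k g.
rewrite !lcompE [lin_at _ _ _]unrollE shift_consL unroll1E [oact _ _ _]thetas_cons.
rewrite -[RHS]/(lin_fun (unroll3 y a b c o e (g \oc (idm (so sd (Some a)) \ot k) \oc (idm _ \ot prea _ f))) t).
by rewrite -compA -mtenr [RHS]unrollE.
Qed.

(** The scalar of a bracket with the unit, normalised by the unit constraint. The cast along [e]
    appears because [d] has to stay a variable in the type. *)
Fact lcoef_key c d : {F : {linear br None (Some c) d -> K^o} |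
  forall e : Some c = d, F (eq_rect _ (fun d => br None (Some c) d) (lunit (so sd (Some c))) d e) = 1}.
Proof.
have [e|ne] := pselect (Some c = d); last by exists lzero.
case: d / e; have b : bijective (vec (lunit (so sd (Some c)))).
  apply: bij_inj_surj => [k /= /eqP|f].
    by rewrite scaler_eq0 => /orP[/eqP //|/eqP h]; case: (@lunit_neq0 K (tc sd) (sp sd) (Some c) h).
  have [k ->] := @bracket_lunit1 K (tc sd) (sp sd) (@Endtc sd) (Some c) f; by exists k.
exists (linv (vec (lunit (so sd (Some c))))) => e.
rewrite (eq_irrelevance e erefl) /=; apply: (bij_inj b).
by rewrite linvVK //= scale1r.
Qed.
Definition lcoef c d := sval (lcoef_key c d).
Lemma lcoef1 c : lcoef c (Some c) (lunit (so sd (Some c))) = 1.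
Proof. exact: (svalP (lcoef_key c (Some c)) erefl). Qed.

Fact rcoef_key a d : {F : {linear br (Some a) None d -> K^o} |
  forall e : Some a = d, F (eq_rect _ (fun d => br (Some a) None d) (runit (so sd (Some a))) d e) = 1}.
Proof.
have [e|ne] := pselect (Some a = d); last by exists lzero.
case: d / e; have b : bijective (vec (runit (so sd (Some a)))).
  apply: bij_inj_surj => [k /= /eqP|f].
    by rewrite scaler_eq0 => /orP[/eqP //|/eqP h]; case: (@runit_neq0 K (tc sd) (sp sd) (Some a) h).
  have [k ->] := @bracket_runit1 K (tc sd) (sp sd) (@Endtc sd) (Some a) f; by exists k.
exists (linv (vec (runit (so sd (Some a))))) => e.
rewrite (eq_irrelevance e erefl) /=; apply: (bij_inj b).
by rewrite linvVK //= scale1r.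
Qed.
Definition rcoef a d := sval (rcoef_key a d).
Lemma rcoef1 a : rcoef a (Some a) (runit (so sd (Some a))) = 1.
Proof. exact: (svalP (rcoef_key a (Some a)) erefl). Qed.

Definition thetao a b d : {linear br (Some a) (Some b) d -> op} :=
  match d with Some c => thetas a b c | None => thetan a b end.
(** For [u = 1] the second factor is a scalar and [thetan] alone acts. This summand does not see the
    last label, which is why [evb_assoc] is stated on paths with last label [d]. *)
Definition evbL_in a b c d u : {linear tens (br (Some a) (Some b) u) (br u (Some c) d) -> op} :=
  match u return {linear tens (br (Some a) (Some b) u) (br u (Some c) d) -> op} with
  | Some u => omul (thetao a b (Some u)) (thetao u c d)
  | None => tunitr _ \ol tmap (thetao a b None) (lcoef c d)
  end.
Definition evbL a b c d : {linear @baseL K (tc sd) (sp sd) (Some a) (Some b) (Some c) d -> op} :=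
  dlift (@evbL_in a b c d).
Definition evbR_in a b c d v : {linear tens (br (Some b) (Some c) v) (br (Some a) v d) -> op} :=
  match v return {linear tens (br (Some b) (Some c) v) (br (Some a) v d) -> op} with
  | Some v => omul (shift \ol thetao b c (Some v)) (thetao a v d)
  | None => tunitr _ \ol tmap (shift \ol thetao b c None) (rcoef a d)
  end.
Definition evbR a b c d : {linear @baseR K (tc sd) (sp sd) (Some a) (Some b) (Some c) d -> op} :=
  dlift (@evbR_in a b c d).

Lemma evbL_some a b c d u f g :
  evbL a b c d (baseL_in (Some a) (Some b) (Some c) d (Some u) (tpure f g)) =
  ocomp (thetas a b u f) (thetao u c d g).
Proof. by rewrite /evbL /baseL_in dlift_inj omulE. Qed.
Lemma evbL_none a b c d f g :
  evbL a b c d (baseL_in (Some a) (Some b) (Some c) d None (tpure f g)) =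
  (lcoef c d g : K) *: thetan a b f.
Proof. by rewrite /evbL /baseL_in dlift_inj lcompE tmapE tunitrE. Qed.
Lemma evbR_some a b c d v f g :
  evbR a b c d (baseR_in (Some a) (Some b) (Some c) d (Some v) (tpure f g)) =
  ocomp (shift (thetas b c v f)) (thetao a v d g).
Proof. by rewrite /evbR /baseR_in dlift_inj omulE. Qed.
Lemma evbR_none a b c d f g :
  evbR a b c d (baseR_in (Some a) (Some b) (Some c) d None (tpure f g)) =
  (rcoef a d g : K) *: shift (thetan b c f).
Proof. by rewrite /evbR /baseR_in dlift_inj lcompE tmapE tunitrE. Qed.
Lemma evbL_unit a b c f :
  evbL a b c (Some c) (baseL_unit (Some a) (Some b) (Some c) f) = thetan a b f.
Proof. by rewrite /baseL_unit lcompE [LHS]evbL_none lcoef1 scale1r. Qed.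
Lemma evbR_unit a b c f :
  evbR a b c (Some a) (baseR_unit (Some a) (Some b) (Some c) f) = shift (thetan b c f).
Proof. by rewrite /baseR_unit lcompE [LHS]evbR_none rcoef1 scale1r. Qed.

(** The common normal form of both evaluations: [p] on the three outer letters in front of [Y],
    after rebracketing from the right-nested product. *)
Definition prea3 a b c o (p : hom (tc sd) (oten (oten (so sd (Some a)) (so sd (Some b))) (so sd (Some c)))
   (so sd o)) Y :=
  (p \ot idm Y) \oc assocV (oten (so sd (Some a)) (so sd (Some b))) (so sd (Some c)) Y
    \oc assocV (so sd (Some a)) (so sd (Some b)) (oten (so sd (Some c)) Y).

Lemma prea_prea3 a b u c d Y (f : br (Some a) (Some b) (Some u)) (g : br (Some u) (Some c) d) :
  prea Y g \oc prea (oten (so sd (Some c)) Y) f = prea3 (g \oc (f \ot idm _)) Y.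
Proof.
rewrite /prea /prea3 mtenl -(mten1 (so sd (Some c)) Y).
by rewrite -!compA (compA (assocV _ _ _) (f \ot _)) assocV_nat !compA.
Qed.

(** The inverse pentagon moves the fusion of [b] and [c] out of the right-nested product. The factor
    [assoc] left over is exactly the one relating [evalR] to [evalL]. *)
Lemma prea_prea3R a b v c d Y (f : br (Some b) (Some c) (Some v)) (g : br (Some a) (Some v) d) :
  prea Y g \oc (idm _ \ot prea Y f) =
  prea3 (g \oc (idm _ \ot f) \oc assoc _ _ _) Y.
Proof.
rewrite /prea /prea3 -compA mtenr (compA (assocV _ _ _) (idm _ \ot _)) assocV_nat.
rewrite -!compA pentagonV !compA -!mtenl.
by rewrite -(compA (g \oc (idm _ \ot f)) (assoc _ _ _)) assocVK compm1.
Qed.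

Lemma lunit_prea a b o Y (f : br (Some a) (Some b) None) (h : hom (tc sd) Y (so sd o)) :
  lunit (so sd o) \oc prea (so sd o) f \oc (idm _ \ot (idm _ \ot h)) =
  h \oc (lunit Y \oc prea Y f).
Proof.
have e := prea_nat f h; rewrite -compA.
transitivity (lunit (so sd o) \oc ((idm (ounit (tc sd)) \ot h) \oc prea Y f)); first by congr (_ \oc _).
by rewrite compA lunit_nat -compA.
Qed.

(** The unit summand of [R_0]: a pair cancelled below [a] is absorbed by [runit] of [a], by the
    pentagon, naturality and the triangle. *)
Lemma lunit_prea_runit a b c o (f : br (Some b) (Some c) None) :
  (idm (so sd (Some a)) \ot (lunit (so sd o) \oc prea (so sd o) f)) =
  prea3 (runit (so sd (Some a)) \oc (idm _ \ot f) \oc assoc _ _ _) (so sd o).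
Proof.
rewrite /prea3 /prea -compA mtenl -!compA pentagonV !compA -!mtenl.
rewrite -!(compA _ (assoc _ _ _)) assocVK compm1.
rewrite mtenl -!compA (compA (_ \ot idm (so sd o)) (assocV _ _ _)).
rewrite -assocV_nat -!compA (compA (runit _ \ot _)) triangleV.
by rewrite -!mtenr.
Qed.

(** The unit summand of [L_0]: a pair cancelled in front of a step labelled [c] is absorbed by
    [lunit] of [c]. The hypothesis on [y] ensures that [thetan] cuts the word in the same place as
    the step does. *)
Lemma comp_lunit_prea a b c y o o' (f : br (Some a) (Some b) None) h t :
  gd sd y ->
  oact (thetan a b f) _ (pcons (Lb sd c) y o o' (tpure h t)) =
  lin_fun (unroll3 y a b c o o' (h \oc prea3 (lunit (so sd (Some c)) \oc (f \ot idm _)) (so sd o))) t.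
Proof.
move=> g; rewrite thetan_gd // -unroll1E unroll2_unroll1 lunit_prea.
congr (lin_fun (unroll3 y a b c o o' (_ \oc _)) t).
rewrite /prea3 /prea mtenl -lunit_otenV.
rewrite -!compA (compA (assocV _ _ _) (f \ot _)) -(mten1 (so sd (Some c)) (so sd o)).
by rewrite assocV_nat !compA.
Qed.

(** Both sides are linear in [m], so pure tensors suffice. For [u <> 1] the letter operators compose
    as morphisms do; for [u = 1] Schur leaves only [c = d] and multiples of [lunit]. *)
Lemma evbL_cons a b c (d : sp sd) m y o o' h t : gd sd y ->
  oact (evbL a b c (Some d) m) _ (pcons (Lb sd d) y o o' (tpure h t)) =
  lin_fun (unroll3 y a b c o o' (h \oc prea3 (evalL _ _ _ _ m) (so sd o))) t.
Proof.
move=> gy; have lin_rhs : linear (fun p => lin_fun (unroll3 y a b c o o' (h \oc prea3 (o := Some d) p (so sd o))) t).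
  move=> k p q; rewrite /prea3 mten_linear_l !mcompDl !mcompZl comp_linear_r.
  by rewrite (linearP (unroll3 y a b c o o')).
have lin_lhs : linear (fun O : op => oact O _ (pcons (Lb sd d) y o o' (tpure h t))) by [].
move: m; apply: (@dtens_ext _ _ _ _ _ (mklin lin_lhs \ol evbL a b c (Some d))
   (mklin lin_rhs \ol evalL (Some a) (Some b) (Some c) (Some d))) => u f g.
rewrite !lcompE -[LHS]/(oact (evbL a b c (Some d) (baseL_in _ _ _ _ u (tpure f g))) _
  (pcons (Lb sd d) y o o' (tpure h t))).
rewrite -[RHS]/(lin_fun (unroll3 y a b c o o' (h \oc prea3 (evalL _ _ _ _ (baseL_in _ _ _ _ u (tpure f g))) (so sd o))) t).
rewrite evalL_pure; case: u f g => [u|] f g.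
  rewrite evbL_some oact_comp [oact (thetao _ _ _ _) _ _]thetas_cons thetas_unroll2.
  by rewrite -compA prea_prea3.
rewrite evbL_none.
have [[e]|ne] := pselect (Some c = Some d); last first.
  have -> : g = 0 by apply: (bracket_lunitN (@sstc sd) g).
  by rewrite linear0 scale0r mcomp0l -[LHS]/(mklin lin_lhs 0) -[RHS]/(mklin lin_rhs 0) !linear0.
subst d; have [k ->] := @bracket_lunit1 K (tc sd) (sp sd) (@Endtc sd) (Some c) g.
rewrite mcompZl linearZZ lcoef1; have -> : (k *: (1 : K^o) : K) = k by exact: mulr1.
rewrite -[LHS]/(mklin lin_lhs _) -[RHS]/(mklin lin_rhs _) !linearZZ; congr (_ *: _).
exact: comp_lunit_prea.
Qed.

Lemma evbL_None a b c m y o t : hd sd (ocons sd o y) = o -> tl sd (ocons sd o y) = y ->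
  oact (evbL a b c None m) (ocons sd o y) t =
  lin_fun (unroll3 y a b c o o (lunit (so sd o) \oc prea3 (o := None) (evalL _ _ _ _ m) (so sd o))) t.
Proof.
move=> ho hy; have lin_rhs : linear (fun p => lin_fun (unroll3 y a b c o o (lunit (so sd o) \oc prea3 (o := None) p (so sd o))) t).
  move=> k p q; rewrite /prea3 mten_linear_l !mcompDl !mcompZl comp_linear_r.
  by rewrite (linearP (unroll3 y a b c o o)).
have lin_lhs : linear (fun O : op => oact O (ocons sd o y) t) by [].
move: m; apply: (@dtens_ext _ _ _ _ _ (mklin lin_lhs \ol evbL a b c None)
   (mklin lin_rhs \ol evalL (Some a) (Some b) (Some c) None)) => u f g.
rewrite !lcompE -[LHS]/(oact (evbL a b c None (baseL_in _ _ _ _ u (tpure f g))) (ocons sd o y) t).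
rewrite -[RHS]/(lin_fun (unroll3 y a b c o o (lunit (so sd o) \oc prea3 (o := None) (evalL _ _ _ _ (baseL_in _ _ _ _ u (tpure f g))) (so sd o))) t).
rewrite evalL_pure; case: u f g => [u|] f g.
  rewrite evbL_some oact_comp [oact (thetao _ _ _ _) _ _]thetan_at_ocons // thetas_unroll2.
  by rewrite -compA (@prea_prea3 a b u c None (so sd o) f g).
have -> : g = 0 by apply: (bracket_lunitN (@sstc sd) g).
rewrite evbL_none linear0 scale0r mcomp0l.
by rewrite -[LHS]/(mklin lin_lhs 0) -[RHS]/(mklin lin_rhs 0) !linear0.
Qed.

Lemma evbR_cons a b c (d : sp sd) m y o o' h t : gd sd y ->
  oact (evbR a b c (Some d) m) _ (pcons (Lb sd d) y o o' (tpure h t)) =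
  lin_fun (unroll3 y a b c o o' (h \oc prea3 (evalR _ _ _ _ m \oc assoc _ _ _) (so sd o))) t.
Proof.
move=> gy; have lin_rhs : linear (fun p => lin_fun (unroll3 y a b c o o' (h \oc prea3 (o := Some d) (p \oc assoc _ _ _) (so sd o))) t).
  move=> k p q; rewrite /prea3 mcompDl mcompZl mten_linear_l !mcompDl !mcompZl comp_linear_r.
  by rewrite (linearP (unroll3 y a b c o o')).
have lin_lhs : linear (fun O : op => oact O _ (pcons (Lb sd d) y o o' (tpure h t))) by [].
move: m; apply: (@dtens_ext _ _ _ _ _ (mklin lin_lhs \ol evbR a b c (Some d))
   (mklin lin_rhs \ol evalR (Some a) (Some b) (Some c) (Some d))) => v f g.
rewrite !lcompE -[LHS]/(oact (evbR a b c (Some d) (baseR_in _ _ _ _ v (tpure f g))) _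
  (pcons (Lb sd d) y o o' (tpure h t))).
rewrite -[RHS]/(lin_fun (unroll3 y a b c o o' (h \oc prea3 (evalR _ _ _ _ (baseR_in _ _ _ _ v (tpure f g)) \oc assoc _ _ _) (so sd o))) t).
rewrite evalR_pure; case: v f g => [v|] f g.
  rewrite evbR_some oact_comp [oact (thetao _ _ _ _) _ _]thetas_cons shift_thetas_unroll2.
  by rewrite -(compA h) prea_prea3R.
rewrite evbR_none.
have [[e]|ne] := pselect (Some a = Some d); last first.
  have -> : g = 0 by apply: (bracket_runitN (@sstc sd) g).
  by rewrite linear0 scale0r mcomp0l -[LHS]/(mklin lin_lhs 0) -[RHS]/(mklin lin_rhs 0) !linear0.
subst d; have [k ->] := @bracket_runit1 K (tc sd) (sp sd) (@Endtc sd) (Some a) g.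
rewrite mcompZl linearZZ rcoef1; have -> : (k *: (1 : K^o) : K) = k by exact: mulr1.
rewrite -[LHS]/(mklin lin_lhs _) -[RHS]/(mklin lin_rhs _) !linearZZ; congr (_ *: _).
rewrite -[LHS]/(oact (shift (thetan b c f)) _ (pcons (Lb sd a) y o o' (tpure h t))).
rewrite shift_consL thetan_gd //.
rewrite -[RHS]/(lin_fun (unroll3 y a b c o o' (h \oc prea3 (runit (so sd (Some a)) \oc (idm _ \ot f) \oc assoc _ _ _) (so sd o))) t).
by rewrite -lunit_prea_runit [RHS]unrollE.
Qed.

Lemma evbR_None a b c m y o t : hd sd (ocons sd o y) = o -> tl sd (ocons sd o y) = y ->
  oact (evbR a b c None m) (ocons sd o y) t =
  lin_fun (unroll3 y a b c o o (lunit (so sd o) \oc prea3 (o := None) (evalR _ _ _ _ m \oc assoc _ _ _) (so sd o))) t.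
Proof.
move=> ho hy; have lin_rhs : linear (fun p => lin_fun (unroll3 y a b c o o (lunit (so sd o) \oc prea3 (o := None) (p \oc assoc _ _ _) (so sd o))) t).
  move=> k p q; rewrite /prea3 mcompDl mcompZl mten_linear_l !mcompDl !mcompZl comp_linear_r.
  by rewrite (linearP (unroll3 y a b c o o)).
have lin_lhs : linear (fun O : op => oact O (ocons sd o y) t) by [].
move: m; apply: (@dtens_ext _ _ _ _ _ (mklin lin_lhs \ol evbR a b c None)
   (mklin lin_rhs \ol evalR (Some a) (Some b) (Some c) None)) => v f g.
rewrite !lcompE -[LHS]/(oact (evbR a b c None (baseR_in _ _ _ _ v (tpure f g))) (ocons sd o y) t).
rewrite -[RHS]/(lin_fun (unroll3 y a b c o o (lunit (so sd o) \oc prea3 (o := None) (evalR _ _ _ _ (baseR_in _ _ _ _ v (tpure f g)) \oc assoc _ _ _) (so sd o))) t).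
rewrite evalR_pure; case: v f g => [v|] f g.
  rewrite evbR_some oact_comp [oact (thetao _ _ _ _) _ _]thetan_at_ocons // shift_thetas_unroll2.
  by rewrite -(compA (lunit (so sd o))) (@prea_prea3R a b v c None (so sd o) f g).
have -> : g = 0 by apply: (bracket_runitN (@sstc sd) g).
rewrite evbR_none linear0 scale0r mcomp0l.
by rewrite -[LHS]/(mklin lin_lhs 0) -[RHS]/(mklin lin_rhs 0) !linear0.
Qed.

Lemma opc_comp (O O' : op) : opc (ocomp O O') = opc O * opc O'. Proof. by []. Qed.
Lemma evbL_opc a b c d m : opc (evbL a b c d m) = 0.
Proof.
have lin_opc : linear (fun O : op => opc O : K^o) by [].
move: m; apply: (@dtens_ext _ _ _ _ _ (mklin lin_opc \ol evbL a b c d) lzero) => u f g.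
rewrite lcompE -[LHS]/(opc (evbL a b c d (baseL_in _ _ _ _ u (tpure f g)))).
case: u f g => [u|] f g; first by rewrite evbL_some opc_comp thetas_opc mul0r.
by rewrite evbL_none /= thetan_opc mulr0.
Qed.
Lemma evbR_opc a b c d m : opc (evbR a b c d m) = 0.
Proof.
have lin_opc : linear (fun O : op => opc O : K^o) by [].
move: m; apply: (@dtens_ext _ _ _ _ _ (mklin lin_opc \ol evbR a b c d) lzero) => u f g.
rewrite lcompE -[LHS]/(opc (evbR a b c d (baseR_in _ _ _ _ u (tpure f g)))).
case: u f g => [u|] f g; first by rewrite evbR_some opc_comp shift_opc thetas_opc mul0r.
by rewrite evbR_none /= shift_opc thetan_opc mulr0.
Qed.

Definition lams d : op := if d is Some d then lam (Lb sd d) else oid.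

(** Both evaluations are [unroll3] of one morphism, because [base_assoc] satisfies the equation [E].
    The projector selects the label on which the unit summands act correctly; for [d = 1] these
    summands vanish and the identity serves instead. *)
Lemma evb_assoc a b c d m :
  ocomp (evbR a b c d (base_assoc _ _ _ _ m)) (lams d) = ocomp (evbL a b c d m) (lams d).
Proof.
have E : evalR _ _ _ _ (base_assoc _ _ _ _ m) \oc assoc (so sd (Some a)) (so sd (Some b)) (so sd (Some c))
    = evalL _ _ _ _ m.
  rewrite (base_assocP (@sstc sd) (@Endtc sd)) -compA assocK compm1.
  by [].
apply: opP => [w|]; last by rewrite !opc_comp evbL_opc evbR_opc !mul0r.
case: d m E => [d|] m E.
  apply: (@pat_ext K C D S T pat (oact (ocomp (evbR a b c (Some d) (base_assoc _ _ _ _ m)) (lam (Lb sd d))))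
    (oact (ocomp (evbL a b c (Some d) m) (lam (Lb sd d))))) w.
    by rewrite !oact_comp lam_Om !linear0.
  move=> l y o o' h t g; rewrite !oact_comp.
  have [e|ne] := pselect (Lb sd d = l); last by rewrite lam_consN // !linear0.
  by subst l; rewrite lam_cons evbL_cons // -E evbR_cons.
move: w; apply: (@hd_tl_ind K C D S T sd) => o y ho hy t.
by rewrite !oact_comp !oact_id evbL_None // -E evbR_None.
Qed.

(** Naturality of [runit] carries [f] past the canonical step, so the unrolled pair is visibly the
    step [f] over the canonical step of [b]. *)
Lemma thetas_runit a b c y (f : br (Some a) (Some b) (Some c)) t :
  oact (thetas a b c f) _ (pcons (Lb sd c) y None (Some c) (tpure (runit (so sd (Some c))) t)) =
  pcons (Lb sd a) y (Some b) (Some c) (tpure f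
    (pcons (Lb sd b) y None (Some b) (tpure (runit (so sd (Some b))) t))).
Proof.
rewrite thetas_cons.
have -> : runit (so sd (Some c)) \oc prea (ounit (tc sd)) f = f \oc (idm _ \ot runit (so sd (Some b))).
  by rewrite /prea compA runit_nat -compA runit_otenV.
have := @unrollE K C D S T ssC ssD EndC EndD sd y a None _ (unroll1 y b None) (Some c) (Some b) (runit (so sd (Some b))) f t.
by rewrite unroll1E.
Qed.

Lemma thetan_runit a b y (f : br (Some a) (Some b) None) (t : pat (ocons sd None y)) : gd sd y ->
  oact (thetan a b f) (ocons sd None y) t =
  pcons (Lb sd a) y (Some b) None (tpure f
    (pcons (Lb sd b) y None (Some b) (tpure (runit (so sd (Some b))) t))).
Proof.
move=> g; rewrite thetan_gd //.
(* The head is the unit object, where [lunit] and [runit] coincide. *)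
have -> : lunit (so sd None) \oc prea (ounit (tc sd)) f = f \oc (idm _ \ot runit (so sd (Some b))).
  by rewrite /prea compA -[so sd None]/(ounit (tc sd)) lunit_runit runit_nat -compA runit_otenV.
have := @unrollE K C D S T ssC ssD EndC EndD sd y a None _ (unroll1 y b None) None (Some b) (runit (so sd (Some b))) f t.
by rewrite unroll1E.
Qed.
End OneSide.
End LetterRel.

(** * Letters of both sides, and reading off one letter *)

Section Letters.
Variables (K : fieldType) (C D : tensorCategory K) (S : spectrum C) (T : spectrum D).
Hypotheses (ssC : semisimple C) (ssD : semisimple D).
Hypothesis EndC :
  forall (x : obj C) (f : hom C x x), simple x -> exists k, f = k *: idm x.
Hypothesis EndD :
  forall (x : obj D) (f : hom D x x), simple x -> exists k, f = k *: idm x.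
Local Notation letter := (letter S T).
Implicit Types (a b c u v : letter) (d : option letter).
Local Notation pat := (@pat K C D S T).
Local Notation op := (@op K C D S T).
Local Notation thetas sd := (@thetas K C D S T ssC ssD EndC EndD sd).
Local Notation thetan sd := (@thetan K C D S T ssC ssD EndC EndD sd).
Local Notation evbL sd := (@evbL K C D S T ssC ssD EndC EndD sd).
Local Notation evbR sd := (@evbR K C D S T ssC ssD EndC EndD sd).
Local Notation lcoef sd := (@lcoef K C D S T EndC EndD sd).
Local Notation rcoef sd := (@rcoef K C D S T EndC EndD sd).
Local Notation B := (@lbracket K C D S T).
Local Notation LL := (@letterL K C D S T).
Local Notation RR := (@letterR K C D S T).

Definition theta a b d : {linear B a b d -> op} :=
  match a, b return {linear B a b d -> op} with
  | inl a, inl b => match d return {linear B (inl a) (inl b) d -> op} with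
     | None => thetan true a b
     | Some (inl c) => thetas true a b c
     | Some (inr _) => lzero end
  | inr a, inr b => match d return {linear B (inr a) (inr b) d -> op} with
     | None => thetan false a b
     | Some (inr c) => thetas false a b c
     | Some (inl _) => lzero end
  | _, _ => lzero
  end.

Definition ltag a : lab S T := match a with inl s => @Lb K C D S T true s | inr t => @Lb K C D S T false t end.
Definition lamL a : op := lam (ltag a).
Definition lamo d : op := if d is Some d then lamL d else oid.

Lemma theta_shift a b c f O :
  ocomp (theta a b (Some c) f) (shift O) = ocomp (shift (shift O)) (theta a b (Some c) f).
Proof.
by case: a b c f => [a|a] [b|b] [c|c] f; rewrite ?[theta _ _ _ f]/(0 : op) ?ocomp0l ?ocomp0r //;
  first [exact: (@thetas_shift K C D S T ssC ssD EndC EndD true a b c f O) | exact: (@thetas_shift K C D S T ssC ssD EndC EndD false a b c f O)].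
Qed.
Lemma theta_none_shift a b f O :
  ocomp (theta a b None f) O = ocomp (shift (shift O)) (theta a b None f).
Proof.
by case: a b f => [a|a] [b|b] f; rewrite ?[theta _ _ _ f]/(0 : op) ?ocomp0l ?ocomp0r //;
  first [exact: (@thetan_shift K C D S T ssC ssD EndC EndD true a b f O) | exact: (@thetan_shift K C D S T ssC ssD EndC EndD false a b f O)].
Qed.
Lemma lam_theta a b d f : ocomp (lamL a) (theta a b d f) = theta a b d f.
Proof.
case: a b d f => [a|a] [b|b] [[c|c]|] f; rewrite ?[theta _ _ _ f]/(0 : op) ?ocomp0r //;
  first [exact: (@lam_thetas K C D S T ssC ssD EndC EndD true a b c f) | exact: (@lam_thetas K C D S T ssC ssD EndC EndD false a b c f) | exact: (@lam_thetan K C D S T ssC ssD EndC EndD true a b f) | exact: (@lam_thetan K C D S T ssC ssD EndC EndD false a b f)].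
Qed.
Lemma shift_lam_theta a b d f : ocomp (shift (lamL b)) (theta a b d f) = theta a b d f.
Proof.
case: a b d f => [a|a] [b|b] [[c|c]|] f; rewrite ?[theta _ _ _ f]/(0 : op) ?ocomp0r //;
  first [exact: (@shift_lam_thetas K C D S T ssC ssD EndC EndD true a b c f) | exact: (@shift_lam_thetas K C D S T ssC ssD EndC EndD false a b c f) | exact: (@shift_lam_thetan K C D S T ssC ssD EndC EndD true a b f) | exact: (@shift_lam_thetan K C D S T ssC ssD EndC EndD false a b f)].
Qed.

Definition evL4 a b c d : {linear LL a b c d -> op} :=
  match a, b, c return {linear LL a b c d -> op} with
  | inl a, inl b, inl c => match d return {linear LL (inl a) (inl b) (inl c) d -> op} with
     | None => evbL true a b c None
     | Some (inl d) => evbL true a b c (Some d)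
     | Some (inr _) => lzero end
  | inr a, inr b, inr c => match d return {linear LL (inr a) (inr b) (inr c) d -> op} with
     | None => evbL false a b c None
     | Some (inr d) => evbL false a b c (Some d)
     | Some (inl _) => lzero end
  | _, _, _ => lzero
  end.
Definition evR4 a b c d : {linear RR a b c d -> op} :=
  match a, b, c return {linear RR a b c d -> op} with
  | inl a, inl b, inl c => match d return {linear RR (inl a) (inl b) (inl c) d -> op} with
     | None => evbR true a b c None
     | Some (inl d) => evbR true a b c (Some d)
     | Some (inr _) => lzero end
  | inr a, inr b, inr c => match d return {linear RR (inr a) (inr b) (inr c) d -> op} with
     | None => evbR false a b c None
     | Some (inr d) => evbR false a b c (Some d)
     | Some (inl _) => lzero end
  | _, _, _ => lzero
  end.


Ltac kill f := rewrite [f]null0 ?tpure0l ?tpure0r ?linear0 ?ocomp0l ?ocomp0r ?linear0 //.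

Lemma evL4_in a b c d u f g :
  evL4 a b c d (letterL_in a b c d u (tpure f g)) = ocomp (theta a b (Some u) f) (theta u c d g).
Proof.
case: a b f => [a|a] [b|b] f; try by kill f.
- case: u f g => [u|u] f g; last by kill f.
  case: c g => [c|c] g; last by kill g.
  by case: d g => [[d|d]|] g; [exact: evbL_some | kill g | exact: evbL_some].
- case: u f g => [u|u] f g; first by kill f.
  case: c g => [c|c] g; first by kill g.
  by case: d g => [[d|d]|] g; [kill g | exact: evbL_some | exact: evbL_some].
Qed.
Lemma evR4_in a b c d v f g :
  evR4 a b c d (letterR_in a b c d v (tpure f g)) = ocomp (shift (theta b c (Some v) f)) (theta a v d g).
Proof.
case: b c f => [b|b] [c|c] f; try by kill f.
- case: v f g => [v|v] f g; last by kill f.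
  case: a g => [a|a] g; last by kill g.
  by case: d g => [[d|d]|] g; [exact: evbR_some | kill g | exact: evbR_some].
- case: v f g => [v|v] f g; first by kill f.
  case: a g => [a|a] g; first by kill g.
  by case: d g => [[d|d]|] g; [kill g | exact: evbR_some | exact: evbR_some].
Qed.
(** The hypothesis on sides excludes the case where [letterL] is zero while [theta a b None f] may
    be nonzero. *)
Lemma evL4_unit a b c f : side b = side c ->
  evL4 a b c (Some c) (letterL_unit a b c f) = theta a b None f.
Proof.
by case: a b c f => [a|a] [b|b] [c|c] f // _; try (by kill f); exact: evbL_unit.
Qed.
Lemma evR4_unit a b c f : side a = side b ->
  evR4 a b c (Some a) (letterR_unit a b c f) = shift (theta b c None f).
Proof.
by case: a b c f => [a|a] [b|b] [c|c] f // _; try (by kill f); exact: evbR_unit.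
Qed.

Lemma ev4_assoc a b c d m :
  ocomp (evR4 a b c d (letter_assoc a b c d m)) (lamo d) = ocomp (evL4 a b c d m) (lamo d).
Proof.
case: a b c m => [a|a] [b|b] [c|c] m; try by rewrite !ocomp0l.
- case: d m => [[d|d]|] m; [|by rewrite !ocomp0l|].
  + exact: (@evb_assoc K C D S T ssC ssD EndC EndD true a b c (Some d)).
  + exact: (@evb_assoc K C D S T ssC ssD EndC EndD true a b c None).
- case: d m => [[d|d]|] m; [by rewrite !ocomp0l| |].
  + exact: (@evb_assoc K C D S T ssC ssD EndC EndD false a b c (Some d)).
  + exact: (@evb_assoc K C D S T ssC ssD EndC EndD false a b c None).
Qed.

Lemma letter_assoc_bij a b c d : bijective (@letter_assoc K C D S T a b c d).
Proof.
case: a b c => [a|a] [b|b] [c|c]; try exact: bij_lid.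
- by case: d => [[d|d]|]; [exact: base_assoc_bij | exact: bij_lid | exact: base_assoc_bij].
- by case: d => [[d|d]|]; [exact: bij_lid | exact: base_assoc_bij | exact: base_assoc_bij].
Qed.

Definition outL_sum a b c v : lmodType K :=
  prodm (dsum (fun u : letter => tens (B a b (Some u)) (B u c (Some v)))) (B a b None).
(** Coordinates on [L_0]: the summands with [u <> 1], and the scalar that represents the summand
    [u = 1]. They undo [letterL_in] and [letterL_unit], and so provide the inverse of the
    rearrangement in case (4). *)
Definition outL a b c v : {linear LL a b c (Some v) -> outL_sum a b c v} :=
  match a, b, c, v return {linear LL a b c (Some v) -> outL_sum a b c v} with
  | inl a, inl b, inl c, inl v => dlift (fun o : option S =>
      match o return {linear tens (@bracket K C S (Some a) (Some b) o) (bracket o (Some c) (Some v)) ->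
         outL_sum (inl a) (inl b) (inl c) (inl v)} with
      | Some u => linl \ol @dinj K letter
          (fun u : letter => tens (B (inl a) (inl b) (Some u)) (B u (inl c) (Some (inl v)))) (inl u)
      | None => linr \ol tunitr _ \ol tmap lid (lcoef true c (Some v))
      end)
  | inr a, inr b, inr c, inr v => dlift (fun o : option T =>
      match o return {linear tens (@bracket K D T (Some a) (Some b) o) (bracket o (Some c) (Some v)) ->
         outL_sum (inr a) (inr b) (inr c) (inr v)} with
      | Some u => linl \ol @dinj K letter
          (fun u : letter => tens (B (inr a) (inr b) (Some u)) (B u (inr c) (Some (inr v)))) (inr u)
      | None => linr \ol tunitr _ \ol tmap lid (lcoef false c (Some v))
      end)
  | _, _, _, _ => lzero
  end.
Definition outL0_sum a b c : lmodType K :=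
  dsum (fun u : letter => tens (B a b (Some u)) (B u c None)).
Definition outL0 a b c : {linear LL a b c None -> outL0_sum a b c} :=
  match a, b, c return {linear LL a b c None -> outL0_sum a b c} with
  | inl a, inl b, inl c => dlift (fun o : option S =>
      match o return {linear tens (@bracket K C S (Some a) (Some b) o) (bracket o (Some c) None) ->
         outL0_sum (inl a) (inl b) (inl c)} with
      | Some u => @dinj K letter
          (fun u : letter => tens (B (inl a) (inl b) (Some u)) (B u (inl c) None)) (inl u)
      | None => lzero
      end)
  | inr a, inr b, inr c => dlift (fun o : option T =>
      match o return {linear tens (@bracket K D T (Some a) (Some b) o) (bracket o (Some c) None) ->
         outL0_sum (inr a) (inr b) (inr c)} with
      | Some u => @dinj K letter
          (fun u : letter => tens (B (inr a) (inr b) (Some u)) (B u (inr c) None)) (inr u)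
      | None => lzero
      end)
  | _, _, _ => lzero
  end.

Lemma outL_in a b c v u f g :
  outL a b c v (letterL_in a b c (Some v) u (tpure f g)) =
  linl (@dinj K letter (fun u : letter => tens (B a b (Some u)) (B u c (Some v))) u (tpure f g)).
Proof.
case: a b f => [a|a] [b|b] f; try by kill f.
- case: u f g => [u|u] f g; last by kill f.
  case: c g => [c|c] g; last by kill g.
  by case: v g => [v|v] g; [exact: dlift_inj | kill g].
- case: u f g => [u|u] f g; first by kill f.
  case: c g => [c|c] g; first by kill g.
  by case: v g => [v|v] g; [kill g | exact: dlift_inj].
Qed.
Lemma outL_unit a b c f : side b = side c -> outL a b c c (letterL_unit a b c f) = linr f.
Proof.
case: a b c f => [a|a] [b|b] [c|c] f // _; try (by kill f);
rewrite [LHS]dlift_inj 2!lcompE.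
  by rewrite -[tpurel _ _ f]/(tpure f _) tmapE tunitrE lcoef1 scale1r.
by rewrite -[tpurel _ _ f]/(tpure f _) tmapE tunitrE lcoef1 scale1r.
Qed.
Lemma outL0_in a b c u f g :
  outL0 a b c (letterL_in a b c None u (tpure f g)) =
  @dinj K letter (fun u : letter => tens (B a b (Some u)) (B u c None)) u (tpure f g).
Proof.
case: a b f => [a|a] [b|b] f; try by kill f.
- case: u f g => [u|u] f g; last by kill f.
  case: c g => [c|c] g; last by kill g.
  exact: dlift_inj.
- case: u f g => [u|u] f g; first by kill f.
  case: c g => [c|c] g; first by kill g.
  exact: dlift_inj.
Qed.

(** The images of [letterL_in] and [letterL_unit] span, since Schur reduces the unit summand to
    multiples of [lunit] over [v = c]. The whole family in [v] is treated at once because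
    [letterL_unit] lives over [v = c] alone. *)
Lemma letterL_ext a b c (W : letter -> lmodType K)
    (F G : forall v, {linear LL a b c (Some v) -> W v}) :
  (forall v u f g, F v (letterL_in a b c (Some v) u (tpure f g)) =
                   G v (letterL_in a b c (Some v) u (tpure f g))) ->
  (forall f, F c (letterL_unit a b c f) = G c (letterL_unit a b c f)) ->
  forall v, F v =1 G v.
Proof.
case: a b c F G => [a|a] [b|b] [c|c] F G h1 h2 v m; try (by rewrite [m]null0 !linear0).
- case: v m => [v|v] m; last by rewrite [m]null0 !linear0.
  move: m; apply: (@dtens_ext _ _ _ _ _ (F (inl v)) (G (inl v))) => -[u|] f g.
    exact: (h1 (inl v) (inl u) f g).
  have [[e]|ne] := pselect (Some c = Some v); last first.
    by rewrite (bracket_lunitN ssC g ne) tpure0r !linear0.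
  subst v; have [k ->] := bracket_lunit1 EndC g.
  by rewrite tpureZr !linearZZ; congr (_ *: _); exact: (h2 f).
- case: v m => [v|v] m; first by rewrite [m]null0 !linear0.
  move: m; apply: (@dtens_ext _ _ _ _ _ (F (inr v)) (G (inr v))) => -[u|] f g.
    exact: (h1 (inr v) (inr u) f g).
  have [[e]|ne] := pselect (Some c = Some v); last first.
    by rewrite (bracket_lunitN ssD g ne) tpure0r !linear0.
  subst v; have [k ->] := bracket_lunit1 EndD g.
  by rewrite tpureZr !linearZZ; congr (_ *: _); exact: (h2 f).
Qed.
Lemma letterL0_ext a b c (W : lmodType K) (F G : {linear LL a b c None -> W}) :
  (forall u f g, F (letterL_in a b c None u (tpure f g)) =
                 G (letterL_in a b c None u (tpure f g))) -> F =1 G.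
Proof.
case: a b c F G => [a|a] [b|b] [c|c] F G h1 m; try (by rewrite [m]null0 !linear0).
- move: m; apply: (@dtens_ext _ _ _ _ _ F G) => -[u|] f g.
    exact: (h1 (inl u) f g).
  by rewrite (bracket_lunitN ssC g) // tpure0r !linear0.
- move: m; apply: (@dtens_ext _ _ _ _ _ F G) => -[u|] f g.
    exact: (h1 (inr u) f g).
  by rewrite (bracket_lunitN ssD g) // tpure0r !linear0.
Qed.

Definition outR_sum a b c v : lmodType K :=
  prodm (dsum (fun u : letter => tens (B b c (Some u)) (B a u (Some v)))) (B b c None).
Definition outR a b c v : {linear RR a b c (Some v) -> outR_sum a b c v} :=
  match a, b, c, v return {linear RR a b c (Some v) -> outR_sum a b c v} with
  | inl a, inl b, inl c, inl v => dlift (fun o : option S =>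
      match o return {linear tens (@bracket K C S (Some b) (Some c) o) (bracket (Some a) o (Some v)) ->
         outR_sum (inl a) (inl b) (inl c) (inl v)} with
      | Some u => linl \ol @dinj K letter
          (fun u : letter => tens (B (inl b) (inl c) (Some u)) (B (inl a) u (Some (inl v)))) (inl u)
      | None => linr \ol tunitr _ \ol tmap lid (rcoef true a (Some v))
      end)
  | inr a, inr b, inr c, inr v => dlift (fun o : option T =>
      match o return {linear tens (@bracket K D T (Some b) (Some c) o) (bracket (Some a) o (Some v)) ->
         outR_sum (inr a) (inr b) (inr c) (inr v)} with
      | Some u => linl \ol @dinj K letter
          (fun u : letter => tens (B (inr b) (inr c) (Some u)) (B (inr a) u (Some (inr v)))) (inr u)
      | None => linr \ol tunitr _ \ol tmap lid (rcoef false a (Some v))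
      end)
  | _, _, _, _ => lzero
  end.
Definition outR0_sum a b c : lmodType K :=
  dsum (fun u : letter => tens (B b c (Some u)) (B a u None)).
Definition outR0 a b c : {linear RR a b c None -> outR0_sum a b c} :=
  match a, b, c return {linear RR a b c None -> outR0_sum a b c} with
  | inl a, inl b, inl c => dlift (fun o : option S =>
      match o return {linear tens (@bracket K C S (Some b) (Some c) o) (bracket (Some a) o None) ->
         outR0_sum (inl a) (inl b) (inl c)} with
      | Some u => @dinj K letter
          (fun u : letter => tens (B (inl b) (inl c) (Some u)) (B (inl a) u None)) (inl u)
      | None => lzero
      end)
  | inr a, inr b, inr c => dlift (fun o : option T =>
      match o return {linear tens (@bracket K D T (Some b) (Some c) o) (bracket (Some a) o None) ->
         outR0_sum (inr a) (inr b) (inr c)} with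
      | Some u => @dinj K letter
          (fun u : letter => tens (B (inr b) (inr c) (Some u)) (B (inr a) u None)) (inr u)
      | None => lzero
      end)
  | _, _, _ => lzero
  end.

Lemma outR_in a b c v u f g :
  outR a b c v (letterR_in a b c (Some v) u (tpure f g)) =
  linl (@dinj K letter (fun u : letter => tens (B b c (Some u)) (B a u (Some v))) u (tpure f g)).
Proof.
case: b c f => [b|b] [c|c] f; try by kill f.
- case: u f g => [u|u] f g; last by kill f.
  case: a g => [a|a] g; last by kill g.
  by case: v g => [v|v] g; [exact: dlift_inj | kill g].
- case: u f g => [u|u] f g; first by kill f.
  case: a g => [a|a] g; first by kill g.
  by case: v g => [v|v] g; [kill g | exact: dlift_inj].
Qed.
Lemma outR_unit a b c f : side a = side b -> outR a b c a (letterR_unit a b c f) = linr f.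
Proof.
case: a b c f => [a|a] [b|b] [c|c] f // _; try (by kill f);
rewrite [LHS]dlift_inj 2!lcompE.
  by rewrite -[tpurel _ _ f]/(tpure f _) tmapE tunitrE rcoef1 scale1r.
by rewrite -[tpurel _ _ f]/(tpure f _) tmapE tunitrE rcoef1 scale1r.
Qed.
Lemma outR0_in a b c u f g :
  outR0 a b c (letterR_in a b c None u (tpure f g)) =
  @dinj K letter (fun u : letter => tens (B b c (Some u)) (B a u None)) u (tpure f g).
Proof.
case: b c f => [b|b] [c|c] f; try by kill f.
- case: u f g => [u|u] f g; last by kill f.
  case: a g => [a|a] g; last by kill g.
  exact: dlift_inj.
- case: u f g => [u|u] f g; first by kill f.
  case: a g => [a|a] g; first by kill g.
  exact: dlift_inj.
Qed.

Lemma letterR_ext a b c (W : letter -> lmodType K)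
    (F G : forall v, {linear RR a b c (Some v) -> W v}) :
  (forall v u f g, F v (letterR_in a b c (Some v) u (tpure f g)) =
                   G v (letterR_in a b c (Some v) u (tpure f g))) ->
  (forall f, F a (letterR_unit a b c f) = G a (letterR_unit a b c f)) ->
  forall v, F v =1 G v.
Proof.
case: a b c F G => [a|a] [b|b] [c|c] F G h1 h2 v m; try (by rewrite [m]null0 !linear0).
- case: v m => [v|v] m; last by rewrite [m]null0 !linear0.
  move: m; apply: (@dtens_ext _ _ _ _ _ (F (inl v)) (G (inl v))) => -[u|] f g.
    exact: (h1 (inl v) (inl u) f g).
  have [[e]|ne] := pselect (Some a = Some v); last first.
    by rewrite (bracket_runitN ssC g ne) tpure0r !linear0.
  subst v; have [k ->] := bracket_runit1 EndC g.
  by rewrite tpureZr !linearZZ; congr (_ *: _); exact: (h2 f).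
- case: v m => [v|v] m; first by rewrite [m]null0 !linear0.
  move: m; apply: (@dtens_ext _ _ _ _ _ (F (inr v)) (G (inr v))) => -[u|] f g.
    exact: (h1 (inr v) (inr u) f g).
  have [[e]|ne] := pselect (Some a = Some v); last first.
    by rewrite (bracket_runitN ssD g ne) tpure0r !linear0.
  subst v; have [k ->] := bracket_runit1 EndD g.
  by rewrite tpureZr !linearZZ; congr (_ *: _); exact: (h2 f).
Qed.
Lemma letterR0_ext a b c (W : lmodType K) (F G : {linear RR a b c None -> W}) :
  (forall u f g, F (letterR_in a b c None u (tpure f g)) =
                 G (letterR_in a b c None u (tpure f g))) -> F =1 G.
Proof.
case: a b c F G => [a|a] [b|b] [c|c] F G h1 m; try (by rewrite [m]null0 !linear0).
- move: m; apply: (@dtens_ext _ _ _ _ _ F G) => -[u|] f g.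
    exact: (h1 (inl u) f g).
  by rewrite (bracket_runitN ssC g) // tpure0r !linear0.
- move: m; apply: (@dtens_ext _ _ _ _ _ F G) => -[u|] f g.
    exact: (h1 (inr u) f g).
  by rewrite (bracket_runitN ssD g) // tpure0r !linear0.
Qed.

Definition good a (q : seq letter) : bool := if q is l :: _ then side a != side l else true.
Definition cat_opt d (y : seq letter) := if d is Some c then c :: y else y.

(** The moves of a path in terms of letters: [stepS] fuses or cancels an existing head [b], while
    [stepJ] adds a new letter through [runit]. *)
Definition stepS a b y d : {linear tens (B a b d) (pat (b :: y)) -> pat (cat_opt d y)} :=
  match a, b return {linear tens (B a b d) (pat (b :: y)) -> pat (cat_opt d y)} with
  | inl a, inl b =>
    match d return {linear tens (B (inl a) (inl b) d) (pat (inl b :: y)) -> pat (cat_opt d y)} with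
    | None => pcons (@Lb K C D S T true a) y (Some b) None
    | Some (inl c) => pcons (@Lb K C D S T true a) y (Some b) (Some c)
    | Some (inr _) => lzero
    end
  | inr a, inr b =>
    match d return {linear tens (B (inr a) (inr b) d) (pat (inr b :: y)) -> pat (cat_opt d y)} with
    | None => pcons (@Lb K C D S T false a) y (Some b) None
    | Some (inr c) => pcons (@Lb K C D S T false a) y (Some b) (Some c)
    | Some (inl _) => lzero
    end
  | _, _ => lzero
  end.
Definition stepJ a q : {linear pat q -> pat (a :: q)} :=
  match a return {linear pat q -> pat (a :: q)} with
  | inl s => pcons (@Lb K C D S T true s) q None (Some s)
               \ol tpurer (pat q) (runit (spec_obj (Some s)) : @bracket K C S (Some s) None (Some s))
  | inr s => pcons (@Lb K C D S T false s) q None (Some s)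
               \ol tpurer (pat q) (runit (spec_obj (Some s)) : @bracket K D T (Some s) None (Some s))
  end.
(** The canonical path, which adds the letters of [w] one by one; when paths are read as morphisms
    it is the identity of [w]. *)
Fixpoint ew (w : seq letter) : pat w :=
  if w is a :: w' then stepJ a w' (ew w') else Om.

Lemma theta_stepJ a b c y f t :
  oact (theta a b (Some c) f) (c :: y) (stepJ c y t) = stepS a b y (Some c) (tpure f (stepJ b y t)).
Proof.
case: a b c f => [a|a] [b|b] [c|c] f; try by kill f.
- exact: (@thetas_runit K C D S T ssC ssD EndC EndD true a b c y f t).
- exact: (@thetas_runit K C D S T ssC ssD EndC EndD false a b c y f t).
Qed.
Lemma gd_good a y : good a y -> gd (side a) y.
Proof. by case: a => a; case: y => //= -[b|b]. Qed.
Lemma theta_none_stepJ a b y f t : good a y ->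
  oact (theta a b None f) y t = stepS a b y None (tpure f (stepJ b y t)).
Proof.
move/gd_good; case: a b f => [a|a] [b|b] f gy; try by kill f.
- exact: (@thetan_runit K C D S T ssC ssD EndC EndD true a b y f t gy).
- exact: (@thetan_runit K C D S T ssC ssD EndC EndD false a b y f t gy).
Qed.
Lemma shift_stepS a b y d f t O :
  oact (shift O) (cat_opt d y) (stepS a b y d (tpure f t)) =
  stepS a b y d (tpure f (oact O (b :: y) t)).
Proof.
case: a b f t => [a|a] [b|b] f t; try by kill f.
- case: d f => [[c|c]|] f; try by kill f.
  + exact: (@shift_cons K C D S T O (@Lb K C D S T true a) y (Some b) (Some c) f t).
  + exact: (@shift_cons K C D S T O (@Lb K C D S T true a) y (Some b) None f t).
- case: d f => [[c|c]|] f; try by kill f.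
  + exact: (@shift_cons K C D S T O (@Lb K C D S T false a) y (Some b) (Some c) f t).
  + exact: (@shift_cons K C D S T O (@Lb K C D S T false a) y (Some b) None f t).
Qed.
Lemma shift_stepJ a q t O :
  oact (shift O) (a :: q) (stepJ a q t) = stepJ a q (oact O q t).
Proof.
case: a => a.
- exact: (@shift_cons K C D S T O (@Lb K C D S T true a) q None (Some a) _ t).
- exact: (@shift_cons K C D S T O (@Lb K C D S T false a) q None (Some a) _ t).
Qed.

Section Read.
Variables (W : seq letter -> lmodType K) (a : letter).
Variable phiJ : forall q, {linear pat q -> W (a :: q)}.
Variable phiS : forall b y d, {linear tens (B a b d) (pat (b :: y)) -> W (cat_opt d y)}.

(** A map out of paths prescribed on steps labelled [a]. The prescribed values are enough to define
    it: a step on an empty head is a multiple of [runit], extracted by [rcoef], and all other steps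
    are fusions or cancellations. *)
Fact read_key : {rd : forall w, {linear pat w -> W w} |
  (forall q t, good a q -> rd (a :: q) (stepJ a q t) = phiJ q t) /\
  (forall b y d f t, good a y -> rd (cat_opt d y) (stepS a b y d (tpure f t)) = phiS b y d (tpure f t))}.
Proof.
case: a phiJ phiS => s fJ fS.
- pose phi : stpmap W (@Lb K C D S T true s) := fun y (o o' : option S) =>
   match o, o' return {linear tens (stp (@Lb K C D S T true s) o o') (pat (@ocons K C D S T true o y)) -> W (@ocons K C D S T true o' y)} with
   | None, Some s' => transport W (inl s :: y) (inl s' :: y) \ol fJ y \ol tunitl _ \ol tmap (rcoef true s (Some s')) lid
   | None, None => lzero
   | Some b, Some c => fS (inl b) y (Some (inl c))
   | Some b, None => fS (inl b) y None
   end.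
  exists (telim 0 (at_lab phi)); split=> [q t g|b y d f t g].
    have gy := gd_good g; rewrite /= in gy.
    rewrite [LHS](@telim_cons K C D S T W 0 (at_lab phi) (@Lb K C D S T true s) q None (Some s) _ gy).
    rewrite at_labE /phi 3!lcompE [tmap _ _ _]tmapE rcoef1 tunitlE scale1r.
    exact: transportE.
  have gy := gd_good g; rewrite /= in gy.
  case: b f t => b f t; last by kill f.
  case: d f => [[c|c]|] f.
  + rewrite [LHS](@telim_cons K C D S T W 0 (at_lab phi) (@Lb K C D S T true s) y (Some b) (Some c) _ gy).
    by rewrite at_labE.
  + by kill f.
  + rewrite [LHS](@telim_cons K C D S T W 0 (at_lab phi) (@Lb K C D S T true s) y (Some b) None _ gy).
    by rewrite at_labE.
- pose phi : stpmap W (@Lb K C D S T false s) := fun y (o o' : option T) =>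
   match o, o' return {linear tens (stp (@Lb K C D S T false s) o o') (pat (@ocons K C D S T false o y)) -> W (@ocons K C D S T false o' y)} with
   | None, Some s' => transport W (inr s :: y) (inr s' :: y) \ol fJ y \ol tunitl _ \ol tmap (rcoef false s (Some s')) lid
   | None, None => lzero
   | Some b, Some c => fS (inr b) y (Some (inr c))
   | Some b, None => fS (inr b) y None
   end.
  exists (telim 0 (at_lab phi)); split=> [q t g|b y d f t g].
    have gy := gd_good g; rewrite /= in gy.
    rewrite [LHS](@telim_cons K C D S T W 0 (at_lab phi) (@Lb K C D S T false s) q None (Some s) _ gy).
    rewrite at_labE /phi 3!lcompE [tmap _ _ _]tmapE rcoef1 tunitlE scale1r.
    exact: transportE.
  have gy := gd_good g; rewrite /= in gy.
  case: b f t => b f t; first by kill f.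
  case: d f => [[c|c]|] f.
  + by kill f.
  + rewrite [LHS](@telim_cons K C D S T W 0 (at_lab phi) (@Lb K C D S T false s) y (Some b) (Some c) _ gy).
    by rewrite at_labE.
  + rewrite [LHS](@telim_cons K C D S T W 0 (at_lab phi) (@Lb K C D S T false s) y (Some b) None _ gy).
    by rewrite at_labE.
Qed.
End Read.
End Letters.

(** * Words and triangular spaces *)

Section BijMore.
Variable K : fieldType.
Implicit Types U V W : lmodType K.
Lemma linl_bij U V : (forall v : V, v = 0) -> bijective (linl : {linear U -> prodm U V}).
Proof.
move=> h; apply: (@bij_cancel _ _ _ _ lfst) => [u|[u v]]; first by [].
by rewrite lcompE linlE lidE /= (h v).
Qed.
Lemma linr_bij U V : (forall u : U, u = 0) -> bijective (linr : {linear V -> prodm U V}).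
Proof.
move=> h; apply: (@bij_cancel _ _ _ _ lsnd) => [v|[u v]]; first by [].
by rewrite lcompE linrE lidE /= (h u).
Qed.
Lemma dinj_bij (I : choiceType) (V : I -> lmodType K) i :
  (forall j, i <> j -> forall v : V j, v = 0) -> bijective (@dinj K I V i).
Proof.
move=> h; apply: (@bij_cancel _ _ _ _ (dlift (fun j => transport V j i))).
  by move=> v; rewrite lcompE dlift_inj transportE.
apply: dsum_ext => j v; rewrite lcompE dlift_inj lidE.
have [e|ne] := pselect (i = j); last by rewrite (h _ ne v) !linear0.
by subst j; rewrite transportE.
Qed.
End BijMore.

Lemma transportK (K : fieldType) (I : eqType) (V : I -> lmodType K) i j (v : V i) :
  i = j -> transport V j i (transport V i j v) = v.
Proof. by move=> e; case: j / e; rewrite !transportE. Qed.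

Section Words.
Variables (K : fieldType) (C D : tensorCategory K) (S : spectrum C) (T : spectrum D).
Local Notation letter := (letter S T).
Implicit Types (x y z w : seq letter) (a b c : letter).

Lemma sorted_cat_cons (A : Type) (e : rel A) (s1 s2 : seq A) (p : A) :
  sorted e (s1 ++ p :: s2) = sorted e (rcons s1 p) && path e p s2.
Proof. by case: s1 => //= q s1; rewrite cat_path rcons_path /= andbA. Qed.
Lemma alt_cat_cons x a y :
  alternating (x ++ a :: y) = alternating (rcons x a) && alternating (a :: y).
Proof. by rewrite /alternating sorted_cat_cons. Qed.
(** Alternation is a property of the sequence of sides, so a letter may be exchanged for another one
    of the same side. *)
Lemma alt_map x : alternating x = sorted (fun p q => p != q) (map (@side K C D S T) x).
Proof. by rewrite /alternating sorted_map. Qed.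
Lemma alt_rcons_side x a c : side a = side c -> alternating (rcons x a) -> alternating (rcons x c).
Proof. by rewrite !alt_map !map_rcons => ->. Qed.
Lemma alt_cons_side x a c : side a = side c -> alternating (a :: x) -> alternating (c :: x).
Proof. by rewrite !alt_map /= => ->. Qed.
Lemma alt_fuse x a b c y : alternating (rcons x a) -> alternating (b :: y) ->
  side a = side c -> side b = side c -> alternating (x ++ c :: y).
Proof.
move=> hx hy ac bc; rewrite alt_cat_cons (alt_rcons_side ac hx) /=.
exact: (alt_cons_side bc hy).
Qed.
Lemma joins_rcons_cons x a b y : alternating (rcons x a) -> alternating (b :: y) ->
  joins (rcons x a) (b :: y) = (side a != side b).
Proof.
move=> hx hy; rewrite /joins -cats1 -catA /= alt_cat_cons hx /=.
by rewrite /alternating /= in hy *; rewrite hy andbT.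
Qed.
Lemma alt_catl x y : alternating (x ++ y) -> alternating x.
Proof. by rewrite !alt_map map_cat => /cat_sorted2[]. Qed.
Lemma alt_catr x y : alternating (x ++ y) -> alternating y.
Proof. by rewrite !alt_map map_cat => /cat_sorted2[]. Qed.

(** The word [x ++ c :: y] determines [c], so all entries that survive the filter in [middle] are
    equal. *)
Lemma middleP x y z c : middle x y z = Some c <-> z = x ++ c :: y.
Proof.
rewrite /middle; split=> [|->].
  have : all (fun c => x ++ c :: y == z) [seq c <- z | x ++ c :: y == z] by exact: filter_all.
  by case: [seq _ <- _ | _] => //= d s /andP[/eqP <- _] [->].
have : c \in [seq c0 <- x ++ c :: y | x ++ c0 :: y == x ++ c :: y].
  by rewrite mem_filter eqxx mem_cat inE eqxx orbT.
have : all (fun c0 => x ++ c0 :: y == x ++ c :: y) [seq c0 <- x ++ c :: y | x ++ c0 :: y == x ++ c :: y].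
  exact: filter_all.
case: [seq _ <- _ | _] => //= d s /andP[/eqP e _] _.
by move/eqP: e; rewrite eqseq_cat // eqxx /= => /eqP[->].
Qed.
Lemma middleN x y z c : middle x y z = None -> (x ++ c :: y == z) = false.
Proof.
move=> h; apply/eqP => e; have [_ h2] := middleP x y z c.
by rewrite h2 // in h.
Qed.
End Words.

(** * Triangular spaces and fusion sums in recursive form *)

Section TriIso.
Variables (K : fieldType) (C D : tensorCategory K) (S : spectrum C) (T : spectrum D).
Local Notation letter := (letter S T).
Local Notation word := (word S T).
Local Notation B := (@lbracket K C D S T).
Implicit Types (x y z w : seq letter) (a b c : letter).

Lemma lbracket_nullr' a b c (f : B a b (Some c)) : side a <> side c -> f = 0.
Proof. by case: a b c f => [a|a] [b|b] [c|c] f //= _; exact: null0. Qed.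

(** Copies of [join_out] and [join_in] in which the reversed word is a variable, so that the
    dependent match can be reduced by cases. *)
Let jout rx y z : {linear tri_rev rx y z -> K^o} :=
  match rx return {linear tri_rev rx y z -> K^o} with
  | [::] =>
    if joins (rev [::]) y as j return
      {linear (if j then delta K (rev [::] ++ y == z) else null) -> K^o}
    then guard_out _ else lzero
  | a :: rx' =>
    if joins (rev (a :: rx')) y as j return
      {linear (if j then delta K (rev (a :: rx') ++ y == z) else _) -> K^o}
    then guard_out _ else lzero
  end.
Let jin rx y z : {linear K^o -> tri_rev rx y z} :=
  match rx return {linear K^o -> tri_rev rx y z} with
  | [::] =>
    if joins (rev [::]) y as j return
      {linear K^o -> (if j then delta K (rev [::] ++ y == z) else null)}
    then guard_in _ else lzero
  | a :: rx' =>
    if joins (rev (a :: rx')) y as j return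
      {linear K^o -> (if j then delta K (rev (a :: rx') ++ y == z) else _)}
    then guard_in _ else lzero
  end.
Let joutP rx y z : joins (rev rx) y ->
  [/\ forall m, jout rx y z m = 0 -> m = 0,
      z = rev rx ++ y -> forall k, jout rx y z (jin rx y z k) = k
    & z <> rev rx ++ y -> forall m : tri_rev rx y z, m = 0].
Proof.
case: rx => [|a rx]; rewrite /jout /jin [tri_rev _ _ _]/= => h.
  have -> /= : joins [::] y by [].
  split=> [m|e k|ne m]; last by apply: guard0; apply/eqP => e; apply: ne.
    by move=> e; rewrite -[m]guard_outK e linear0.
  by rewrite guard_inK // e.
move: h; case: (joins (rev (a :: rx)) y) => // _.
split=> [m|e k|ne m]; last by apply: guard0; apply/eqP => e; apply: ne.
  by move=> e; rewrite -[m]guard_outK e linear0.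
by rewrite guard_inK // e.
Qed.

Lemma join_out_inj x y z m : joins x y -> join_out x y z m = 0 -> m = 0.
Proof.
move=> h; have h' : joins (rev (rev x)) y by rewrite revK.
by have [h1 _ _] := @joutP (rev x) y z h'; exact: h1.
Qed.
Lemma join_inK x y z k : joins x y -> z = x ++ y -> join_out x y z (join_in x y z k) = k.
Proof.
move=> h e; have h' : joins (rev (rev x)) y by rewrite revK.
by have [_ h1 _] := @joutP (rev x) y z h'; apply: h1; rewrite revK.
Qed.
Lemma tri_join0 x y z (m : tri x y z) : joins x y -> z <> x ++ y -> m = 0.
Proof.
move=> h e; have h' : joins (rev (rev x)) y by rewrite revK.
by have [_ _ h1] := @joutP (rev x) y z h'; apply: h1; rewrite revK.
Qed.
Lemma join_outK x y z (m : tri x y z) : joins x y ->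
  m = join_in x y z (join_out x y z m).
Proof.
move=> h; have [e|ne] := pselect (z = x ++ y); last first.
  by rewrite (tri_join0 m h ne) !linear0.
apply/eqP; rewrite -subr_eq0; apply/eqP/(join_out_inj h).
by rewrite linearB join_inK // subrr.
Qed.
Lemma join_out_bij x y z : joins x y -> z = x ++ y -> bijective (@join_out K C D S T x y z).
Proof.
move=> h e; exists (join_in x y z) => m; last exact: join_inK.
by rewrite -join_outK.
Qed.

(** Joining preserves the total length, fusing lowers it by one, cancelling by two. This kills the
    cancelling summand of [split] when [z] is a fused word. *)
Lemma tri_rev_size rx y z (m : tri_rev rx y z) : (size rx + size y < size z)%N -> m = 0.
Proof.
elim: rx y m => [|a rx ih] y m sz; first rewrite /= in m *.
  move: m; case: (joins (rev [::]) y) => m; last exact: null0.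
  by apply: guard0; apply/eqP => e; rewrite -e /= ltnn in sz.
rewrite [tri_rev _ _ _]/= in m *; move: m; case: (joins (rev (a :: rx)) y) => m.
  apply: guard0; apply/eqP => e; rewrite -e size_cat size_rev ltnn in sz.
  by [].
move: m sz; case: y => [|b y] m sz; first exact: null0.
move: m; rewrite /tri_fused; case: (nilp (rev rx) && nilp y).
  by clear ih; case: z sz => [|c [|c' z]] sz m; [by [] | by rewrite /= addnS in sz | exact: null0].
case E: (middle (rev rx) y z) => [c|] m.
  have [/(_ E) e _] := middleP (rev rx) y z c.
  by move: sz; rewrite e size_cat size_rev /= !addSn !addnS => /ltnW; rewrite ltnn.
apply: tens0r => v; apply: ih.
by move: sz; rewrite /= addSn addnS => /ltnW /ltnW.
Qed.
Lemma tri_size0 x y z (m : tri x y z) : (size x + size y < size z)%N -> m = 0.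
Proof. by move=> h; apply: tri_rev_size; rewrite size_rev. Qed.

(** At most one part of the target survives: if [z = x c y], then [z] is too long for the cancelling
    part, and otherwise no fused letter fits. Two single letters form a separate clause of the
    definition. The word [x1] stands for [rev (rev x)], equal but not convertible to [x]. *)
Lemma split_fused_bij x1 x a b y z : x1 = x -> bijective (@split_fused K C D S T x1 x a b y z).
Proof.
move=> ->; rewrite /split_fused /tri_fused; case e: (nilp x && nilp y).
  case/andP: e => /nilP -> /nilP ->; have j0 : @joins K C D S T [::] [::] by [].
  case: z => [|c [|c' z]].
  - apply: bij_lcomp.
      by apply: linr_bij; apply: dsum_triv => c v; apply: guard0.
    apply: (@bij_cancel _ _ _ _ (tunitr _ \ol tmap lid (join_out [::] [::] [::]))).
      move=> f; rewrite 2!lcompE -[tpurel _ _ f]/(tpure f _) tmapE join_inK //.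
      by rewrite tunitrE scale1r.
    apply: tens_ext => f m; rewrite 2!lcompE tmapE tunitrE.
    rewrite -[tpurel _ _ _]/(tpure _ _) tpureZl -tpureZr !lidE; congr tpure.
    exact: mulr1.
  - apply: bij_lcomp; last by apply: guard_in_bij; rewrite eqxx.
    apply: bij_lcomp; last first.
      by apply: dinj_bij => d ne v; apply: guard0; apply/eqP => -[h]; apply: ne.
    by apply: linl_bij; apply: tens0r => v; apply: (tri_join0 v j0).
  - apply: bij_triv; first exact: null0.
    apply: prodm0; first by apply: dsum_triv => d v; apply: guard0; rewrite /= eqseq_cons andbF.
    by apply: tens0r => v; apply: (tri_join0 v j0).
move: (@middleP K C D S T x y z) (@middleN K C D S T x y z).
case: (middle x y z) => [c|] h1 h2.
  have [/(_ erefl) ez _] := h1 c.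
  apply: bij_lcomp; last by apply: guard_in_bij; rewrite ez eqxx.
  apply: bij_lcomp; last first.
    apply: dinj_bij => d ne v; apply: guard0; apply/eqP => h; apply: ne.
    by move/eqP: h; rewrite ez eqseq_cat // eqxx /= => /eqP[].
  apply: linl_bij; apply: tens0r => v; apply: tri_size0.
  by rewrite ez size_cat /= addnS.
by apply: linr_bij; apply: dsum_triv => d v; apply: guard0; rewrite h2.
Qed.

Lemma split_bij x y x' a b y' z : x = rcons x' a -> y = b :: y' -> ~~ joins x y ->
  bijective (@split K C D S T x y x' a b y' z).
Proof.
move=> -> -> nj; rewrite /split; apply: bij_lcomp; last first.
  have h := @transport_bij K _ (fun p : seq letter * seq letter => tri_rev p.1 p.2 z)
    (rev (rcons x' a), b :: y') (a :: rev x', b :: y').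
  by apply: h; rewrite rev_rcons.
rewrite /split_rev.
have : ~~ joins (rev (a :: rev x')) (b :: y') by rewrite rev_cons revK.
rewrite [tri_rev _ _ _]/=; case: (joins (rev (a :: rev x')) (b :: y')) => // _.
by apply: split_fused_bij; rewrite revK.
Qed.

Lemma join_dinj x y (F : seq letter -> lmodType K) (u : word) f m :
  join x y F (dinj u (tpure f m)) =
  (join_out x y (val u) f : K) *: transport F (val u) (x ++ y) m.
Proof. by rewrite /join dlift_inj 2!lcompE tmapE tunitlE linearZZ. Qed.

(** Only the summand at the concatenation is nonzero, and its bracket is a line with generator
    [join_in 1]. *)
Lemma join_bij x y (F : seq letter -> lmodType K) : joins x y -> bijective (@join K C D S T x y F).
Proof.
move=> h; pose u0 : word := exist _ (x ++ y) h.
apply: (@bij_cancel _ _ _ _ (dinj u0 \ol tpurer (F (x ++ y)) (join_in x y (x ++ y) 1))).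
  apply: dtens_ext => -[w hw] f m; rewrite 2!lcompE lidE join_dinj -[val (exist _ w hw)]/w -[tpurer _ _ _]/(tpure _ _).
  have [e|ne] := pselect (w = x ++ y); last first.
    by rewrite (tri_join0 f h ne) tpure0l [join_out _ _ _ _]linear0 scale0r
      tpure0r [LHS]linear0 [RHS]linear0.
  subst w; rewrite transportE tpureZr -tpureZl.
  rewrite -linearZZ.
  have -> : (join_out x y (x ++ y) f : K) *: (1 : K^o) = join_out x y (x ++ y) f by exact: mulr1.
  rewrite -join_outK //.
  by rewrite /u0 (bool_irrelevance h hw).
by move=> m; rewrite 2!lcompE -[tpurer _ _ _]/(tpure _ _) join_dinj -[val u0]/(x ++ y)
  join_inK // scale1r transportE.
Qed.

Section Expand.
Variables (x y : seq letter) (F : seq letter -> lmodType K).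
Variables (x' : seq letter) (a b : letter) (y' : seq letter).
Hypotheses (ex : x = rcons x' a) (ey : y = b :: y') (nj : ~~ joins x y).

Local Notation linvsplit z := (linv (split x y x' a b y' z)).

Lemma expand_linl (u : word) c g m :
  expand x y F x' a b y' (dinj u (tpure (linvsplit (val u) (linl (dinj c g))) m)) =
  linl (dinj c (tpure (guard_out _ g) (transport F (val u) (x' ++ c :: y') m))).
Proof.
rewrite /expand dlift_inj lpairE linlE; congr pair.
  rewrite lcompE tmapE lcompE linvVK; last exact: split_bij.
  by rewrite [lfst _](_ : _ = dinj c g) // tdsumlE lcompE tmapE lidE.
rewrite 2!lcompE tmapE lcompE linvVK; last exact: split_bij.
rewrite [lsnd _](_ : _ = 0) // tpure0l [tassoc _ _ _ _]linear0.
exact: linear0.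
Qed.
Lemma expand_linr (u : word) f g m :
  expand x y F x' a b y' (dinj u (tpure (linvsplit (val u) (linr (tpure f g))) m)) =
  linr (tpure f (dinj u (tpure g m))).
Proof.
rewrite /expand dlift_inj lpairE linrE; congr pair.
  rewrite lcompE tmapE lcompE linvVK; last exact: split_bij.
  rewrite [lfst _](_ : _ = 0) // tpure0l.
  exact: linear0.
rewrite 2!lcompE tmapE lcompE linvVK; last exact: split_bij.
by rewrite [lsnd _](_ : _ = tpure f g) // tassocE tmapE !lidE.
Qed.

Hypotheses (hx : alternating x) (hy : alternating y).
Lemma side_ab : side a = side b.
Proof.
apply/eqP; move: nj; rewrite ex ey joins_rcons_cons ?negbK //; [by rewrite -ex | by rewrite -ey].
Qed.
Lemma fuse_alt c : side a = side c -> alternating (x' ++ c :: y').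
Proof.
move=> ac; apply: (@alt_fuse _ _ _ _ _ x' a b c y'); rewrite -?ex -?ey //.
by rewrite -side_ab.
Qed.

(** The sum defining [fus] runs over alternating words, so [insub] has to certify the fused word. By
    [fuse_alt] it can fail only for [c] on the wrong side, where the bracket is zero. *)
Definition unexpand_some c : {linear tens (B a b (Some c)) (F (x' ++ c :: y')) -> fus x y F} :=
  match insub (x' ++ c :: y') : option word with
  | Some u => dinj u \ol tmap (linvsplit (val u) \ol linl \ol dinj c \ol guard_in _) (transport F (x' ++ c :: y') (val u))
  | None => lzero
  end.
Definition unexpand : {linear prodm (dsum (fun c => tens (B a b (Some c)) (F (x' ++ c :: y'))))
      (tens (B a b None) (fus x' y' F)) -> fus x y F} :=
  lcase (dlift unexpand_some)
    (tdsumr (fun u : word => dinj u \ol tmap (linvsplit (val u) \ol linr) lid \ol tassocV _ _ _)).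

Lemma expand_bij : bijective (@expand K C D S T x y F x' a b y').
Proof.
apply: (@bij_cancel _ _ _ _ unexpand).
  apply: dtens_ext => u f m; rewrite lcompE lidE.
  rewrite -[f](linvK (f := split x y x' a b y' (val u))); last exact: split_bij.
  move: (split x y x' a b y' (val u) f) => {}f; move: f.
  apply: (@prodm_ext _ _ _ _
     (unexpand \ol expand x y F x' a b y' \ol dinj u \ol tpurel _ m \ol linvsplit (val u))
     (dinj u \ol tpurel _ m \ol linvsplit (val u))).
    apply: (@dsum_ext _ _ _ _
      (unexpand \ol expand x y F x' a b y' \ol dinj u \ol tpurel _ m \ol linvsplit (val u) \ol linl)
      (dinj u \ol tpurel _ m \ol linvsplit (val u) \ol linl)) => c g.
    have [/eqP e|/negP ne] := pselect ((x' ++ c :: y' == val u) = true); last first.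
      by rewrite [g]guard0 // !linear0.
    rewrite -[g]guard_outK; move: (guard_out _ g) => {}g.
    rewrite !lcompE -[tpurel _ _ _]/(tpure _ _) expand_linl guard_inK; last by apply/eqP.
    rewrite /unexpand lcase_inl dlift_inj /unexpand_some.
    have au : alternating (x' ++ c :: y') by rewrite e; exact: valP u.
    case: insubP => [u' _ eu'|/negP na]; last by case: (na au).
    have <- : u = u' by apply: val_inj; rewrite eu' e.
    by rewrite lcompE tmapE !lcompE transportK // e.
  apply: (@tens_ext _ _ _ _
      (unexpand \ol expand x y F x' a b y' \ol dinj u \ol tpurel _ m \ol linvsplit (val u) \ol linr)
      (dinj u \ol tpurel _ m \ol linvsplit (val u) \ol linr)) => f g.
  rewrite !lcompE -[tpurel _ _ _]/(tpure _ _) expand_linr /unexpand lcase_inr.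
  by rewrite tdsumrE 2!lcompE tassocVE tmapE.
apply: prodm_ext => p; rewrite lcompE lidE.
  move: p; apply: (@dtens_ext _ _ _ _ _ (expand x y F x' a b y' \ol unexpand \ol linl) linl) => c f m.
  rewrite 2!lcompE /unexpand lcase_inl dlift_inj /unexpand_some.
  have [sc|/eqP sc] := eqVneq (side a) (side c); last first.
    by rewrite (lbracket_nullr' f sc) tpure0l !linear0.
  case: insubP => [u _ eu|]; last by rewrite fuse_alt.
  rewrite lcompE tmapE !lcompE expand_linl guard_inK; last by rewrite eu.
  by rewrite transportK // eu.
move: p; apply: (@tens_ext _ _ _ _ (expand x y F x' a b y' \ol unexpand \ol linr) linr) => f n.
move: n; apply: (@dtens_ext _ _ _ _ _ (expand x y F x' a b y' \ol unexpand \ol linr \ol tpurer _ f)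
   (linr \ol tpurer _ f)) => u g m.
rewrite !lcompE /unexpand lcase_inr -[tpurer _ _ _]/(tpure _ _) tdsumrE 2!lcompE tassocVE tmapE.
by rewrite expand_linr.
Qed.
End Expand.
End TriIso.

(** * Rearranging the sums of case (4) for a middle word of one letter *)

Section Sigma4.
Variables (K : fieldType) (I : choiceType).
Variables (U : I -> lmodType K) (Q : I -> I -> lmodType K) (Q0 : I -> lmodType K).
Variables (X U0 : lmodType K) (gam : I -> bool) (c : I).
Variables (Z : I -> lmodType K) (Z0 : lmodType K).
Variables (iota : forall v u, {linear tens (U u) (Q u v) -> Z v}) (kappa : {linear U0 -> Z c}).
Variable iota0 : forall u, {linear tens (U u) (Q0 u) -> Z0}.

(** For the left side [U u = [a b; u]], [Q u v = [u c; v]], [Q0 u = [u c; 1]], [X = [x' z'; w]],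
    [Z v = L_0(a,b,c;v)] and [Z0 = L_0(a,b,c;1)]. The last summand is [u = 1], where only [v = c]
    remains. The right side is the same pattern mirrored, whence the abstraction. *)
Definition sig4_src : lmodType K :=
  prodm (dsum (fun u => tens (U u)
           (prodm (dsum (fun v => guard (gam v) (Q u v))) (tens (Q0 u) X))))
        (tens U0 (guard (gam c) K^o)).
Definition sig4_tgt : lmodType K :=
  prodm (dsum (fun v => guard (gam v) (Z v))) (tens Z0 X).

Definition sig4_u u : {linear tens (U u) (prodm (dsum (fun v => guard (gam v) (Q u v))) (tens (Q0 u) X)) -> sig4_tgt} :=
  lpair (tdsumr (fun v => dinj v \ol guard_in (gam v) \ol iota v u \ol tmap lid (guard_out _)) \ol tmap lid lfst)
        (tmap (iota0 u) lid \ol tassocV _ _ _ \ol tmap lid lsnd).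
Definition sig4_0 : {linear tens U0 K^o -> sig4_tgt} :=
  linl \ol dinj c \ol guard_in (gam c) \ol kappa \ol tunitr _.
Definition sig4 : {linear sig4_src -> sig4_tgt} :=
  lcase (dlift sig4_u) (sig4_0 \ol tmap lid (guard_out _)).

Lemma sig4_u_inl u f v g :
  sig4_u u (tpure f (linl (dinj v g))) = linl (dinj v (guard_in (gam v) (iota v u (tpure f (guard_out _ g))))).
Proof.
rewrite /sig4_u lpairE linlE; congr pair.
  by rewrite lcompE tmapE lidE [lfst _](_ : _ = dinj v g) // tdsumrE 3!lcompE tmapE.
rewrite 2!lcompE tmapE lidE [lsnd _](_ : _ = 0) // tpure0r [tassocV _ _ _ _]linear0.
exact: linear0.
Qed.
Lemma sig4_u_inr u f g t :
  sig4_u u (tpure f (linr (tpure g t))) = linr (tpure (iota0 u (tpure f g)) t).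
Proof.
rewrite /sig4_u lpairE linrE; congr pair.
  rewrite lcompE tmapE lidE [lfst _](_ : _ = 0) // tpure0r.
  exact: linear0.
by rewrite 2!lcompE tmapE lidE [lsnd _](_ : _ = tpure g t) // tassocVE tmapE.
Qed.
Lemma sig4_0E f k : sig4_0 (tpure f k) = linl (dinj c (guard_in (gam c) (kappa ((k : K) *: f)))).
Proof. by rewrite /sig4_0 4!lcompE tunitrE. Qed.
Lemma sig4_inr f k :
  sig4 (linr (tpure f k)) = linl (dinj c (guard_in (gam c) (kappa ((guard_out _ k : K) *: f)))).
Proof. by rewrite /sig4 lcase_inr lcompE tmapE sig4_0E lidE. Qed.
Lemma sig4_inl u t : sig4 (linl (dinj u t)) = sig4_u u t.
Proof. by rewrite /sig4 lcase_inl dlift_inj. Qed.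

Section Bij.
Variable out : forall v, {linear Z v -> prodm (dsum (fun u => tens (U u) (Q u v))) U0}.
Variable out0 : {linear Z0 -> dsum (fun u => tens (U u) (Q0 u))}.
Hypothesis out_iota : forall v u f g, out v (iota v u (tpure f g)) = linl (dinj u (tpure f g)).
Hypothesis out_kappa : forall f, out c (kappa f) = linr f.
Hypothesis Z_ext : forall (W : I -> lmodType K) (F G : forall v, {linear Z v -> W v}),
  (forall v u f g, F v (iota v u (tpure f g)) = G v (iota v u (tpure f g))) ->
  (forall f, F c (kappa f) = G c (kappa f)) -> forall v, F v =1 G v.
Hypothesis out0_iota : forall u f g, out0 (iota0 u (tpure f g)) = dinj u (tpure f g).
Hypothesis Z0_ext : forall (W : lmodType K) (F G : {linear Z0 -> W}),
  (forall u f g, F (iota0 u (tpure f g)) = G (iota0 u (tpure f g))) -> F =1 G.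

Definition sig4V_v v : {linear prodm (dsum (fun u => tens (U u) (Q u v))) U0 -> sig4_src} :=
  lcase (dlift (fun u => linl \ol dinj u \ol tmap lid (linl \ol dinj v \ol guard_in (gam v))))
    (linr \ol tpurel _ (guard_in (gam c) (1 : K^o))).
Definition sig4V_0 : {linear tens Z0 X -> sig4_src} :=
  tdsuml (fun u => linl \ol dinj u \ol tmap lid linr \ol tassoc _ _ _) \ol tmap out0 lid.
Definition sig4V : {linear sig4_tgt -> sig4_src} :=
  lcase (dlift (fun v => sig4V_v v \ol out v \ol guard_out _)) sig4V_0.

Lemma sig4V_v_inl v u f g : sig4V_v v (linl (dinj u (tpure f g))) =
  linl (dinj u (tpure f (linl (dinj v (guard_in (gam v) g))))).
Proof. by rewrite /sig4V_v lcase_inl dlift_inj 2!lcompE tmapE. Qed.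
Lemma sig4V_v_inr v f : sig4V_v v (linr f) = linr (tpure f (guard_in (gam c) (1 : K^o))).
Proof. by rewrite /sig4V_v lcase_inr lcompE. Qed.

(** The inverse sorts [Z v] and [Z0] by the coordinates [out] and [out0]. That [iota] and [kappa]
    jointly span enters through the extensionality principles [Z_ext] and [Z0_ext]. *)
Lemma sig4_bij : bijective sig4.
Proof.
apply: (@bij_cancel _ _ _ _ sig4V).
  apply: prodm_ext => p; rewrite lcompE lidE.
    move: p; apply: (@dtens_ext _ _ _ _ _ (sig4V \ol sig4 \ol linl) linl) => u f s; rewrite 2!lcompE sig4_inl.
    move: s; apply: (@prodm_ext _ _ _ _ (sig4V \ol sig4_u u \ol tpurer _ f) (linl \ol dinj u \ol tpurer _ f)).
      apply: (@dsum_ext _ _ _ _ (sig4V \ol sig4_u u \ol tpurer _ f \ol linl) (linl \ol dinj u \ol tpurer _ f \ol linl)) => v g.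
      have [gv|/negP ngv] := pselect (gam v = true); last by rewrite [g]guard0 // !linear0.
      rewrite !lcompE -[tpurer _ f _]/(tpure f _) sig4_u_inl /sig4V lcase_inl dlift_inj 2!lcompE.
      by rewrite guard_inK // out_iota sig4V_v_inl guard_outK.
    apply: (@tens_ext _ _ _ _ (sig4V \ol sig4_u u \ol tpurer _ f \ol linr) (linl \ol dinj u \ol tpurer _ f \ol linr)) => g t.
    rewrite !lcompE -[tpurer _ f _]/(tpure f _) sig4_u_inr /sig4V lcase_inr /sig4V_0 lcompE tmapE out0_iota.
    by rewrite tdsumlE 3!lcompE tassocE tmapE.
  move: p; apply: (@tens_ext _ _ _ _ (sig4V \ol sig4 \ol linr) linr) => f k; rewrite 2!lcompE sig4_inr.
  have [gc|/negP ngc] := pselect (gam c = true); last by rewrite [k]guard0 // tpure0r !linear0 ?scale0r ?linear0.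
  rewrite /sig4V lcase_inl dlift_inj 2!lcompE guard_inK // out_kappa sig4V_v_inr.
  rewrite tpureZl -tpureZr -linearZZ.
  have -> : (guard_out (gam c) k : K) *: (1 : K^o) = guard_out (gam c) k by exact: mulr1.
  by rewrite guard_outK.
apply: prodm_ext => p; rewrite lcompE lidE.
  move: p; apply: (@dsum_ext _ _ _ _ (sig4 \ol sig4V \ol linl) linl) => v z.
  have [gv|/negP ngv] := pselect (gam v = true); last by rewrite [z]guard0 // !linear0.
  rewrite -[z]guard_outK; move: (guard_out _ z) => {}z.
  rewrite 2!lcompE /sig4V lcase_inl dlift_inj 2!lcompE guard_inK //.
  move: v z {gv}; apply: (@Z_ext (fun _ => sig4_tgt) (fun v => sig4 \ol sig4V_v v \ol out v) (fun v => linl \ol dinj v \ol guard_in (gam v))) => [v u f g|f].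
    rewrite !lcompE out_iota sig4V_v_inl sig4_inl sig4_u_inl.
    have [gv|/negP ngv] := pselect (gam v = true); first by rewrite guard_inK.
    by congr (linl (dinj v _)); rewrite [LHS]guard0 // [RHS]guard0.
  rewrite !lcompE out_kappa sig4V_v_inr sig4_inr.
  have [gc|/negP ngc] := pselect (gam c = true); first by rewrite guard_inK // scale1r.
  by congr (linl (dinj c _)); rewrite [LHS]guard0 // [RHS]guard0.
move: p; apply: (@tens_ext _ _ _ _ (sig4 \ol sig4V \ol linr) linr) => z t.
move: z; apply: (@Z0_ext _ (sig4 \ol sig4V \ol linr \ol tpurel _ t) (linr \ol tpurel _ t)) => u f g.
rewrite !lcompE -[tpurel _ t _]/(tpure _ t) /sig4V lcase_inr /sig4V_0 lcompE tmapE out0_iota.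
by rewrite tdsumlE 3!lcompE tassocE tmapE sig4_inl sig4_u_inr.
Qed.
End Bij.

Variables (C D : tensorCategory K) (S : spectrum C) (T : spectrum D).
Local Notation op := (@op K C D S T).
Variables (e : forall u, {linear U u -> op}) (q : forall u v, {linear Q u v -> op}).
Variables (q0 : forall u, {linear Q0 u -> op}) (tX : {linear X -> op}) (e0 : {linear U0 -> op}).
Variables (E : forall v, {linear Z v -> op}) (E0 : {linear Z0 -> op}).
Hypothesis E_iota : forall v u f g, E v (iota v u (tpure f g)) = ocomp (e u f) (q u v g).
Hypothesis E_kappa : forall f, E c (kappa f) = e0 f.
Hypothesis E0_iota : forall u f g, E0 (iota0 u (tpure f g)) = ocomp (e u f) (q0 u g).
Definition sig4_tgt_ev : {linear sig4_tgt -> op} :=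
  lcase (dlift (fun v => E v \ol guard_out _)) (omul E0 tX).
Definition sig4_src_ev : {linear sig4_src -> op} :=
  lcase (dlift (fun u => omul (e u) (lcase (dlift (fun v => q u v \ol guard_out _)) (omul (q0 u) tX))))
    (omul e0 (vec oid \ol guard_out _)).
Lemma sig4_ev p : sig4_tgt_ev (sig4 p) = sig4_src_ev p.
Proof.
move: p; apply: (@prodm_ext _ _ _ _ (sig4_tgt_ev \ol sig4) sig4_src_ev).
  apply: (@dtens_ext _ _ _ _ _ (sig4_tgt_ev \ol sig4 \ol linl) (sig4_src_ev \ol linl)) => u f s.
  rewrite !lcompE sig4_inl /sig4_src_ev lcase_inl dlift_inj omulE.
  move: s; apply: (@prodm_ext _ _ _ _ (sig4_tgt_ev \ol sig4_u u \ol tpurer _ f)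
    (ocompl (e u f) \ol lcase (dlift (fun v => q u v \ol guard_out _)) (omul (q0 u) tX))).
    apply: (@dsum_ext _ _ _ _ (sig4_tgt_ev \ol sig4_u u \ol tpurer _ f \ol linl)
    (ocompl (e u f) \ol lcase (dlift (fun v => q u v \ol guard_out _)) (omul (q0 u) tX) \ol linl)) => v g.
    have [gv|/negP ngv] := pselect (gam v = true); last by rewrite [g]guard0 // !linear0.
    rewrite !lcompE -[tpurer _ f _]/(tpure f _) sig4_u_inl /sig4_tgt_ev !lcase_inl !dlift_inj !lcompE.
    by rewrite guard_inK // E_iota.
  apply: (@tens_ext _ _ _ _ (sig4_tgt_ev \ol sig4_u u \ol tpurer _ f \ol linr)
    (ocompl (e u f) \ol lcase (dlift (fun v => q u v \ol guard_out _)) (omul (q0 u) tX) \ol linr)) => g t.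
  rewrite !lcompE -[tpurer _ f _]/(tpure f _) sig4_u_inr /sig4_tgt_ev !lcase_inr !omulE.
  by rewrite E0_iota -ocompA.
apply: (@tens_ext _ _ _ _ (sig4_tgt_ev \ol sig4 \ol linr) (sig4_src_ev \ol linr)) => f k.
rewrite !lcompE sig4_inr /sig4_tgt_ev lcase_inl dlift_inj lcompE /sig4_src_ev lcase_inr omulE.
have [gc|/negP ngc] := pselect (gam c = true); last first.
  rewrite [k]guard0 // [guard_in (gam c) _]guard0 // [(vec oid \ol _) _]linear0 ocomp0r.
  by rewrite [X in E c X]linear0 linear0.
rewrite guard_inK // linearZZ linearZZ E_kappa lcompE -[vec _ _]/((guard_out (gam c) k : K) *: (oid : op)).
by rewrite ocompZr ocomp1r.
Qed.
End Sigma4.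

(** * Rearranging the sums of case (4) for a longer middle word *)

Section SigmaPsi.
Variables (K : fieldType) (I : choiceType).
Variables (U Q Xu Zv : I -> lmodType K) (U0 Q0 Y : lmodType K).
Variables (gam gam' : I -> I -> bool).
Hypothesis gamE : forall u v, gam u v = gam' u v.

(** Here [U u = [a b; u]], [Q v = [b' c; v]], with [U0] and [Q0] their values at 1, [Xu u =
    [x'uy'' z'; w]], [Zv v = [x' y''vz'; w]], and [Y] is the space of the remaining triple
    [x', y'', z']. The conditions [gam] and [gam'] differ in the bracketing of the concatenated
    word. *)
Definition sigP_mid : lmodType K :=
  prodm (dsum (fun p : I * I => guard (gam' p.1 p.2) (tens (U p.1) (Q p.2))))
    (prodm (dsum (fun u => tens (U u) (tens Q0 (Xu u))))
           (dsum (fun v => tens U0 (tens (Q v) (Zv v))))).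
Definition sigP_tgt : lmodType K := prodm sigP_mid (tens U0 (tens Q0 Y)).

Definition sigL_src : lmodType K :=
  prodm (dsum (fun u => tens (U u) (prodm (dsum (fun v => guard (gam u v) (Q v))) (tens Q0 (Xu u)))))
        (tens U0 (prodm (dsum (fun v => tens (Q v) (Zv v))) (tens Q0 Y))).
Definition sigL_u u : {linear tens (U u) (prodm (dsum (fun v => guard (gam u v) (Q v))) (tens Q0 (Xu u))) -> sigP_tgt} :=
  linl \ol lpair
    (tdsumr (fun v => @dinj K (I * I)%type (fun p : I * I => guard (gam' p.1 p.2) (tens (U p.1) (Q p.2))) (u, v)
        \ol guard_in _ \ol tmap (@lid K (U u)) (@guard_out K (gam u v) (Q v))) \ol tmap lid lfst)
    (linl \ol @dinj K I (fun u => tens (U u) (tens Q0 (Xu u))) u \ol tmap lid lsnd).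
Definition sigL_0 : {linear tens U0 (prodm (dsum (fun v => tens (Q v) (Zv v))) (tens Q0 Y)) -> sigP_tgt} :=
  lpair (linr \ol linr \ol tdsumr (fun v => @dinj K I (fun v => tens U0 (tens (Q v) (Zv v))) v) \ol tmap lid lfst)
        (tmap lid lsnd).
Definition sigL : {linear sigL_src -> sigP_tgt} := lcase (dlift sigL_u) sigL_0.

Definition sigR_src : lmodType K :=
  prodm (dsum (fun v => tens (Q v) (prodm (dsum (fun u => guard (gam u v) (U u))) (tens U0 (Zv v)))))
        (tens Q0 (prodm (dsum (fun u => tens (U u) (Xu u))) (tens U0 Y))).
Definition sigR_v v : {linear tens (Q v) (prodm (dsum (fun u => guard (gam u v) (U u))) (tens U0 (Zv v))) -> sigP_tgt} :=
  linl \ol lpair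
    (tdsumr (fun u => @dinj K (I * I)%type (fun p : I * I => guard (gam' p.1 p.2) (tens (U p.1) (Q p.2))) (u, v)
        \ol guard_in _ \ol tswap (Q v) (U u) \ol tmap lid (@guard_out K (gam u v) (U u))) \ol tmap lid lfst)
    (linr \ol @dinj K I (fun v => tens U0 (tens (Q v) (Zv v))) v \ol tflip _ _ _ \ol tmap lid lsnd).
Definition sigR_0 : {linear tens Q0 (prodm (dsum (fun u => tens (U u) (Xu u))) (tens U0 Y)) -> sigP_tgt} :=
  lpair (linr \ol linl \ol tdsumr (fun u => @dinj K I (fun u => tens (U u) (tens Q0 (Xu u))) u \ol tflip _ _ _) \ol tmap lid lfst)
        (tflip _ _ _ \ol tmap lid lsnd).
Definition sigR : {linear sigR_src -> sigP_tgt} := lcase (dlift sigR_v) sigR_0.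

Definition tgt1 u v : {linear tens (U u) (Q v) -> sigP_tgt} :=
  linl \ol linl \ol @dinj K (I * I)%type (fun p : I * I => guard (gam' p.1 p.2) (tens (U p.1) (Q p.2))) (u, v) \ol guard_in _.
Definition tgt2 u : {linear tens (U u) (tens Q0 (Xu u)) -> sigP_tgt} :=
  linl \ol linr \ol linl \ol @dinj K I (fun u => tens (U u) (tens Q0 (Xu u))) u.
Definition tgt3 v : {linear tens U0 (tens (Q v) (Zv v)) -> sigP_tgt} :=
  linl \ol linr \ol linr \ol @dinj K I (fun v => tens U0 (tens (Q v) (Zv v))) v.
Definition tgt4 : {linear tens U0 (tens Q0 Y) -> sigP_tgt} := linr.

Lemma linl_pair0 (V W : lmodType K) (x : V) : (x, 0) = linl x :> prodm V W.
Proof. by []. Qed.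
Lemma linr_pair0 (V W : lmodType K) (x : W) : (0, x) = linr x :> prodm V W.
Proof. by []. Qed.

Lemma sigL1 u f v g : sigL (linl (dinj u (tpure f (linl (dinj v g))))) = tgt1 u v (tpure f (guard_out _ g)).
Proof.
rewrite /sigL lcase_inl dlift_inj /sigL_u lcompE lpairE.
rewrite [X in linl (X, _)](_ : _ = @dinj K (I * I)%type (fun p : I * I => guard (gam' p.1 p.2) (tens (U p.1) (Q p.2))) (u, v) (guard_in _ (tpure f (guard_out _ g)))); last first.
  by rewrite lcompE tmapE lidE [lfst _](_ : _ = dinj v g) // tdsumrE 2!lcompE tmapE.
rewrite [X in linl (_, X)](_ : _ = 0); last first.
  by rewrite 2!lcompE tmapE [lsnd _](_ : _ = 0) // tpure0r [dinj _ _]linear0 linear0.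
by rewrite linl_pair0.
Qed.
Lemma sigL2 u f g t : sigL (linl (dinj u (tpure f (linr (tpure g t))))) = tgt2 u (tpure f (tpure g t)).
Proof.
rewrite /sigL lcase_inl dlift_inj /sigL_u lcompE lpairE.
rewrite [X in linl (X, _)](_ : _ = 0); last first.
  by rewrite lcompE tmapE lidE [lfst _](_ : _ = 0) // tpure0r linear0.
by rewrite 2!lcompE tmapE lidE [lsnd _](_ : _ = tpure g t) // linr_pair0.
Qed.
Lemma sigL3 f v g t : sigL (linr (tpure f (linl (dinj v (tpure g t))))) = tgt3 v (tpure f (tpure g t)).
Proof.
rewrite /sigL lcase_inr /sigL_0 lpairE.
rewrite [X in (_, X)](_ : _ = 0); last first.
  by rewrite tmapE lidE [lsnd _](_ : _ = 0) // tpure0r.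
by rewrite 3!lcompE tmapE lidE [lfst _](_ : _ = dinj v (tpure g t)) // tdsumrE linl_pair0.
Qed.
Lemma sigL4 f g t : sigL (linr (tpure f (linr (tpure g t)))) = tgt4 (tpure f (tpure g t)).
Proof.
rewrite /sigL lcase_inr /sigL_0 lpairE.
rewrite [X in (X, _)](_ : _ = 0); last first.
  by rewrite 3!lcompE tmapE lidE [lfst _](_ : _ = 0) // tpure0r [tdsumr _ _]linear0 !linear0.
by rewrite tmapE lidE [lsnd _](_ : _ = tpure g t).
Qed.

Lemma sigR1 v g u f : sigR (linl (dinj v (tpure g (linl (dinj u f))))) = tgt1 u v (tpure (guard_out _ f) g).
Proof.
rewrite /sigR lcase_inl dlift_inj /sigR_v lcompE lpairE.
rewrite [X in linl (X, _)](_ : _ = @dinj K (I * I)%type (fun p : I * I => guard (gam' p.1 p.2) (tens (U p.1) (Q p.2))) (u, v) (guard_in _ (tpure (guard_out _ f) g))); last first.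
  by rewrite lcompE tmapE lidE [lfst _](_ : _ = dinj u f) // tdsumrE 3!lcompE tmapE tswapE.
rewrite [X in linl (_, X)](_ : _ = 0); last first.
  by rewrite 3!lcompE tmapE [lsnd _](_ : _ = 0) // tpure0r [tflip _ _ _ _]linear0 [dinj _ _]linear0 linear0.
by rewrite linl_pair0.
Qed.
Lemma sigR2 v g f t : sigR (linl (dinj v (tpure g (linr (tpure f t))))) = tgt3 v (tpure f (tpure g t)).
Proof.
rewrite /sigR lcase_inl dlift_inj /sigR_v lcompE lpairE.
rewrite [X in linl (X, _)](_ : _ = 0); last first.
  by rewrite lcompE tmapE lidE [lfst _](_ : _ = 0) // tpure0r linear0.
by rewrite 3!lcompE tmapE lidE [lsnd _](_ : _ = tpure f t) // tflipE linr_pair0.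
Qed.
Lemma sigR3 g u f t : sigR (linr (tpure g (linl (dinj u (tpure f t))))) = tgt2 u (tpure f (tpure g t)).
Proof.
rewrite /sigR lcase_inr /sigR_0 lpairE.
rewrite [X in (_, X)](_ : _ = 0); last first.
  by rewrite lcompE tmapE lidE [lsnd _](_ : _ = 0) // tpure0r linear0.
by rewrite 3!lcompE tmapE lidE [lfst _](_ : _ = dinj u (tpure f t)) // tdsumrE lcompE tflipE linl_pair0.
Qed.
Lemma sigR4 g f t : sigR (linr (tpure g (linr (tpure f t)))) = tgt4 (tpure f (tpure g t)).
Proof.
rewrite /sigR lcase_inr /sigR_0 lpairE.
rewrite [X in (X, _)](_ : _ = 0); last first.
  by rewrite 3!lcompE tmapE lidE [lfst _](_ : _ = 0) // tpure0r [tdsumr _ _]linear0 !linear0.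
by rewrite lcompE tmapE lidE [lsnd _](_ : _ = tpure f t) // tflipE linr_pair0.
Qed.

Lemma sigP_ext (W : lmodType K) (F G : {linear sigP_tgt -> W}) :
  (forall u v f g, gam' u v -> F (tgt1 u v (tpure f g)) = G (tgt1 u v (tpure f g))) ->
  (forall u f g t, F (tgt2 u (tpure f (tpure g t))) = G (tgt2 u (tpure f (tpure g t)))) ->
  (forall v f g t, F (tgt3 v (tpure f (tpure g t))) = G (tgt3 v (tpure f (tpure g t)))) ->
  (forall f g t, F (tgt4 (tpure f (tpure g t))) = G (tgt4 (tpure f (tpure g t)))) -> F =1 G.
Proof.
move=> h1 h2 h3 h4; apply: prodm_ext => p; last first.
  by move: p; apply: (@tens3_ext _ _ _ _ _ (F \ol linr) (G \ol linr)) => f g t; exact: h4.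
move: p; apply: (@prodm_ext _ _ _ _ (F \ol linl) (G \ol linl)) => p.
  move: p; apply: (@dsum_ext _ _ _ _ (F \ol linl \ol linl) (G \ol linl \ol linl)) => -[u v] s.
  have [gv|/negP ngv] := pselect (gam' u v = true); last by rewrite [s]guard0 // !linear0.
  rewrite -[s]guard_outK; move: (guard_out _ s) => {}s.
  by move: s; apply: (@tens_ext _ _ _ _ (F \ol tgt1 u v) (G \ol tgt1 u v)) => f g; exact: h1.
move: p; apply: (@prodm_ext _ _ _ _ (F \ol linl \ol linr) (G \ol linl \ol linr)) => p.
  move: p; apply: (@dsum_ext _ _ _ _ (F \ol linl \ol linr \ol linl) (G \ol linl \ol linr \ol linl)) => u s.
  by move: s; apply: (@tens3_ext _ _ _ _ _ (F \ol tgt2 u) (G \ol tgt2 u)) => f g t; exact: h2.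
move: p; apply: (@dsum_ext _ _ _ _ (F \ol linl \ol linr \ol linr) (G \ol linl \ol linr \ol linr)) => v s.
by move: s; apply: (@tens3_ext _ _ _ _ _ (F \ol tgt3 v) (G \ol tgt3 v)) => f g t; exact: h3.
Qed.
Lemma sigL_ext (W : lmodType K) (F G : {linear sigL_src -> W}) :
  (forall u v f g, gam u v -> F (linl (dinj u (tpure f (linl (dinj v g))))) = G (linl (dinj u (tpure f (linl (dinj v g)))))) ->
  (forall u f g t, F (linl (dinj u (tpure f (linr (tpure g t))))) = G (linl (dinj u (tpure f (linr (tpure g t)))))) ->
  (forall v f g t, F (linr (tpure f (linl (dinj v (tpure g t))))) = G (linr (tpure f (linl (dinj v (tpure g t)))))) ->
  (forall f g t, F (linr (tpure f (linr (tpure g t)))) = G (linr (tpure f (linr (tpure g t))))) -> F =1 G.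
Proof.
move=> h1 h2 h3 h4; apply: prodm_ext => p.
  move: p; apply: (@dtens_ext _ _ _ _ _ (F \ol linl) (G \ol linl)) => u f s.
  move: s; apply: (@prodm_ext _ _ _ _ (F \ol linl \ol dinj u \ol tpurer _ f) (G \ol linl \ol dinj u \ol tpurer _ f)).
    apply: (@dsum_ext _ _ _ _ (F \ol linl \ol dinj u \ol tpurer _ f \ol linl) (G \ol linl \ol dinj u \ol tpurer _ f \ol linl)) => v s.
    have [gv|/negP ngv] := pselect (gam u v = true); last by rewrite [s]guard0 // !linear0.
    exact: h1.
  apply: (@tens_ext _ _ _ _ (F \ol linl \ol dinj u \ol tpurer _ f \ol linr) (G \ol linl \ol dinj u \ol tpurer _ f \ol linr)) => g t.
  exact: h2.
move: p; apply: (@tens_ext _ _ _ _ (F \ol linr) (G \ol linr)) => f s.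
move: s; apply: (@prodm_ext _ _ _ _ (F \ol linr \ol tpurer _ f) (G \ol linr \ol tpurer _ f)).
  apply: (@dtens_ext _ _ _ _ _ (F \ol linr \ol tpurer _ f \ol linl) (G \ol linr \ol tpurer _ f \ol linl)) => v g t.
  exact: h3.
apply: (@tens_ext _ _ _ _ (F \ol linr \ol tpurer _ f \ol linr) (G \ol linr \ol tpurer _ f \ol linr)) => g t.
exact: h4.
Qed.
Lemma sigR_ext (W : lmodType K) (F G : {linear sigR_src -> W}) :
  (forall v u g f, gam u v -> F (linl (dinj v (tpure g (linl (dinj u f))))) = G (linl (dinj v (tpure g (linl (dinj u f)))))) ->
  (forall v g f t, F (linl (dinj v (tpure g (linr (tpure f t))))) = G (linl (dinj v (tpure g (linr (tpure f t)))))) ->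
  (forall u g f t, F (linr (tpure g (linl (dinj u (tpure f t))))) = G (linr (tpure g (linl (dinj u (tpure f t)))))) ->
  (forall g f t, F (linr (tpure g (linr (tpure f t)))) = G (linr (tpure g (linr (tpure f t))))) -> F =1 G.
Proof.
move=> h1 h2 h3 h4; apply: prodm_ext => p.
  move: p; apply: (@dtens_ext _ _ _ _ _ (F \ol linl) (G \ol linl)) => u f s.
  move: s; apply: (@prodm_ext _ _ _ _ (F \ol linl \ol dinj u \ol tpurer _ f) (G \ol linl \ol dinj u \ol tpurer _ f)).
    apply: (@dsum_ext _ _ _ _ (F \ol linl \ol dinj u \ol tpurer _ f \ol linl) (G \ol linl \ol dinj u \ol tpurer _ f \ol linl)) => v s.
    have [gv|/negP ngv] := pselect (gam v u = true); last by rewrite [s]guard0 // !linear0.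
    exact: h1.
  apply: (@tens_ext _ _ _ _ (F \ol linl \ol dinj u \ol tpurer _ f \ol linr) (G \ol linl \ol dinj u \ol tpurer _ f \ol linr)) => g t.
  exact: h2.
move: p; apply: (@tens_ext _ _ _ _ (F \ol linr) (G \ol linr)) => f s.
move: s; apply: (@prodm_ext _ _ _ _ (F \ol linr \ol tpurer _ f) (G \ol linr \ol tpurer _ f)).
  apply: (@dtens_ext _ _ _ _ _ (F \ol linr \ol tpurer _ f \ol linl) (G \ol linr \ol tpurer _ f \ol linl)) => v g t.
  exact: h3.
apply: (@tens_ext _ _ _ _ (F \ol linr \ol tpurer _ f \ol linr) (G \ol linr \ol tpurer _ f \ol linr)) => g t.
exact: h4.
Qed.

Definition tgt_case (W : lmodType K) (F1 : forall u v, {linear tens (U u) (Q v) -> W})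
   (F2 : forall u, {linear tens (U u) (tens Q0 (Xu u)) -> W})
   (F3 : forall v, {linear tens U0 (tens (Q v) (Zv v)) -> W})
   (F4 : {linear tens U0 (tens Q0 Y) -> W}) : {linear sigP_tgt -> W} :=
  lcase (lcase (dlift (fun p : I * I => F1 p.1 p.2 \ol guard_out _)) (lcase (dlift F2) (dlift F3))) F4.
Lemma tgt_case1 W F1 F2 F3 F4 u v t : gam' u v -> @tgt_case W F1 F2 F3 F4 (tgt1 u v t) = F1 u v t.
Proof. by move=> g; rewrite /tgt_case /tgt1 3!lcompE 2!lcase_inl dlift_inj lcompE guard_inK. Qed.
Lemma tgt_case2 W F1 F2 F3 F4 u t : @tgt_case W F1 F2 F3 F4 (tgt2 u t) = F2 u t.
Proof. by rewrite /tgt_case /tgt2 3!lcompE lcase_inl lcase_inr lcase_inl dlift_inj. Qed.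
Lemma tgt_case3 W F1 F2 F3 F4 v t : @tgt_case W F1 F2 F3 F4 (tgt3 v t) = F3 v t.
Proof. by rewrite /tgt_case /tgt3 3!lcompE lcase_inl 2!lcase_inr dlift_inj. Qed.
Lemma tgt_case4 W F1 F2 F3 F4 t : @tgt_case W F1 F2 F3 F4 (tgt4 t) = F4 t.
Proof. by rewrite /tgt_case lcase_inr. Qed.

Lemma sigL_bij : bijective sigL.
Proof.
pose sigLV : {linear sigP_tgt -> sigL_src} := tgt_case
  (fun u v => linl \ol dinj u \ol tmap lid (linl \ol dinj v \ol guard_in _))
  (fun u => linl \ol dinj u \ol tmap lid linr)
  (fun v => linr \ol tmap lid (linl \ol dinj v)) (linr \ol tmap lid linr).
apply: (@bij_cancel _ _ _ _ sigLV).
  apply: sigL_ext => [u v f g h|u f g t|v f g t|f g t]; rewrite lcompE lidE.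
  - by rewrite sigL1 /sigLV tgt_case1 -?gamE // 2!lcompE tmapE 2!lcompE guard_outK.
  - by rewrite sigL2 /sigLV tgt_case2 2!lcompE tmapE.
  - by rewrite sigL3 /sigLV tgt_case3 lcompE tmapE lcompE.
  - by rewrite sigL4 /sigLV tgt_case4 lcompE tmapE.
apply: sigP_ext => [u v f g h|u f g t|v f g t|f g t]; rewrite lcompE lidE.
- by rewrite /sigLV tgt_case1 // 2!lcompE tmapE 2!lcompE sigL1 guard_inK // gamE.
- by rewrite /sigLV tgt_case2 2!lcompE tmapE sigL2.
- by rewrite /sigLV tgt_case3 lcompE tmapE lcompE sigL3.
- by rewrite /sigLV tgt_case4 lcompE tmapE sigL4.
Qed.

Lemma sigR_bij : bijective sigR.
Proof.
pose sigRV : {linear sigP_tgt -> sigR_src} := tgt_case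
  (fun u v => linl \ol dinj v \ol tmap lid (linl \ol dinj u \ol guard_in _) \ol tswap _ _)
  (fun u => linr \ol tmap lid (linl \ol dinj u) \ol tflip _ _ _)
  (fun v => linl \ol dinj v \ol tmap lid linr \ol tflip _ _ _)
  (linr \ol tmap lid linr \ol tflip _ _ _).
apply: (@bij_cancel _ _ _ _ sigRV).
  apply: sigR_ext => [v u g f h|v g f t|u g f t|g f t]; rewrite lcompE lidE.
  - by rewrite sigR1 /sigRV tgt_case1 -?gamE // 3!lcompE tswapE tmapE 2!lcompE guard_outK.
  - by rewrite sigR2 /sigRV tgt_case3 3!lcompE tflipE tmapE.
  - by rewrite sigR3 /sigRV tgt_case2 2!lcompE tflipE tmapE lcompE.
  - by rewrite sigR4 /sigRV tgt_case4 2!lcompE tflipE tmapE.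
apply: sigP_ext => [u v f g h|u f g t|v f g t|f g t]; rewrite lcompE lidE.
- by rewrite /sigRV tgt_case1 // 3!lcompE tswapE tmapE 2!lcompE sigR1 guard_inK // gamE.
- by rewrite /sigRV tgt_case2 2!lcompE tflipE tmapE lcompE sigR3.
- by rewrite /sigRV tgt_case3 3!lcompE tflipE tmapE sigR2.
- by rewrite /sigRV tgt_case4 2!lcompE tflipE tmapE sigR4.
Qed.

Variables (C D : tensorCategory K) (S : spectrum C) (T : spectrum D).
Local Notation op := (@op K C D S T).
Variables (e : forall u, {linear U u -> op}) (e0 : {linear U0 -> op}).
Variables (q q' r : forall v, {linear Q v -> op}) (q0 q0' r0 : {linear Q0 -> op}).
Variables (xu : forall u, {linear Xu u -> op}) (zv : forall v, {linear Zv v -> op}) (ey : {linear Y -> op}).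
(** The brackets [[b' c; v]] have three evaluations because their depth depends on what became of
    [a] and [b]: [r] before they meet, [q] after a fusion, [q'] after a cancellation. The hypotheses
    [re] to [r0e0] move them past the operator of [a] and [b]. *)
Definition sigP_tgt_ev : {linear sigP_tgt -> op} :=
  tgt_case (fun u v => omul (e u) (q v)) (fun u => omul (e u) (omul q0 (xu u)))
    (fun v => omul e0 (omul (q' v) (zv v))) (omul e0 (omul q0' ey)).
Definition sigL_src_ev : {linear sigL_src -> op} :=
  lcase (dlift (fun u => omul (e u) (lcase (dlift (fun v => q v \ol guard_out _)) (omul q0 (xu u)))))
    (omul e0 (lcase (dlift (fun v => omul (q' v) (zv v))) (omul q0' ey))).
Definition sigR_src_ev : {linear sigR_src -> op} :=
  lcase (dlift (fun v => omul (r v) (lcase (dlift (fun u => e u \ol guard_out _)) (omul e0 (zv v)))))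
    (omul r0 (lcase (dlift (fun u => omul (e u) (xu u))) (omul e0 ey))).
Lemma sigL_ev p : sigP_tgt_ev (sigL p) = sigL_src_ev p.
Proof.
move: p; apply: (@sigL_ext _ (sigP_tgt_ev \ol sigL) sigL_src_ev) => [u v f g h|u f g t|v f g t|f g t];
  rewrite lcompE /sigP_tgt_ev /sigL_src_ev.
- by rewrite sigL1 tgt_case1 -?gamE // lcase_inl dlift_inj !omulE lcase_inl dlift_inj lcompE.
- by rewrite sigL2 tgt_case2 lcase_inl dlift_inj !omulE lcase_inr omulE.
- by rewrite sigL3 tgt_case3 lcase_inr !omulE lcase_inl dlift_inj omulE.
- by rewrite sigL4 tgt_case4 lcase_inr !omulE lcase_inr omulE.
Qed.
Hypothesis re : forall u v f g, ocomp (r v g) (e u f) = ocomp (e u f) (q v g).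
Hypothesis re0 : forall v f g, ocomp (r v g) (e0 f) = ocomp (e0 f) (q' v g).
Hypothesis r0e : forall u f g, ocomp (r0 g) (e u f) = ocomp (e u f) (q0 g).
Hypothesis r0e0 : forall f g, ocomp (r0 g) (e0 f) = ocomp (e0 f) (q0' g).
Lemma sigR_ev p : sigP_tgt_ev (sigR p) = sigR_src_ev p.
Proof.
move: p; apply: (@sigR_ext _ (sigP_tgt_ev \ol sigR) sigR_src_ev) => [v u g f h|v g f t|u g f t|g f t];
  rewrite lcompE /sigP_tgt_ev /sigR_src_ev.
- by rewrite sigR1 tgt_case1 -?gamE // lcase_inl dlift_inj !omulE lcase_inl dlift_inj lcompE re.
- by rewrite sigR2 tgt_case3 lcase_inl dlift_inj !omulE lcase_inr omulE !ocompA re0.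
- by rewrite sigR3 tgt_case2 lcase_inr !omulE lcase_inl dlift_inj omulE !ocompA r0e.
- by rewrite sigR4 tgt_case4 lcase_inr !omulE lcase_inr omulE !ocompA r0e0.
Qed.
End SigmaPsi.

(** * Evaluation of the associativity transformations *)

Section Regroup.
Variables (K : fieldType) (I J : choiceType).
Variables (U : I -> lmodType K) (U' : J -> lmodType K) (V W : I -> J -> lmodType K).

(** This and the following maps are the reshufflings of factors in the two composites, detached from
    triangular spaces so that each is determined by one formula on pure tensors. *)
Definition nest_r : {linear dsum (fun i : I * J => tens (U i.1) (tens (V i.1 i.2) (W i.1 i.2))) ->
    dsum (fun p => tens (U p) (dsum (fun q => tens (V p q) (W p q))))} :=
  dlift (fun i => dinj i.1 \ol tmap lid (dinj i.2)).
Lemma nest_rE p q f g h :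
  nest_r (dinj (p, q) (tpure f (tpure g h))) = dinj p (tpure f (dinj q (tpure g h))).
Proof. by rewrite /nest_r dlift_inj lcompE tmapE lidE. Qed.

Definition unnest_r : {linear dsum (fun p => tens (U p) (dsum (fun q => tens (V p q) (W p q)))) ->
    dsum (fun i : I * J => tens (U i.1) (tens (V i.1 i.2) (W i.1 i.2)))} :=
  dlift (fun p => tdsumr (fun q => dinj (p, q))).
Lemma unnest_rE p q f g h :
  unnest_r (dinj p (tpure f (dinj q (tpure g h)))) = dinj (p, q) (tpure f (tpure g h)).
Proof. by rewrite /unnest_r dlift_inj tdsumrE. Qed.

Definition nest_flip : {linear dsum (fun p => tens (U p) (dsum (fun r => tens (U' r) (W p r)))) ->
    dsum (fun r => tens (U' r) (dsum (fun p => tens (U p) (W p r))))} :=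
  dlift (fun p => tdsumr (fun r => dinj r \ol tmap lid (dinj p) \ol tflip _ _ _)).
Lemma nest_flipE p f r k l :
  nest_flip (dinj p (tpure f (dinj r (tpure k l)))) = dinj r (tpure k (dinj p (tpure f l))).
Proof. by rewrite /nest_flip dlift_inj tdsumrE 2!lcompE tflipE tmapE lidE. Qed.

Definition nest_l : {linear dsum (fun i : I * J => tens (U i.1) (tens (V i.1 i.2) (U' i.2))) ->
    dsum (fun q => tens (dsum (fun p => tens (U p) (V p q))) (U' q))} :=
  dlift (fun i => dinj i.2 \ol tmap (dinj i.1) lid \ol tassocV _ _ _).
Lemma nest_lE p q f g h :
  nest_l (dinj (p, q) (tpure f (tpure g h))) = dinj q (tpure (dinj p (tpure f g)) h).
Proof. by rewrite /nest_l dlift_inj 2!lcompE tassocVE tmapE lidE. Qed.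

Definition unnest_l : {linear dsum (fun q => tens (dsum (fun p => tens (U p) (V p q))) (U' q)) ->
    dsum (fun i : I * J => tens (U i.1) (tens (V i.1 i.2) (U' i.2)))} :=
  dlift (fun q => tdsuml (fun p => dinj (p, q) \ol tassoc _ _ _)).
Lemma unnest_lE p q f g h :
  unnest_l (dinj q (tpure (dinj p (tpure f g)) h)) = dinj (p, q) (tpure f (tpure g h)).
Proof. by rewrite /unnest_l dlift_inj tdsumlE lcompE tassocE. Qed.

Definition nest_lr : {linear dsum (fun q => tens (dsum (fun p => tens (U p) (V p q))) (U' q)) ->
    dsum (fun p => tens (U p) (dsum (fun q => tens (V p q) (U' q))))} :=
  dlift (fun q => tdsuml (fun p => dinj p \ol tmap lid (dinj q) \ol tassoc _ _ _)).
Lemma nest_lrE p q f g h :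
  nest_lr (dinj q (tpure (dinj p (tpure f g)) h)) = dinj p (tpure f (dinj q (tpure g h))).
Proof. by rewrite /nest_lr dlift_inj tdsumlE 2!lcompE tassocE tmapE lidE. Qed.

Definition nest_rl : {linear dsum (fun p => tens (U p) (dsum (fun q => tens (V p q) (U' q)))) ->
    dsum (fun q => tens (dsum (fun p => tens (U p) (V p q))) (U' q))} :=
  dlift (fun p => tdsumr (fun q => dinj q \ol tmap (dinj p) lid \ol tassocV _ _ _)).
Lemma nest_rlE p q f g h :
  nest_rl (dinj p (tpure f (dinj q (tpure g h)))) = dinj q (tpure (dinj p (tpure f g)) h).
Proof. by rewrite /nest_rl dlift_inj tdsumrE 2!lcompE tassocVE tmapE lidE. Qed.
End Regroup.

Section FreeProduct.
Variables (K : fieldType) (C D : tensorCategory K) (S : spectrum C) (T : spectrum D).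
Hypotheses (ssC : semisimple C) (ssD : semisimple D).
Hypothesis EndC :
  forall (x : obj C) (f : hom C x x), simple x -> exists k, f = k *: idm x.
Hypothesis EndD :
  forall (x : obj D) (f : hom D x x), simple x -> exists k, f = k *: idm x.
Local Notation letter := (letter S T).
Local Notation word := (word S T).
Local Notation op := (@op K C D S T).
Local Notation pat := (@pat K C D S T).
Local Notation ew := (@ew K C D S T).
Local Notation stepJ := (@stepJ K C D S T).
Local Notation stepS := (@stepS K C D S T).
Local Notation Om := (@Om K C D S T).
Local Notation B := (@lbracket K C D S T).
Local Notation tri := (@tri K C D S T).
Local Notation free_assoc := (@free_assoc K C D S T).
Local Notation theta := (@theta K C D S T ssC ssD EndC EndD).
Local Notation evL4 := (@evL4 K C D S T ssC ssD EndC EndD).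
Local Notation evR4 := (@evR4 K C D S T ssC ssD EndC EndD).
Implicit Types (x y z w : seq letter) (a b c : letter).

Lemma lin_transport (I : eqType) (V : I -> lmodType K) (W : lmodType K)
    (phi : forall i, {linear V i -> W}) i j (v : V i) :
  i = j -> phi j (transport V i j v) = phi i v.
Proof. by move=> e; case: j / e; rewrite transportE. Qed.

Lemma unrcons_rcons x a : @unrcons K C D S T (rcons x a) = Some (x, a).
Proof. by rewrite /unrcons rev_rcons revK. Qed.

(** The two meeting letters lie below the [size x] steps of the remaining left word, hence the
    shifts. *)
Definition split_ev_of (Th : forall x y z, {linear tri x y z -> op}) x a b y z :
    {linear @split_target K C D S T x a b y z -> op} :=
  lcase (dlift (fun c => shiftn (size x) \ol theta a b (Some c) \ol guard_out _))
    (omul (shiftn (size x) \ol theta a b None) (Th x y z)).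

(** The argument [n] is fuel, to be taken as the length of the left word: the recursion removes its
    last letter, which is not a structural descent. *)
Fixpoint tri_ev_rec n x y z : {linear tri x y z -> op} :=
  if n is n'.+1 then
    if joins x y then vec oid \ol join_out x y z else
    match unrcons x, y with
    | Some (x', a), b :: y' =>
      split_ev_of (tri_ev_rec n') x' a b y' z \ol split x y x' a b y' z
    | _, _ => lzero
    end
  else vec oid \ol join_out x y z.

Lemma tri_ev_recS n x y z : tri_ev_rec n.+1 x y z =
    if joins x y then vec oid \ol join_out x y z else
    match unrcons x, y with
    | Some (x', a), b :: y' =>
      split_ev_of (tri_ev_rec n) x' a b y' z \ol split x y x' a b y' z
    | _, _ => lzero
    end.
Proof. by []. Qed.

Fact tri_ev_key : {Th : forall x y z, {linear tri x y z -> op} |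
  (forall x y z f, joins x y -> Th x y z f = (join_out x y z f : K) *: oid) /\
  (forall x a b y z f, ~~ joins (rcons x a) (b :: y) ->
     Th (rcons x a) (b :: y) z f =
     split_ev_of Th x a b y z (split (rcons x a) (b :: y) x a b y z f))}.
Proof.
exists (fun x => tri_ev_rec (size x) x); split=> [x y z f|x a b y z f] h.
  by rewrite /tri_ev_rec; case: (size x) => [|n] //; rewrite h.
rewrite size_rcons tri_ev_recS (negbTE h) unrcons_rcons lcompE.
by [].
Qed.
Definition tri_ev := sval tri_ev_key.
Local Notation Th := tri_ev.
Local Notation split_ev := (split_ev_of Th).
Lemma tri_ev_join x y z f : joins x y -> Th x y z f = (join_out x y z f : K) *: oid.
Proof. by have [h _] := svalP tri_ev_key; exact: h. Qed.
Lemma tri_ev_split x y x' a b y' z f : x = rcons x' a -> y = b :: y' -> ~~ joins x y ->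
  Th x y z f = split_ev_of Th x' a b y' z (split x y x' a b y' z f).
Proof. by have [_ h] := svalP tri_ev_key; move=> ex ey; subst x y; exact: h. Qed.

Lemma split_ev_linl x a b y z c f :
  split_ev_of Th x a b y z (linl (dinj c f)) = shiftn (size x) (theta a b (Some c) (guard_out _ f)).
Proof. by rewrite /split_ev_of lcase_inl dlift_inj 2!lcompE. Qed.
Lemma split_ev_linr x a b y z f g :
  split_ev_of Th x a b y z (linr (tpure f g)) =
  ocomp (shiftn (size x) (theta a b None f)) (Th x y z g).
Proof. by rewrite /split_ev_of lcase_inr omulE lcompE. Qed.

Section Fus.
Variables (k : nat) (x y : seq letter) (F : seq letter -> lmodType K).
Variable phi : forall u, {linear F u -> op}.
(** With [k = 0] this evaluates [L]; with [k] the length of the outer left word it evaluates [R]. *)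
Definition fus_ev : {linear fus x y F -> op} :=
  dlift (fun u : word => omul (shiftn k \ol Th x y (val u)) (phi (val u))).
Lemma fus_evE (u : word) f m :
  fus_ev (dinj u (tpure f m)) = ocomp (shiftn k (Th x y (val u) f)) (phi (val u) m).
Proof. by rewrite /fus_ev dlift_inj omulE lcompE. Qed.

Lemma fus_ev_join m : joins x y -> fus_ev m = phi (x ++ y) (join x y F m).
Proof.
move=> h; move: m; apply: (@dtens_ext _ _ _ _ _ fus_ev (phi (x ++ y) \ol join x y F)) => u f m.
rewrite lcompE fus_evE join_dinj tri_ev_join // linearZZ shiftn_id ocompZl ocomp1l.
rewrite linearZZ; have [e|ne] := pselect (val u = x ++ y); last first.
  by rewrite (tri_join0 f h ne) [join_out _ _ _ _]linear0 !scale0r.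
by rewrite lin_transport.
Qed.
End Fus.

Section FusExpand.
Variables (k : nat) (x y : seq letter) (F : seq letter -> lmodType K).
Variable phi : forall u, {linear F u -> op}.
Variables (x' : seq letter) (a b : letter) (y' : seq letter).
Hypotheses (ex : x = rcons x' a) (ey : y = b :: y') (nj : ~~ joins x y).

Definition expand_ev : {linear prodm (dsum (fun c => tens (B a b (Some c)) (F (x' ++ c :: y'))))
      (tens (B a b None) (fus x' y' F)) -> op} :=
  lcase (dlift (fun c => omul (shiftn (k + size x') \ol theta a b (Some c)) (phi (x' ++ c :: y'))))
    (omul (shiftn (k + size x') \ol theta a b None) (fus_ev k x' y' phi)).
Lemma expand_ev_linl c f m :
  expand_ev (linl (dinj c (tpure f m))) =
  ocomp (shiftn (k + size x') (theta a b (Some c) f)) (phi (x' ++ c :: y') m).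
Proof. by rewrite /expand_ev lcase_inl dlift_inj omulE lcompE. Qed.
Lemma expand_ev_linr f m :
  expand_ev (linr (tpure f m)) =
  ocomp (shiftn (k + size x') (theta a b None f)) (fus_ev k x' y' phi m).
Proof. by rewrite /expand_ev lcase_inr omulE lcompE. Qed.

Lemma fus_ev_expand m : fus_ev k x y phi m = expand_ev (expand x y F x' a b y' m).
Proof.
move: m; apply: (@dtens_ext _ _ _ _ _ (fus_ev k x y phi) (expand_ev \ol expand x y F x' a b y')) => u f m.
have sb := @split_bij K C D S T x y x' a b y' (val u) ex ey nj.
rewrite -[f](linvK sb); move: (split x y x' a b y' (val u) f) => {}f; move: f.
apply: (@prodm_ext _ _ _ _
   (fus_ev k x y phi \ol dinj u \ol tpurel _ m \ol linv (split x y x' a b y' (val u)))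
   (expand_ev \ol expand x y F x' a b y' \ol dinj u \ol tpurel _ m \ol linv (split x y x' a b y' (val u)))).
  apply: (@dsum_ext _ _ _ _
     (fus_ev k x y phi \ol dinj u \ol tpurel _ m \ol linv (split x y x' a b y' (val u)) \ol linl)
     (expand_ev \ol expand x y F x' a b y' \ol dinj u \ol tpurel _ m \ol linv (split x y x' a b y' (val u)) \ol linl)) => c g.
  rewrite !lcompE -[tpurel _ _ _]/(tpure _ _) expand_linl // expand_ev_linl fus_evE.
  rewrite (tri_ev_split _ ex ey nj) linvVK // split_ev_linl -shiftnD.
  have [/eqP e|/negP ne] := pselect ((x' ++ c :: y' == val u) = true); last first.
    by rewrite [g]guard0 // ![guard_out _ _]linear0 ![theta _ _ _ _]linear0 !linear0 !ocomp0l.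
  by rewrite lin_transport // e.
apply: (@tens_ext _ _ _ _
     (fus_ev k x y phi \ol dinj u \ol tpurel _ m \ol linv (split x y x' a b y' (val u)) \ol linr)
     (expand_ev \ol expand x y F x' a b y' \ol dinj u \ol tpurel _ m \ol linv (split x y x' a b y' (val u)) \ol linr)) => f g.
rewrite !lcompE -[tpurel _ _ _]/(tpure _ _) expand_linr // expand_ev_linr !fus_evE.
rewrite (tri_ev_split _ ex ey nj) linvVK // split_ev_linr shiftnM -shiftnD.
by rewrite ocompA.
Qed.
End FusExpand.

Definition spaceL_ev x y z w : {linear @spaceL K C D S T x y z w -> op} :=
  fus_ev 0 x y (fun u => Th u z w).
Definition spaceR_ev x y z w : {linear @spaceR K C D S T x y z w -> op} :=
  fus_ev (size x) y z (fun v => Th x v w).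

(** The projector onto paths whose outermost labels spell [w]. *)
Fixpoint lamW w : op := if w is a :: w' then ocomp (lamL a) (shift (lamW w')) else oid.

(** The second alternative covers letters on the wrong side: the words then need not join, but the
    bracket [U] is zero. *)
Lemma slot_bij (U : lmodType K) g p q w :
  (joins p q /\ (p ++ q == w) = g) \/ (forall u : U, u = 0) ->
  bijective (guard_in g \ol tunitr U \ol tmap lid (@join_out K C D S T p q w)).
Proof.
case=> [[h <-]|u0]; last first.
  apply: bij_triv; first exact: tens0l.
  by case: g => v; [exact: u0 | exact: null0].
have [e|ne] := eqVneq (p ++ q) w.
  apply: bij_lcomp.
    by apply: bij_lcomp; [exact: (@guard_in_bij _ true) | exact: tunitr_bij].
  by apply: bij_tmap; [exact: bij_lid | exact: join_out_bij].
apply: bij_triv; last exact: null0.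
by apply: tens0r => v; apply: (tri_join0 v h) => e; rewrite e eqxx in ne.
Qed.

Lemma slot_ev (U : lmodType K) (f : {linear U -> op}) g p q w t :
  (joins p q /\ (p ++ q == w) = g) \/ (forall u : U, u = 0) ->
  omul f (Th p q w) t =
  f (guard_out g ((guard_in g \ol tunitr U \ol tmap lid (@join_out K C D S T p q w)) t)).
Proof.
case=> [[h <-]|u0]; last by rewrite (tens0l u0 t) !linear0.
move: t; apply: (@tens_ext _ _ _ _ (omul f (Th p q w))
  (f \ol guard_out _ \ol (guard_in _ \ol tunitr U \ol tmap lid (join_out p q w)))) => u m.
rewrite omulE tri_ev_join // 4!lcompE tmapE tunitrE lidE ocompZr ocomp1r guard_out_in.
case: eqVneq => [e|ne]; first by rewrite linearZZ.
rewrite (tri_join0 m h) ?[join_out _ _ _ _]linear0 ?scale0r ?linear0 //.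
by move=> e; rewrite e eqxx in ne.
Qed.

(** The common pattern of the inductive cases. Evaluations [t1] and [t2] of the intermediate sums
    mediate between those of [L] and [R], so each case reduces to three bijections and three
    compatibilities after composition with [l]. *)
Lemma via_target (U V T1 T2 : lmodType K) (toL : {linear U -> T1}) (toR : {linear V -> T2})
    (mid : {linear T1 -> T2}) (eL : {linear U -> op}) (eR : {linear V -> op})
    (t1 : {linear T1 -> op}) (t2 : {linear T2 -> op}) (l : op) :
  bijective toL -> bijective toR -> bijective mid ->
  (forall m, ocomp (t1 (toL m)) l = ocomp (eL m) l) ->
  (forall m, ocomp (t2 (toR m)) l = ocomp (eR m) l) ->
  (forall m, ocomp (t2 (mid m)) l = ocomp (t1 m) l) ->
  bijective (linv toR \ol mid \ol toL) /\
  forall m, ocomp (eR ((linv toR \ol mid \ol toL) m)) l = ocomp (eL m) l.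
Proof.
move=> bL bR bM h1 h2 h3; split.
  by apply: bij_lcomp bL; apply: bij_lcomp bM; exact: linv_bij.
by move=> m; rewrite -h2 2!lcompE linvVK // h3 h1.
Qed.
Lemma via_target0 (U V T1 : lmodType K) (toL : {linear U -> T1}) (toR : {linear V -> T1})
    (eL : {linear U -> op}) (eR : {linear V -> op}) (t1 : {linear T1 -> op}) (l : op) :
  bijective toL -> bijective toR ->
  (forall m, ocomp (t1 (toL m)) l = ocomp (eL m) l) ->
  (forall m, ocomp (t1 (toR m)) l = ocomp (eR m) l) ->
  bijective (linv toR \ol toL) /\
  forall m, ocomp (eR ((linv toR \ol toL) m)) l = ocomp (eL m) l.
Proof.
move=> bL bR h1 h2; split; first by apply: bij_lcomp bL; exact: linv_bij.
by move=> m; rewrite -h2 lcompE linvVK // h1.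
Qed.

Lemma alt_cat3 x y z : y <> [::] -> alternating (x ++ y) -> alternating (y ++ z) ->
  alternating (x ++ y ++ z).
Proof.
case: y => // a y _; rewrite -[(a :: y) ++ z]/(a :: (y ++ z)) !alt_cat_cons.
by case/andP=> -> _ ->.
Qed.
Lemma njoins_catl x y z : ~~ joins y z -> ~~ joins (x ++ y) z.
Proof. by apply: contra; rewrite /joins -catA; exact: alt_catr. Qed.
Lemma njoins_catr x y z : ~~ joins x y -> ~~ joins x (y ++ z).
Proof. by apply: contra; rewrite /joins catA; exact: alt_catl. Qed.

Lemma tri_cast_bij x y z x1 y1 z1 : x = x1 -> y = y1 -> z = z1 ->
  bijective (@tri_cast K C D S T x y z x1 y1 z1).
Proof.
move=> -> -> ->.
by have := @transport_bij K _ (fun p : seq letter * seq letter * seq letter => tri p.1.1 p.1.2 p.2)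
    (x1, y1, z1) (x1, y1, z1) erefl.
Qed.
Lemma tri_ev_cast x y z x1 y1 z1 m : x = x1 -> y = y1 -> z = z1 ->
  Th x1 y1 z1 (tri_cast x y z x1 y1 z1 m) = Th x y z m.
Proof.
move=> ex ey ez; subst x1 y1 z1; congr (Th x y z _).
exact: (@transportE K _ (fun p : seq letter * seq letter * seq letter => tri p.1.1 p.1.2 p.2) (x, y, z)).
Qed.

Lemma guard_join_bij p q w g : joins p q -> (p ++ q == w) = g ->
  bijective (guard_in g \ol @join_out K C D S T p q w).
Proof.
move=> h <-; have [e|ne] := eqVneq (p ++ q) w.
  by apply: bij_lcomp; [exact: (@guard_in_bij _ true) | exact: join_out_bij].
apply: bij_triv; last exact: null0.
by move=> m; apply: (tri_join0 m h) => e; rewrite e eqxx in ne.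
Qed.
Lemma guard_join_ev p q w g m : joins p q -> (p ++ q == w) = g ->
  (vec (oid : op) \ol guard_out g) ((guard_in g \ol join_out p q w) m) = Th p q w m.
Proof.
move=> h <-; rewrite tri_ev_join // 2!lcompE guard_out_in.
case: eqVneq => // ne; rewrite (tri_join0 m h) ?[join_out _ _ _ _]linear0 ?linear0 ?scale0r //.
by move=> e; rewrite e eqxx in ne.
Qed.

Lemma spaceL_ev_join x y z w m : joins x y ->
  spaceL_ev x y z w m = Th (x ++ y) z w (join x y (fun u => tri u z w) m).
Proof. exact: (@fus_ev_join 0 x y _ (fun u => Th u z w) m). Qed.
Lemma spaceR_ev_join x y z w m : joins y z ->
  spaceR_ev x y z w m = Th x (y ++ z) w (join y z (fun v => tri x v w) m).
Proof. exact: (@fus_ev_join (size x) y z _ (fun v => Th x v w) m). Qed.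

Definition assoc_ok x y z w (f : {linear spaceL x y z w -> spaceR x y z w}) :=
  bijective f /\
  forall m, ocomp (spaceR_ev x y z w (f m)) (lamW w) = ocomp (spaceL_ev x y z w m) (lamW w).

Lemma assoc1_ok x y z w : joins x y -> joins y z -> @assoc_ok x y z w (assoc1 x y z w).
Proof.
move=> jxy jyz; rewrite /assoc1; case: nilP => [e|ne].
  subst y; apply: (via_target0 (t1 := Th x z w)).
  - by apply: bij_lcomp; [apply: tri_cast_bij; rewrite ?cats0 | exact: join_bij].
  - by apply: bij_lcomp; [exact: tri_cast_bij | exact: join_bij].
  - by move=> m; rewrite lcompE tri_ev_cast ?cats0 // spaceL_ev_join.
  - by move=> m; rewrite lcompE tri_ev_cast // spaceR_ev_join.
have j1 : joins (x ++ y) z by rewrite /joins -catA; exact: alt_cat3.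
have j2 : joins x (y ++ z) by exact: alt_cat3.
have E : ((x ++ y) ++ z == w) = (x ++ y ++ z == w) by rewrite catA.
apply: (via_target0 (t1 := vec oid \ol guard_out _)).
- by apply: bij_lcomp; [exact: guard_join_bij | exact: join_bij].
- by apply: bij_lcomp; [exact: guard_join_bij | exact: join_bij].
- by move=> m; rewrite spaceL_ev_join // -(@guard_join_ev _ _ w (x ++ y ++ z == w)).
- by move=> m; rewrite spaceR_ev_join // -(@guard_join_ev _ _ w (x ++ y ++ z == w)).
Qed.

Lemma expand_ev_linl' k (F : seq letter -> lmodType K) (phi : forall u, {linear F u -> op})
    x' a b y' c t :
  expand_ev k phi x' a b y' (linl (dinj c t)) =
  omul (shiftn (k + size x') \ol theta a b (Some c)) (phi (x' ++ c :: y')) t.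
Proof. by rewrite /expand_ev lcase_inl dlift_inj. Qed.
Lemma expand_ev_linr' k (F : seq letter -> lmodType K) (phi : forall u, {linear F u -> op})
    x' a b y' t :
  expand_ev k phi x' a b y' (linr t) =
  omul (shiftn (k + size x') \ol theta a b None) (fus_ev k x' y' phi) t.
Proof. by rewrite /expand_ev lcase_inr. Qed.

Lemma eq_omul (U V W1 W2 : lmodType K) (f : {linear U -> op}) (g : {linear V -> op})
   (f' : {linear W1 -> op}) (g' : {linear W2 -> op}) (p : {linear U -> W1}) (q : {linear V -> W2}) t :
  (forall u, f u = f' (p u)) -> (forall v, g v = g' (q v)) ->
  omul f g t = omul f' g' (tmap p q t).
Proof.
move=> h1 h2; move: t; apply: (@tens_ext _ _ _ _ (omul f g) (omul f' g' \ol tmap p q)) => u v.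
by rewrite lcompE tmapE !omulE h1 h2.
Qed.

Lemma slot_or b c p q (g : bool) w u : (side b = side u -> joins p q) -> (p ++ q == w) = g ->
  (joins p q /\ (p ++ q == w) = g) \/ (forall f : B b c (Some u), f = 0).
Proof.
move=> h1 h2; have [e|/eqP ne] := eqVneq (side b) (side u); first by left; split=> //; exact: h1.
by right=> f; exact: (lbracket_nullr' f ne).
Qed.

(** * Cases (2) and (3) *)

Section Case2Letter.
Variables (x y z w : seq letter) (b c : letter) (z' : seq letter).
Hypotheses (hx : alternating x) (hy : alternating y) (hz : alternating z).
Hypotheses (jxy : joins x y) (jyz : ~~ joins y z).

Lemma assoc2_letter_ok : y = [:: b] -> z = c :: z' -> @assoc_ok x y z w (assoc2_letter x y z w b c z').
Proof.
move=> ey ez.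
have ex : x ++ y = rcons x b by rewrite ey cats1.
have nj : ~~ joins (x ++ y) z by exact: njoins_catl.
have hz' : joins [::] z' by move: hz; rewrite ez; exact: (@alt_catr _ _ _ _ _ [:: c]).
have bc : side b = side c by exact: (side_ab (x' := [::]) ey ez jyz hy hz).
(* A fused letter has the side of [b], and then [x u z'] alternates; for all other [u] the bracket
   is zero. *)
have sl u : (joins x (u :: z') /\ (x ++ u :: z' == w) = (x ++ u :: z' == w)) \/
    (forall f : B b c (Some u), f = 0).
  apply: slot_or => // su; apply: (@alt_fuse _ _ _ _ _ x b c u z'); rewrite -?ez -?bc //.
  by rewrite -ex.
apply: (via_target0 (t1 := split_ev x b c z' w)).
- by apply: bij_lcomp; [exact: split_bij | exact: join_bij].
- apply: bij_lcomp; last exact: expand_bij.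
  apply: bij_lprod; last by apply: bij_tmap; [exact: bij_lid | exact: join_bij].
  by apply: bij_dmap => u; apply: slot_bij.
- by move=> m; rewrite lcompE spaceL_ev_join // -tri_ev_split.
- move=> m; rewrite /spaceR_ev (@fus_ev_expand (size x) y z _
     (fun v => Th x v w) [::] b c z' ey ez jyz) lcompE.
  move: (expand _ _ _ _ _ _ _ m) => {}m; congr (ocomp _ _); move: m.
  set toR := lprod _ _.
  apply: (@prodm_ext _ _ _ _ (split_ev x b c z' w \ol toR) (expand_ev (size x) (fun v => Th x v w) [::] b c z')).
    apply: (@dsum_ext _ _ _ _ (split_ev x b c z' w \ol toR \ol linl) (expand_ev (size x) (fun v => Th x v w) [::] b c z' \ol linl)) => u t.
    rewrite !lcompE expand_ev_linl' /toR lprod_inl dmap_inj split_ev_linl.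
    by rewrite (@slot_ev _ _ _ _ _ _ _ (sl u)) addn0.
  apply: (@tens_ext _ _ _ _ (split_ev x b c z' w \ol toR \ol linr) (expand_ev (size x) (fun v => Th x v w) [::] b c z' \ol linr)) => f n.
  rewrite !lcompE expand_ev_linr /toR lprod_inr tmapE split_ev_linr addn0.
  by rewrite fus_ev_join.
Qed.
End Case2Letter.

(** The intermediate sums of cases (2) and (3) have one shape, with the space of the recursive call
    as parameter [V]. *)
Definition tgt_ev n b c (g : letter -> bool) (V : lmodType K) (eV : {linear V -> op}) :
    {linear prodm (dsum (fun u => guard (g u) (B b c (Some u)))) (tens (B b c None) V) -> op} :=
  lcase (dlift (fun u => shiftn n \ol theta b c (Some u) \ol guard_out _))
    (omul (shiftn n \ol theta b c None) eV).
Arguments tgt_ev : clear implicits.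
Lemma tgt_ev_linl n b c g V eV u t :
  tgt_ev n b c g V eV (linl (dinj u t)) = shiftn n (theta b c (Some u) (guard_out _ t)).
Proof. by rewrite /tgt_ev lcase_inl dlift_inj !lcompE. Qed.
Lemma tgt_ev_linr n b c g V eV f m :
  tgt_ev n b c g V eV (linr (tpure f m)) = ocomp (shiftn n (theta b c None f)) (eV m).
Proof. by rewrite /tgt_ev lcase_inr omulE lcompE. Qed.
Lemma tgt_ev_linr' n b c g V eV t :
  tgt_ev n b c g V eV (linr t) = omul (shiftn n \ol theta b c None) eV t.
Proof. by rewrite /tgt_ev lcase_inr. Qed.

Lemma tgt_ev_mid n b c g (V V' : lmodType K) (eV : {linear V -> op}) (eV' : {linear V' -> op}) (f : {linear V -> V'}) (l : op) p :
  (forall m, ocomp (eV' (f m)) l = ocomp (eV m) l) ->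
  ocomp (tgt_ev n b c g V' eV' (lprod lid (tmap lid f) p)) l =
  ocomp (tgt_ev n b c g V eV p) l.
Proof.
move=> h; move: p; apply: (@prodm_ext _ _ _ _
   (ocompr l \ol tgt_ev n b c g V' eV' \ol lprod lid (tmap lid f)) (ocompr l \ol tgt_ev n b c g V eV)) => t.
  by rewrite !lcompE lprod_inl lidE; congr (ocompr l _); rewrite /tgt_ev !lcase_inl.
rewrite !lcompE lprod_inr !tgt_ev_linr' -!/(ocomp _ l).
move: t; apply: (@tens_ext _ _ _ _ (ocompr l \ol omul _ eV' \ol tmap lid f) (ocompr l \ol omul _ eV)) => u m.
rewrite !lcompE tmapE !omulE.
rewrite -[LHS]/(ocomp (ocomp _ (eV' (f m))) l) -[RHS]/(ocomp (ocomp _ (eV m)) l).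
by rewrite -!ocompA h.
Qed.

Lemma tgt_ev_split x a b y z w n g (V : lmodType K) (eV : {linear V -> op}) (fL : forall u, {linear guard (x ++ u :: y == w) (B a b (Some u)) -> guard (g u) (B a b (Some u))})
   (fR : {linear tri x y w -> V}) p :
  size x = n -> (forall u t, guard_out _ (fL u t) = guard_out _ t) ->
  (forall t, eV (fR t) = Th x y w t) -> z = w ->
  tgt_ev n a b g V eV (lprod (dmap fL) (tmap lid fR) p) = split_ev x a b y w p.
Proof.
move=> <- hL hR _; move: p; apply: (@prodm_ext _ _ _ _
   (tgt_ev _ a b g V eV \ol lprod (dmap fL) (tmap lid fR)) (split_ev x a b y w)).
  apply: (@dsum_ext _ _ _ _ (tgt_ev _ a b g V eV \ol lprod (dmap fL) (tmap lid fR) \ol linl)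
    (split_ev x a b y w \ol linl)) => u t.
  by rewrite !lcompE lprod_inl dmap_inj tgt_ev_linl split_ev_linl hL.
apply: (@tens_ext _ _ _ _ (tgt_ev _ a b g V eV \ol lprod (dmap fL) (tmap lid fR) \ol linr)
    (split_ev x a b y w \ol linr)) => f t.
by rewrite !lcompE lprod_inr tmapE tgt_ev_linr split_ev_linr hR lidE.
Qed.

Lemma tgt_ev_expand k (F : seq letter -> lmodType K) (phi : forall u, {linear F u -> op})
    x' a b y' n g (V : lmodType K) (eV : {linear V -> op})
    (fL : forall u, {linear tens (B a b (Some u)) (F (x' ++ u :: y')) -> guard (g u) (B a b (Some u))})
    (fR : {linear fus x' y' F -> V}) p :
  k + size x' = n ->
  (forall u t, shiftn n (theta a b (Some u) (guard_out _ (fL u t))) =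
     omul (shiftn n \ol theta a b (Some u)) (phi (x' ++ u :: y')) t) ->
  (forall t, eV (fR t) = fus_ev k x' y' phi t) ->
  tgt_ev n a b g V eV (lprod (dmap fL) (tmap lid fR) p) = expand_ev k phi x' a b y' p.
Proof.
move=> <- hL hR; move: p; apply: (@prodm_ext _ _ _ _
   (tgt_ev _ a b g V eV \ol lprod (dmap fL) (tmap lid fR)) (expand_ev k phi x' a b y')).
  apply: (@dsum_ext _ _ _ _ (tgt_ev _ a b g V eV \ol lprod (dmap fL) (tmap lid fR) \ol linl)
    (expand_ev k phi x' a b y' \ol linl)) => u t.
  by rewrite !lcompE lprod_inl dmap_inj tgt_ev_linl expand_ev_linl' hL.
apply: (@tens_ext _ _ _ _ (tgt_ev _ a b g V eV \ol lprod (dmap fL) (tmap lid fR) \ol linr)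
    (expand_ev k phi x' a b y' \ol linr)) => f t.
by rewrite !lcompE lprod_inr tmapE tgt_ev_linr expand_ev_linr hR lidE.
Qed.

Lemma guard_swap_bij (V : lmodType K) g g' : g = g' ->
  bijective (@guard_in K g' V \ol @guard_out K g V).
Proof.
move=> ->; case: g'; first by apply: bij_lcomp; [exact: guard_in_bij | exact: guard_out_bij].
by apply: bij_triv => v; exact: null0.
Qed.
Lemma guard_swap_out (V : lmodType K) g g' (t : guard g V) : g = g' ->
  guard_out g' ((guard_in g' \ol guard_out g) t) = guard_out g t.
Proof. by move=> <-; case: g t. Qed.
Lemma lprod_tmap_lid (U V U' V' : lmodType K) (f : {linear U -> U'}) p :
  lprod f (lid : {linear tens V V' -> tens V V'}) p = lprod f (tmap lid lid) p.
Proof.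
case: p => u v; rewrite !lprodE; congr pair; move: v.
by apply: tens_ext => s t; rewrite tmapE !lidE.
Qed.

Section Case23.
Variables (x y z w : seq letter).
Hypotheses (hx : alternating x) (hy : alternating y) (hz : alternating z).

Lemma assoc2_ok y' b c z' (f : {linear spaceL x y' z' w -> spaceR x y' z' w}) :
  joins x y -> ~~ joins y z -> y = rcons y' b -> z = c :: z' -> y' <> [::] ->
  @assoc_ok x y' z' w f -> @assoc_ok x y z w (@assoc2 K C D S T x y z w y' b c z' f).
Proof.
move=> jxy jyz ey ez ny [bf hf].
have ex : x ++ y = rcons (x ++ y') b by rewrite ey -rcons_cat.
have nj : ~~ joins (x ++ y) z by exact: njoins_catl.
have jxy' : joins x y' by move: jxy; rewrite ey -cats1 /joins catA; exact: alt_catl.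
have hz' : alternating z' by move: hz; rewrite ez; exact: (@alt_catr _ _ _ _ _ [:: c]).
have bc : side b = side c by exact: (side_ab ey ez jyz hy hz).
have sl u : (joins x (y' ++ u :: z') /\ (x ++ y' ++ u :: z' == w) = (x ++ y' ++ u :: z' == w)) \/
    (forall f : B b c (Some u), f = 0).
  apply: slot_or => // su; rewrite /joins catA.
  by apply: (@alt_fuse _ _ _ _ _ (x ++ y') b c u z'); rewrite -?ez -?bc // -ex.
have E u : ((x ++ y') ++ u :: z' == w) = (x ++ y' ++ u :: z' == w) by rewrite catA.
apply: (via_target (t1 := tgt_ev (size x + size y') b c _ _ (spaceL_ev x y' z' w))
                   (t2 := tgt_ev (size x + size y') b c _ _ (spaceR_ev x y' z' w))).
- rewrite /toL2; apply: bij_lcomp; last exact: join_bij.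
  apply: bij_lcomp; last exact: split_bij.
  apply: bij_lprod; last by apply: bij_tmap; [exact: bij_lid | apply: linv_bij; exact: join_bij].
  by apply: bij_dmap => u; exact: guard_swap_bij.
- rewrite /toR2; apply: bij_lcomp; last exact: expand_bij.
  apply: bij_lprod; last exact: bij_lid.
  by apply: bij_dmap => u; apply: slot_bij.
- by apply: bij_lprod; [exact: bij_lid | apply: bij_tmap => //; exact: bij_lid].
- move=> m; rewrite /toL2 2!lcompE spaceL_ev_join // (@tri_ev_split _ _ _ _ _ _ _ _ ex ez nj).
  congr (ocomp _ _); apply: tgt_ev_split (erefl w); first by rewrite size_cat.
    by move=> u t; apply: guard_swap_out.
  move=> t; rewrite spaceL_ev_join // linvVK //; exact: join_bij.
- move=> m; rewrite /toR2 lcompE lprod_tmap_lid.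
  rewrite /spaceR_ev (@fus_ev_expand (size x) y z _
     (fun v => Th x v w) y' b c z' ey ez jyz).
  congr (ocomp _ _); apply: tgt_ev_expand => // u t.
  by rewrite (@slot_ev _ _ _ _ _ _ _ (sl u)).
- by move=> m; apply: tgt_ev_mid.
Qed.

Lemma assoc3_letter_ok x' a b : ~~ joins x y -> joins y z -> x = rcons x' a -> y = [:: b] ->
  @assoc_ok x y z w (assoc3_letter x y z w x' a b).
Proof.
move=> jxy jyz ex ey.
have nj : ~~ joins x (y ++ z) by exact: njoins_catr.
have hx' : alternating x' by move: hx; rewrite ex -cats1; exact: alt_catl.
have jx' : joins x' [::] by rewrite /joins cats0.
have ab : side a = side b by exact: (side_ab ex ey jxy hx hy).
have sl u : (joins (x' ++ [:: u]) z /\ ((x' ++ [:: u]) ++ z == w) = (x' ++ u :: z == w)) \/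
    (forall f : B a b (Some u), f = 0).
  apply: slot_or; last by rewrite -catA.
  move=> su; rewrite /joins -catA; apply: (@alt_fuse _ _ _ _ _ x' a b u z); rewrite -?ex -?ab //.
  by rewrite -[b :: z]/([:: b] ++ z) -ey.
rewrite /assoc3_letter; apply: (via_target0 (t1 := tgt_ev (size x') a b _ _ (Th x' z w))).
- apply: bij_lcomp; last exact: expand_bij.
  apply: bij_lprod; first by apply: bij_dmap => u; apply: slot_bij.
  apply: bij_tmap; first exact: bij_lid.
  by apply: bij_lcomp; [apply: tri_cast_bij; rewrite ?cats0 | exact: join_bij].
- by apply: bij_lcomp; [apply: split_bij => //; rewrite ey | exact: join_bij].
- move=> m; rewrite lcompE.
  rewrite /spaceL_ev (@fus_ev_expand 0 x y _
     (fun u => Th u z w) x' a b [::] ex ey jxy).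
  congr (ocomp _ _); apply: tgt_ev_expand => // [u t|t].
    by rewrite (@slot_ev _ _ _ _ _ _ _ (sl u)).
  by rewrite fus_ev_join // lcompE tri_ev_cast ?cats0.
- move=> m; rewrite lcompE spaceR_ev_join //; congr (ocomp _ _).
  have ez : y ++ z = b :: z by rewrite ey.
  by rewrite (@tri_ev_split _ _ _ _ _ _ _ _ ex ez nj).
Qed.

Lemma assoc3_ok x' a b y' (f : {linear spaceL x' y' z w -> spaceR x' y' z w}) :
  ~~ joins x y -> joins y z -> x = rcons x' a -> y = b :: y' -> y' <> [::] ->
  @assoc_ok x' y' z w f -> @assoc_ok x y z w (@assoc3 K C D S T x y z w x' a b y' f).
Proof.
move=> jxy jyz ex ey ny [bf hf].
have nj : ~~ joins x (y ++ z) by exact: njoins_catr.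
have ez : y ++ z = b :: (y' ++ z) by rewrite ey.
have jyz' : joins y' z by move: jyz; rewrite /joins ez; exact: (@alt_catr _ _ _ _ _ [:: b]).
have ab : side a = side b by exact: (side_ab ex ey jxy hx hy).
have sl u : (joins (x' ++ u :: y') z /\ ((x' ++ u :: y') ++ z == w) = (x' ++ u :: y' ++ z == w)) \/
    (forall f : B a b (Some u), f = 0).
  apply: slot_or; last by rewrite -catA.
  move=> su; rewrite /joins -catA.
  by apply: (@alt_fuse _ _ _ _ _ x' a b u (y' ++ z)); rewrite -?ex -?ab // -ez.
apply: (via_target (t1 := tgt_ev (size x') a b _ _ (spaceL_ev x' y' z w))
                   (t2 := tgt_ev (size x') a b _ _ (spaceR_ev x' y' z w))).
- rewrite /toL3; apply: bij_lcomp; last exact: expand_bij.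
  apply: bij_lprod; last exact: bij_lid.
  by apply: bij_dmap => u; apply: slot_bij.
- rewrite /toR3; apply: bij_lcomp; last exact: join_bij.
  apply: bij_lcomp; last exact: split_bij.
  apply: bij_lprod; first exact: bij_lid.
  by apply: bij_tmap; [exact: bij_lid | apply: linv_bij; exact: join_bij].
- by apply: bij_lprod; [exact: bij_lid | apply: bij_tmap => //; exact: bij_lid].
- move=> m; rewrite /toL3 lcompE lprod_tmap_lid.
  rewrite /spaceL_ev (@fus_ev_expand 0 x y _
     (fun u => Th u z w) x' a b y' ex ey jxy).
  congr (ocomp _ _); apply: tgt_ev_expand => // u t.
  by rewrite (@slot_ev _ _ _ _ _ _ _ (sl u)).
- move=> m; rewrite /toR3 2!lcompE spaceR_ev_join // (@tri_ev_split _ _ _ _ _ _ _ _ ex ez nj).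
  congr (ocomp _ _).
  transitivity (tgt_ev (size x') a b (fun u => x' ++ u :: y' ++ z == w) _ (spaceR_ev x' y' z w)
    (lprod (dmap (fun u => lid)) (tmap lid (linv (join y' z (fun v => tri x' v w)))) (split x (y ++ z) x' a b (y' ++ z) w (join y z (fun v => tri x v w) m)))).
    congr (tgt_ev _ _ _ _ _ _ _); rewrite !lprodE; congr pair.
    by rewrite (dsum_ext (f := dmap _) (g := lid)) // => u t; rewrite dmap_inj.
  apply: tgt_ev_split (erefl w) => // t.
  by rewrite spaceR_ev_join // linvVK //; exact: join_bij.
- by move=> m; apply: tgt_ev_mid.
Qed.
End Case23.

(** The projector reads only the outermost [size x] labels, and the operator acts only below
    them. *)
Lemma shiftn_lamW x O : ocomp (shiftn (size x) O) (lamW x) = ocomp (lamW x) (shiftn (size x) O).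
Proof.
elim: x => [|a x ih] /=; first by rewrite ocomp1l ocomp1r.
rewrite shiftnS ocompA -[ocomp (shift _) (lamL a)]lam_shift -ocompA -shiftM ih shiftM.
by rewrite ocompA.
Qed.
Lemma lamW_cat x y : lamW (x ++ y) = ocomp (lamW x) (shiftn (size x) (lamW y)).
Proof.
elim: x => [|a x ih] /=; first by rewrite shiftn0 ocomp1l.
by rewrite ih shiftM ocompA shiftnS.
Qed.

(** The definitions of case (4) apply [join_out] directly where [sig4] expects a guarded scalar; the
    guard around the result makes the two agree. *)
Lemma sig4_0_guard (U0 V : lmodType K) (I : choiceType) (Z : I -> lmodType K) (Z0 X : lmodType K)
   (gam : I -> bool) (c : I) (kappa : {linear U0 -> Z c}) (J : {linear V -> K^o}) t :
  sig4_0 X gam Z0 kappa (tmap lid J t) =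
  sig4_0 X gam Z0 kappa (tmap lid (guard_out (gam c)) (tmap lid (guard_in (gam c) \ol J) t)).
Proof.
move: t; apply: (@tens_ext _ _ _ _ (sig4_0 X gam Z0 kappa \ol tmap lid J)
  (sig4_0 X gam Z0 kappa \ol tmap lid (guard_out (gam c)) \ol tmap lid (guard_in (gam c) \ol J))) => f m.
rewrite 3!lcompE !tmapE !sig4_0E !lidE lcompE.
have [gc|/negP ngc] := pselect (gam c = true); first by rewrite guard_inK.
by congr (linl (dinj c _)); rewrite [LHS]guard0 // [RHS]guard0.
Qed.

(** * Case (4) for a middle word of one letter *)

Section Letter.
Variables (x y z w : seq letter) (x' : seq letter) (a b c : letter) (z' : seq letter).
Hypotheses (hx : alternating x) (hy : alternating y) (hz : alternating z).
Hypotheses (jxy : ~~ joins x y) (jyz : ~~ joins y z).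
Hypotheses (ex : x = rcons x' a) (ey : y = [:: b]) (ez : z = c :: z').

Let ab : side a = side b.
Proof. exact: (side_ab (y' := [::]) ex ey jxy hx hy). Qed.
Let bc : side b = side c.
Proof. exact: (side_ab (x' := [::]) ey ez jyz hy hz). Qed.
Let n := size x'.
Let gam v := (x' ++ v :: z' == w).

Let srcL : {linear prodm (dsum (fun u => tens (B a b (Some u)) (tri (x' ++ [:: u]) z w)))
      (tens (B a b None) (fus x' [::] (fun u => tri u z w))) -> _} :=
  lprod (dmap (fun u => tmap lid (split (x' ++ [:: u]) z x' u c z' w)))
    (tmap lid (guard_in (gam c) \ol (join_out (x' ++ [::]) z w \ol join x' [::] (fun u => tri u z w)))).
Let sL := @sig4 K letter (fun u => B a b (Some u)) (fun u v => B u c (Some v)) (fun u => B u c None)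
  (tri x' z' w) (B a b None) gam c (fun v => letterL a b c (Some v)) (letterL a b c None)
  (fun v u => letterL_in a b c (Some v) u) (letterL_unit a b c) (fun u => letterL_in a b c None u).

Let toLE m : @toL4_letter K C D S T x y z w x' a b c z' m = sL (srcL (expand x y (fun u => tri u z w) x' a b [::] m)).
Proof.
rewrite /toL4_letter lcompE; move: (expand _ _ _ _ _ _ _ m).
set A := lcase _ _; apply: (@prodm_ext _ _ _ _ A (sL \ol srcL)).
  apply: (@dsum_ext _ _ _ _ (A \ol linl) (sL \ol srcL \ol linl)) => u t.
  rewrite !lcompE /A lcase_inl dlift_inj /srcL lprod_inl dmap_inj /sL sig4_inl.
  by rewrite lcompE.
move=> t; rewrite [RHS]lcompE /srcL lprod_inr /sL /sig4 [RHS]lcase_inr [RHS]lcompE -sig4_0_guard.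
by rewrite /A lcase_inr [LHS]lcompE.
Qed.

(** A fused letter [u] is on the side of [c] and meets [z] again, whereas [x'] alone joins [z]
    ([jJL]). Hence [u = 1] contributes only to [v = c]. *)
Let njL u : side a = side u -> ~~ joins (x' ++ [:: u]) z.
Proof.
move=> su; rewrite cats1 ez joins_rcons_cons; last by rewrite -ez.
  by rewrite -su ab bc negbK.
by apply: (alt_rcons_side su); rewrite -ex.
Qed.
Let jJL : joins (x' ++ [::]) z.
Proof.
rewrite cats0 ez; apply: (@alt_fuse _ _ _ _ _ x' a c c z'); rewrite -?ex -?ez //.
by rewrite ab bc.
Qed.
Let gJL : ((x' ++ [::]) ++ z == w) = gam c. Proof. by rewrite cats0 ez. Qed.

Let toL_bij : bijective (@toL4_letter K C D S T x y z w x' a b c z').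
Proof.
apply: (eq_bij_lin (g := sL \ol srcL \ol expand x y (fun u => tri u z w) x' a b [::])).
  by move=> m; rewrite toLE !lcompE.
apply: bij_lcomp; last exact: expand_bij.
apply: bij_lcomp.
  apply: (@sig4_bij _ _ _ _ _ _ _ _ _ _ _ _ _ _ (@outL K C D S T EndC EndD a b c) (@outL0 K C D S T a b c)).
  - by move=> v u f g; exact: outL_in.
  - by move=> f; exact: outL_unit.
  - by move=> W F G; exact: letterL_ext.
  - by move=> u f g; exact: outL0_in.
  - by move=> W F G; exact: letterL0_ext.
apply: bij_lprod.
  apply: bij_dmap => u; have [su|/eqP su] := eqVneq (side a) (side u).
    apply: bij_tmap; first exact: bij_lid.
    by apply: split_bij => //; [rewrite cats1 | exact: njL].
  by apply: bij_triv; apply: tens0l => f; exact: (lbracket_nullr' f su).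
apply: bij_tmap; first exact: bij_lid.
apply: (eq_bij_lin (g := (guard_in (gam c) \ol join_out (x' ++ [::]) z w) \ol join x' [::] (fun u => tri u z w))) => //.
apply: bij_lcomp; first exact: guard_join_bij.
apply: join_bij; rewrite /joins cats0; move: hx; rewrite ex -cats1; exact: alt_catl.
Qed.

Let tL : {linear sig4_tgt (tri x' z' w) gam (fun v => letterL a b c (Some v)) (letterL a b c None) -> op} :=
  sig4_tgt_ev gam (Th x' z' w) (fun v => shiftn n \ol evL4 a b c (Some v)) (shiftn n \ol evL4 a b c None).

Let tLE m : tL (@toL4_letter K C D S T x y z w x' a b c z' m) = spaceL_ev x y z w m.
Proof.
rewrite toLE /tL (@sig4_ev _ _ _ _ _ _ _ _ _ _ _ _ _ _ _ _ _ _
   (fun u => shiftn n \ol theta a b (Some u))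
   (fun u v => shiftn n \ol theta u c (Some v)) (fun u => shiftn n \ol theta u c None) _
   (shiftn n \ol theta a b None)); first last.
- by move=> u f g; rewrite !lcompE evL4_in shiftnM.
- by move=> f; rewrite !lcompE evL4_unit.
- by move=> v u f g; rewrite !lcompE evL4_in shiftnM.
rewrite /spaceL_ev (@fus_ev_expand 0 x y _ (fun u => Th u z w) x' a b [::] ex ey jxy).
move: (expand _ _ _ _ _ _ _ m).
set A := sig4_src_ev _ _ _ _ _ _ _; set E := expand_ev _ _ _ _ _ _.
apply: (@prodm_ext _ _ _ _ (A \ol srcL) E).
  apply: (@dsum_ext _ _ _ _ (A \ol srcL \ol linl) (E \ol linl)) => u t.
  rewrite !lcompE /srcL lprod_inl dmap_inj /A /sig4_src_ev lcase_inl dlift_inj /E expand_ev_linl'.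
  have [su|/eqP su] := eqVneq (side a) (side u); last first.
    by rewrite (tens0l (fun f => lbracket_nullr' f su) t) !linear0.
  symmetry; apply: eq_omul => // v; apply: tri_ev_split => //; [by rewrite cats1 | exact: njL].
move=> t; rewrite lcompE /srcL lprod_inr /A /sig4_src_ev lcase_inr /E expand_ev_linr'.
symmetry; apply: eq_omul => // v; rewrite fus_ev_join; last first.
  by rewrite /joins cats0; move: hx; rewrite ex -cats1; exact: alt_catl.
by rewrite -(guard_join_ev _ jJL gJL) !lcompE.
Qed.

Let srcR : {linear prodm (dsum (fun v => tens (B b c (Some v)) (tri x (v :: z') w)))
      (tens (B b c None) (fus [::] z' (fun v => tri x v w))) -> _} :=
  lprod (dmap (fun v => tmap lid (split x (v :: z') x' a v z' w)))
    (tmap lid (guard_in (gam a) \ol (join_out x z' w \ol join [::] z' (fun v => tri x v w)))).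
Let sR := @sig4 K letter (fun v => B b c (Some v)) (fun v d => B a v (Some d)) (fun v => B a v None)
  (tri x' z' w) (B b c None) gam a (fun v => letterR a b c (Some v)) (letterR a b c None)
  (fun d v => letterR_in a b c (Some d) v) (letterR_unit a b c) (fun v => letterR_in a b c None v).

Let toRE m : @toR4_letter K C D S T x y z w x' a b c z' m = sR (srcR (expand y z (fun v => tri x v w) [::] b c z' m)).
Proof.
rewrite /toR4_letter lcompE; move: (expand _ _ _ _ _ _ _ m).
set A := lcase _ _; apply: (@prodm_ext _ _ _ _ A (sR \ol srcR)).
  apply: (@dsum_ext _ _ _ _ (A \ol linl) (sR \ol srcR \ol linl)) => u t.
  rewrite !lcompE /A lcase_inl dlift_inj /srcR lprod_inl dmap_inj /sR sig4_inl.
  by rewrite lcompE.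
move=> t; rewrite [RHS]lcompE /srcR lprod_inr /sR /sig4 [RHS]lcase_inr [RHS]lcompE -sig4_0_guard.
by rewrite /A lcase_inr [LHS]lcompE.
Qed.

Let njR v : side c = side v -> ~~ joins x (v :: z').
Proof.
move=> su; rewrite ex joins_rcons_cons; first by rewrite -su ab bc negbK.
  by rewrite -ex.
by apply: (alt_cons_side su); rewrite -ez.
Qed.
Let hz' : joins [::] z'.
Proof. by move: hz; rewrite ez; exact: (@alt_catr _ _ _ _ _ [:: c]). Qed.
Let jJR : joins x z'.
Proof.
rewrite ex -cats1 /joins -catA; apply: (@alt_fuse _ _ _ _ _ x' a c a z'); rewrite -?ex -?ez //.
by rewrite ab bc.
Qed.
Let gJR : (x ++ z' == w) = gam a. Proof. by rewrite ex cat_rcons. Qed.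

Let toR_bij : bijective (@toR4_letter K C D S T x y z w x' a b c z').
Proof.
apply: (eq_bij_lin (g := sR \ol srcR \ol expand y z (fun v => tri x v w) [::] b c z')).
  by move=> m; rewrite toRE !lcompE.
apply: bij_lcomp; last exact: expand_bij.
apply: bij_lcomp.
  apply: (@sig4_bij _ _ _ _ _ _ _ _ _ _ _ _ _ _ (@outR K C D S T EndC EndD a b c) (@outR0 K C D S T a b c)).
  - by move=> v u f g; exact: outR_in.
  - by move=> f; exact: outR_unit.
  - by move=> W F G; exact: letterR_ext.
  - by move=> u f g; exact: outR0_in.
  - by move=> W F G; exact: letterR0_ext.
apply: bij_lprod.
  apply: bij_dmap => u; have [su|/eqP su] := eqVneq (side c) (side u).
    apply: bij_tmap; first exact: bij_lid.
    by apply: split_bij => //; exact: njR.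
  by apply: bij_triv; apply: tens0l => f; apply: (lbracket_nullr' f); rewrite bc.
apply: bij_tmap; first exact: bij_lid.
apply: (eq_bij_lin (g := (guard_in (gam a) \ol join_out x z' w) \ol join [::] z' (fun v => tri x v w))) => //.
by apply: bij_lcomp; [exact: guard_join_bij | exact: join_bij].
Qed.

Let tR : {linear sig4_tgt (tri x' z' w) gam (fun v => letterR a b c (Some v)) (letterR a b c None) -> op} :=
  sig4_tgt_ev gam (Th x' z' w) (fun v => shiftn n \ol evR4 a b c (Some v)) (shiftn n \ol evR4 a b c None).

Let tRE m : tR (@toR4_letter K C D S T x y z w x' a b c z' m) = spaceR_ev x y z w m.
Proof.
(* On this side [b] and [c] meet below all of [x = x' a], one step deeper than the place where [a]
   and [b] meet. *)
have sz : (size x + 0)%N = n.+1 by rewrite addn0 ex size_rcons.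
rewrite toRE /tR (@sig4_ev _ _ _ _ _ _ _ _ _ _ _ _ _ _ _ _ _ _
   (fun v => shiftn (size x + 0) \ol theta b c (Some v))
   (fun v d => shiftn n \ol theta a v (Some d)) (fun v => shiftn n \ol theta a v None) _
   (shiftn (size x + 0) \ol theta b c None)); first last.
- by move=> u f g; rewrite !lcompE evR4_in shiftnM sz shiftnSr.
- by move=> f; rewrite !lcompE evR4_unit // sz shiftnSr.
- by move=> v u f g; rewrite !lcompE evR4_in shiftnM sz shiftnSr.
rewrite /spaceR_ev (@fus_ev_expand (size x) y z _ (fun v => Th x v w) [::] b c z' ey ez jyz).
move: (expand _ _ _ _ _ _ _ m).
set A := sig4_src_ev _ _ _ _ _ _ _; set E := expand_ev _ _ _ _ _ _.
apply: (@prodm_ext _ _ _ _ (A \ol srcR) E).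
  apply: (@dsum_ext _ _ _ _ (A \ol srcR \ol linl) (E \ol linl)) => u t.
  rewrite !lcompE /srcR lprod_inl dmap_inj /A /sig4_src_ev lcase_inl dlift_inj /E expand_ev_linl'.
  have [su|/eqP su] := eqVneq (side c) (side u); last first.
    by rewrite (tens0l _ t) ?linear0 // => f; apply: (lbracket_nullr' f); rewrite bc.
  symmetry; apply: eq_omul => // v; apply: tri_ev_split => //; exact: njR.
move=> t; rewrite lcompE /srcR lprod_inr /A /sig4_src_ev lcase_inr /E expand_ev_linr'.
symmetry; apply: eq_omul => // v; rewrite fus_ev_join //.
by rewrite -(guard_join_ev _ jJR gJR) !lcompE.
Qed.

Lemma assoc4_letter_ok : assoc_ok (assoc4_letter x y z w x' a b c z').
Proof.
apply: (via_target (t1 := tL) (t2 := tR)).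
- exact: toL_bij.
- exact: toR_bij.
- apply: bij_lprod; last by apply: bij_tmap; [exact: letter_assoc_bij | exact: bij_lid].
  apply: bij_dmap => v; have [gv|/negP ngv] := pselect (gam v = true).
    apply: bij_lcomp; last exact: guard_out_bij.
    by apply: bij_lcomp; [exact: guard_in_bij | exact: letter_assoc_bij].
  by apply: bij_triv => t; exact: guard0.
- by move=> m; rewrite tLE.
- by move=> m; rewrite tRE.
(* On the summand [v] one has [w = x' v z'], so at depth [size x'] the projector supplies the label
   [v] that [ev4_assoc] asks for. The summand at 1 asks for none. *)
set M := lprod _ _; move=> m; move: m.
apply: (@prodm_ext _ _ _ _ (ocompr (lamW w) \ol tR \ol M) (ocompr (lamW w) \ol tL)).
  apply: (@dsum_ext _ _ _ _ (ocompr (lamW w) \ol tR \ol M \ol linl) (ocompr (lamW w) \ol tL \ol linl)) => v g.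
  have [gv|/negP ngv] := pselect (gam v = true); last by rewrite [g]guard0 // !linear0.
  rewrite !lcompE /M lprod_inl dmap_inj /tR /tL /sig4_tgt_ev !lcase_inl !dlift_inj !lcompE guard_inK //.
  rewrite -[LHS]/(ocomp _ (lamW w)) -[RHS]/(ocomp _ (lamW w)).
  have -> : lamW w = lamW (x' ++ v :: z') by congr lamW; apply/eqP; rewrite eq_sym.
  rewrite lamW_cat !ocompA !shiftn_lamW -!ocompA -!shiftnM; congr (ocomp _ (shiftn _ _)).
  rewrite [lamW (v :: z')]/(ocomp (lamo (Some v)) (shift (lamW z'))) !ocompA.
  by rewrite ev4_assoc.
apply: (@tens_ext _ _ _ _ (ocompr (lamW w) \ol tR \ol M \ol linr) (ocompr (lamW w) \ol tL \ol linr)) => g t.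
rewrite !lcompE /M lprod_inr tmapE /tR /tL /sig4_tgt_ev !lcase_inr !omulE lidE !lcompE.
congr (ocompr _ (ocomp (shiftn _ _) _)).
by have := ev4_assoc ssC ssD EndC EndD g; rewrite !ocomp1r.
Qed.
End Letter.

(** * Case (4) for a longer middle word *)

Section Long.
Variables (x y z w : seq letter) (x' : seq letter) (a b : letter).
Variables (y1 y2 y'' : seq letter) (b' c : letter) (z' : seq letter).
Hypotheses (hx : alternating x) (hy : alternating y) (hz : alternating z).
Hypotheses (jxy : ~~ joins x y) (jyz : ~~ joins y z).
Hypotheses (ex : x = rcons x' a) (ey : y = b :: y1) (ey1 : y1 = rcons y'' b').
Hypotheses (ey2 : y2 = b :: y'') (ez : z = c :: z').
Variables (f : {linear spaceL x' y1 z w -> spaceR x' y1 z w}).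
Variables (g : {linear spaceL x y2 z' w -> spaceR x y2 z' w}).
Variables (h : {linear spaceL x' y'' z' w -> spaceR x' y'' z' w}).
Hypotheses (okf : assoc_ok f) (okg : assoc_ok g) (okh : assoc_ok h).

Let U u := B a b (Some u).
Let Q v := B b' c (Some v).
Let Xu u := tri (x' ++ u :: y'') z' w.
Let Zv v := tri x' (y'' ++ v :: z') w.
Let gam u v := ((x' ++ u :: y'') ++ v :: z' == w).
Let gam' u v := (x' ++ u :: y'' ++ v :: z' == w).
Let gamE u v : gam u v = gam' u v. Proof. by rewrite /gam -catA. Qed.

Let n := size x'.
Let k := size y''.
Let e u := shiftn (0 + n) \ol theta a b (Some u).
Let e0 := shiftn (0 + n) \ol theta a b None.
(** The letters [b'] and [c] meet at depth [n + k.+2] in the original words, at [n + k.+1] once [a]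
    and [b] have fused, and at [n + k] once they have cancelled. *)
Let q v := shiftn (n + k.+1) \ol theta b' c (Some v).
Let q0 := shiftn (n + k.+1) \ol theta b' c None.
Let q' v := shiftn (n + k) \ol theta b' c (Some v).
Let q0' := shiftn (n + k) \ol theta b' c None.
Let r v := shiftn (size x + size y2) \ol theta b' c (Some v).
Let r0 := shiftn (size x + size y2) \ol theta b' c None.
Let xu u := Th (x' ++ u :: y'') z' w.
Let zv v := Th x' (y'' ++ v :: z') w.

Let eyr : y = rcons y2 b'. Proof. by rewrite ey ey1 ey2. Qed.
Let jy1z : ~~ joins y1 z.
Proof.
apply: contra jyz => j; rewrite ey /joins -[(b :: y1) ++ z]/([:: b] ++ (y1 ++ z)).
by apply: alt_cat3 => //; [rewrite ey1; case: (y'') | move: hy; rewrite ey].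
Qed.
Let jxy2 : ~~ joins x y2.
Proof.
apply: contra jxy => j; rewrite eyr /joins -cats1.
apply: alt_cat3 => //; [by rewrite ey2|by rewrite cats1 -eyr].
Qed.
Let hy1 : alternating y1.
Proof. by move: hy; rewrite ey; exact: (@alt_catr _ _ _ _ _ [:: b]). Qed.
Let hy2 : alternating y2.
Proof. by move: hy; rewrite eyr -cats1; exact: alt_catl. Qed.

Let srcL : {linear prodm (dsum (fun u => tens (B a b (Some u)) (tri (x' ++ u :: y1) z w)))
      (tens (B a b None) (fus x' y1 (fun u => tri u z w))) -> sigL_src U Q Xu Zv (B a b None) (B b' c None) (spaceR x' y'' z' w) gam} :=
  lprod (dmap (fun u => tmap lid (split (x' ++ u :: y1) z (x' ++ u :: y'') b' c z' w)))
        (tmap lid (expand y1 z (fun v => tri x' v w) y'' b' c z' \ol f)).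
Let psiLE m : @psiL K C D S T x y z w x' a b y1 y'' b' c z' f m =
  @sigL K letter U Q Xu Zv (B a b None) (B b' c None) (spaceR x' y'' z' w) gam gam' (srcL (expand x y (fun u => tri u z w) x' a b y1 m)).
Proof.
rewrite /psiL lcompE; move: (expand _ _ _ _ _ _ _ m).
set s := @sigL _ _ _ _ _ _ _ _ _ _ _.
set A := lcase _ _; apply: (@prodm_ext _ _ _ _ A (s \ol srcL)).
  apply: (@dsum_ext _ _ _ _ (A \ol linl) (s \ol srcL \ol linl)) => u t.
  rewrite !lcompE /A lcase_inl dlift_inj /srcL lprod_inl dmap_inj /s /sigL lcase_inl dlift_inj.
  by rewrite lcompE.
move=> t; rewrite [RHS]lcompE /srcL lprod_inr /s /sigL [RHS]lcase_inr.
by rewrite /A lcase_inr [LHS]lcompE.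
Qed.

Let psiL_bij : bijective (@psiL K C D S T x y z w x' a b y1 y'' b' c z' f : {linear spaceL x y z w -> _}).
Proof.
apply: (eq_bij_lin (g := @sigL K letter U Q Xu Zv (B a b None) (B b' c None) (spaceR x' y'' z' w) gam gam' \ol srcL \ol expand x y (fun u => tri u z w) x' a b y1)).
  by move=> m; rewrite psiLE !lcompE.
apply: bij_lcomp; last exact: expand_bij.
apply: bij_lcomp; first exact: sigL_bij.
apply: bij_lprod.
  apply: bij_dmap => u; apply: bij_tmap; first exact: bij_lid.
  apply: split_bij => //; first by rewrite ey1 rcons_cat.
  by rewrite -cat_rcons; exact: njoins_catl.
apply: bij_tmap; first exact: bij_lid.
by apply: bij_lcomp; [exact: expand_bij | case: okf].
Qed.

Let tL := @sigP_tgt_ev K letter U Q Xu Zv (B a b None) (B b' c None) _ gam' C D S T e e0 q q' q0 q0' xu zv (spaceR_ev x' y'' z' w).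
Let tR := @sigP_tgt_ev K letter U Q Xu Zv (B a b None) (B b' c None) _ gam' C D S T e e0 q q' q0 q0' xu zv (spaceL_ev x' y'' z' w).

Let tLE m : ocomp (tL (@psiL K C D S T x y z w x' a b y1 y'' b' c z' f m)) (lamW w) = ocomp (spaceL_ev x y z w m) (lamW w).
Proof.
rewrite psiLE /tL sigL_ev // /spaceL_ev (@fus_ev_expand 0 x y _ (fun u => Th u z w) x' a b y1 ex ey jxy).
move: (expand _ _ _ _ _ _ _ m).
set A := sigL_src_ev _ _ _ _ _ _ _ _ _ _; set E := expand_ev _ _ _ _ _ _.
apply: (@prodm_ext _ _ _ _ (ocompr (lamW w) \ol A \ol srcL) (ocompr (lamW w) \ol E)).
  apply: (@dsum_ext _ _ _ _ (ocompr (lamW w) \ol A \ol srcL \ol linl) (ocompr (lamW w) \ol E \ol linl)) => u t.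
  rewrite !lcompE /srcL lprod_inl dmap_inj /A /sigL_src_ev lcase_inl dlift_inj /E expand_ev_linl'.
  congr (ocompr (lamW w) _); symmetry; apply: eq_omul => // v.
  rewrite (@tri_ev_split _ _ (x' ++ u :: y'') b' c z') //; last 2 first.
  - by rewrite ey1 rcons_cat.
  - by rewrite -cat_rcons; exact: njoins_catl.
  by rewrite /split_ev_of size_cat.
apply: (@tens_ext _ _ _ _ (ocompr (lamW w) \ol A \ol srcL \ol linr) (ocompr (lamW w) \ol E \ol linr)) => s t.
rewrite !lcompE /srcL lprod_inr tmapE /A /sigL_src_ev lcase_inr /E expand_ev_linr' !omulE lidE.
rewrite -[LHS]/(ocomp (ocomp _ _) _) -[RHS]/(ocomp (ocomp _ _) _) -!ocompA; congr (ocomp _ _).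
have [_ <-] := okf; congr (ocomp _ _).
by rewrite lcompE /spaceR_ev (@fus_ev_expand (size x') y1 z _ (fun v => Th x' v w) y'' b' c z' ey1 ez jy1z).
Qed.

Let g' := linv g.
Let g'K m : ocomp (spaceL_ev x y2 z' w (g' m)) (lamW w) = ocomp (spaceR_ev x y2 z' w m) (lamW w).
Proof. by have [bg hg] := okg; rewrite -hg /g' linvVK. Qed.

Let srcR : {linear prodm (dsum (fun v => tens (B b' c (Some v)) (tri x (y2 ++ v :: z') w)))
      (tens (B b' c None) (fus y2 z' (fun v => tri x v w))) -> sigR_src U Q Xu Zv (B a b None) (B b' c None) (spaceL x' y'' z' w) gam'} :=
  lprod (dmap (fun v => tmap lid (split x (y2 ++ v :: z') x' a b (y'' ++ v :: z') w)))
        (tmap lid (expand x y2 (fun u => tri u z' w) x' a b y'' \ol g')).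
Let sR := @sigR K letter U Q Xu Zv (B a b None) (B b' c None) (spaceL x' y'' z' w) gam' gam'.
Let psi := @psiR K C D S T x y z w x' a b y2 y'' b' c z' g'.
Let psiRE m : psi m = sR (srcR (expand y z (fun v => tri x v w) y2 b' c z' m)).
Proof.
rewrite /psi /psiR lcompE; move: (expand _ _ _ _ _ _ _ m).
set A := lcase _ _; apply: (@prodm_ext _ _ _ _ A (sR \ol srcR)).
  apply: (@dsum_ext _ _ _ _ (A \ol linl) (sR \ol srcR \ol linl)) => u t.
  rewrite !lcompE /A lcase_inl dlift_inj /srcR lprod_inl dmap_inj /sR /sigR lcase_inl dlift_inj.
  by rewrite lcompE.
move=> t; rewrite [RHS]lcompE /srcR lprod_inr /sR /sigR [RHS]lcase_inr.
by rewrite /A lcase_inr [LHS]lcompE.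
Qed.

Let psiR_bij : bijective psi.
Proof.
apply: (eq_bij_lin (g := sR \ol srcR \ol expand y z (fun v => tri x v w) y2 b' c z')).
  by move=> m; rewrite psiRE !lcompE.
apply: bij_lcomp; last exact: expand_bij.
apply: bij_lcomp; first by apply: sigR_bij.
apply: bij_lprod.
  apply: bij_dmap => u; apply: bij_tmap; first exact: bij_lid.
  by apply: split_bij => //; [rewrite ey2 | exact: njoins_catr].
apply: bij_tmap; first exact: bij_lid.
by apply: bij_lcomp; [exact: expand_bij | apply: linv_bij; case: okg].
Qed.

(** The operator of [[a b; d]] turns one step into two, so the operator of [[b' c; d']] loses one
    shift when it moves past it; in [swap0] it loses two. *)
Let swap d d' (s : B a b (Some d)) (t : B b' c d') :
  ocomp ((shiftn (size x + size y2) \ol theta b' c d') t) (e d s) =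
  ocomp (e d s) ((shiftn (n + k.+1) \ol theta b' c d') t).
Proof.
have -> : (size x + size y2 = n + k.+2)%N by rewrite ex ey2 size_rcons addSnnS.
rewrite /e !lcompE add0n.
by rewrite !shiftnD -!shiftnM !shiftnS -theta_shift.
Qed.
Let swap0 d' (s : B a b None) (t : B b' c d') :
  ocomp ((shiftn (size x + size y2) \ol theta b' c d') t) (e0 s) =
  ocomp (e0 s) ((shiftn (n + k) \ol theta b' c d') t).
Proof.
have -> : (size x + size y2 = n + k.+2)%N by rewrite ex ey2 size_rcons addSnnS.
rewrite /e0 !lcompE add0n.
by rewrite !shiftnD -!shiftnM !shiftnS -theta_none_shift.
Qed.

Let tRE m : ocomp (tR (psi m)) (lamW w) = ocomp (spaceR_ev x y z w m) (lamW w).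
Proof.
rewrite psiRE /tR (@sigR_ev _ _ _ _ _ _ _ _ _ gam' gam' (fun u v => erefl) _ _ _ _ _ _ _ _ r _ _ r0) //; first last.
- by move=> u s t; exact: swap.
- by move=> u v s t; exact: swap.
rewrite /spaceR_ev (@fus_ev_expand (size x) y z _ (fun v => Th x v w) y2 b' c z' eyr ez jyz).
move: (expand _ _ _ _ _ _ _ m).
set A := sigR_src_ev _ _ _ _ _ _ _ _; set E := expand_ev _ _ _ _ _ _.
apply: (@prodm_ext _ _ _ _ (ocompr (lamW w) \ol A \ol srcR) (ocompr (lamW w) \ol E)).
  apply: (@dsum_ext _ _ _ _ (ocompr (lamW w) \ol A \ol srcR \ol linl) (ocompr (lamW w) \ol E \ol linl)) => u t.
  rewrite !lcompE /srcR lprod_inl dmap_inj /A /sigR_src_ev lcase_inl dlift_inj /E expand_ev_linl'.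
  congr (ocompr (lamW w) _); symmetry; apply: eq_omul => // v.
  by rewrite (@tri_ev_split _ _ x' a b (y'' ++ u :: z')) //;
    [rewrite ey2 | exact: njoins_catr].
apply: (@tens_ext _ _ _ _ (ocompr (lamW w) \ol A \ol srcR \ol linr) (ocompr (lamW w) \ol E \ol linr)) => s t.
rewrite !lcompE /srcR lprod_inr tmapE /A /sigR_src_ev lcase_inr /E expand_ev_linr' !omulE lidE.
rewrite -[LHS]/(ocomp (ocomp _ _) _) -[RHS]/(ocomp (ocomp _ _) _) -!ocompA; congr (ocomp _ _).
rewrite -[fus_ev _ _ _ _]/(spaceR_ev x y2 z' w) -g'K; congr (ocomp _ _).
by rewrite lcompE /spaceL_ev (@fus_ev_expand 0 x y2 _ (fun u => Th u z' w) x' a b y'' ex ey2 jxy2).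
Qed.

Lemma assoc4_ok : assoc_ok (@assoc4 K C D S T x y z w x' a b y1 y2 y'' b' c z' f g h).
Proof.
have [bh hh] := okh.
apply: (via_target (t1 := tL) (t2 := tR)).
- exact: psiL_bij.
- exact: psiR_bij.
- apply: bij_lprod; first exact: bij_lid.
  apply: bij_tmap; first exact: bij_lid.
  by apply: bij_tmap; [exact: bij_lid | exact: linv_bij].
- exact: tLE.
- exact: tRE.
(* Only the last summand contains the recursive space; there [linv h] preserves evaluation because
   [h] does. *)
set M := lprod _ _ => p; move: p.
have E1 p : ocompr (lamW w) (tR (M (linl p))) = ocompr (lamW w) (tL (linl p)).
  by rewrite /M lprod_inl lidE; congr (ocompr _ _); rewrite /tR /tL /sigP_tgt_ev /tgt_case !lcase_inl.
apply: (@sigP_ext K letter U Q Xu Zv (B a b None) (B b' c None) (spaceR x' y'' z' w) gam' op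
  (ocompr (lamW w) \ol tR \ol M) (ocompr (lamW w) \ol tL)) => [u v s t gg|u s t m|v s t m|s t m].
- by rewrite !lcompE; exact: E1.
- by rewrite !lcompE; exact: E1.
- by rewrite !lcompE; exact: E1.
rewrite !lcompE /M lprod_inr !tmapE !lidE.
rewrite /tR /tL /sigP_tgt_ev /tgt_case !lcase_inr !omulE.
rewrite -[LHS]/(ocomp (ocomp _ (ocomp _ _)) _) -[RHS]/(ocomp (ocomp _ (ocomp _ _)) _) -!ocompA.
by congr (ocomp _ (ocomp _ _)); rewrite -hh linvVK.
Qed.
End Long.

Lemma assoc_recS n x y z w : @assoc_rec K C D S T n.+1 x y z w =
    match joins x y, joins y z with
    | true, true => assoc1 x y z w
    | true, false =>
        match unrcons y, z with
        | Some ([::], b), c :: z' => assoc2_letter x y z w b c z'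
        | Some (y', b), c :: z' => @assoc2 K C D S T x y z w y' b c z' (assoc_rec n x y' z' w)
        | _, _ => lzero
        end
    | false, true =>
        match unrcons x, y with
        | Some (x', a), [:: b] => assoc3_letter x y z w x' a b
        | Some (x', a), b :: y' => @assoc3 K C D S T x y z w x' a b y' (assoc_rec n x' y' z w)
        | _, _ => lzero
        end
    | false, false =>
        match unrcons x, y, z with
        | Some (x', a), [:: b], c :: z' => assoc4_letter x y z w x' a b c z'
        | Some (x', a), b :: y1, c :: z' =>
            if unrcons y1 is Some (y'', b') then
              @assoc4 K C D S T x y z w x' a b y1 (b :: y'') y'' b' c z'
                (assoc_rec n x' y1 z w)
                (assoc_rec n x (b :: y'') z' w) (assoc_rec n x' y'' z' w)
            else lzero
        | _, _, _ => lzero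
        end
    end.
Proof. by []. Qed.

Lemma alt_rcons_l x a : alternating (rcons x a) -> alternating x.
Proof. by rewrite -cats1; exact: alt_catl. Qed.
Lemma alt_cons_r a x : alternating (a :: x) -> alternating x.
Proof. exact: (@alt_catr _ _ _ _ _ [:: a]). Qed.

Lemma assoc_rec_ok n x y z w : alternating x -> alternating y -> alternating z ->
  (size y <= n)%N -> assoc_ok (@assoc_rec K C D S T n x y z w).
Proof.
elim: n x y z w => [|n ih] x y z w hx hy hz sy.
  by apply: assoc1_ok; case: y sy hy => // _ _; rewrite /joins ?cats0.
rewrite assoc_recS; have [jxy|njxy] := boolP (joins x y); have [jyz|njyz] := boolP (joins y z).
- exact: assoc1_ok.
- case: z hz njyz => [|c z] hz njyz; first by move: njyz; rewrite /joins cats0 hy.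
  case/lastP: y hy sy jxy njyz => [|y b] hy sy jxy njyz; first by move: njyz; rewrite /joins hz.
  rewrite unrcons_rcons; have hy' := alt_rcons_l hy; have hz' := alt_cons_r hz.
  have sy' : (size y <= n)%N by rewrite size_rcons in sy.
  case: y hy sy jxy njyz hy' sy' => [|b1 y] hy sy jxy njyz hy' sy'.
    exact: (@assoc2_letter_ok).
  by apply: (@assoc2_ok) => //; exact: ih.
- case/lastP: x hx njxy => [|x a] hx njxy; first by move: njxy; rewrite /joins hy.
  case: y hy sy jyz njxy => [|b y] hy sy jyz njxy; first by move: njxy; rewrite /joins cats0 hx.
  rewrite unrcons_rcons; have hx' := alt_rcons_l hx; have hy' := alt_cons_r hy.
  case: y hy sy jyz njxy hy' => [|b1 y] hy sy jyz njxy hy'.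
    exact: (@assoc3_letter_ok).
  by apply: (@assoc3_ok) => //; exact: ih.
case/lastP: x hx njxy => [|x a] hx njxy; first by move: njxy; rewrite /joins hy.
case: z hz njyz => [|c z] hz njyz; first by move: njyz; rewrite /joins cats0 hy.
case: y hy sy njyz njxy => [|b y] hy sy njyz njxy; first by move: njxy; rewrite /joins cats0 hx.
rewrite unrcons_rcons; have hx' := alt_rcons_l hx; have hz' := alt_cons_r hz; have hy' := alt_cons_r hy.
case/lastP: y hy sy njyz njxy hy' => [|y b'] hy sy njyz njxy hy'.
  exact: (@assoc4_letter_ok).
rewrite unrcons_rcons.
have {}sy : (size y < n)%N by move: sy; rewrite -[size (_ :: _)]/(size (rcons y b')).+1 size_rcons.
have hy'' := alt_rcons_l hy'.
have hby : alternating (b :: y) by move: hy; rewrite -rcons_cons; exact: alt_rcons_l.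
(* The match in [assoc_rec] inspects the head of [rcons y b']. The equation [e] keeps its last
   letter at hand while the head is exposed, and excludes the empty word. *)
case: {-2}(rcons y b') (erefl (rcons y b')) => [|b1 y1] e; first by case: (y) e.
rewrite e; apply: (@assoc4_ok) => //; apply: ih => //.
- by rewrite size_rcons.
- exact: ltnW.
Qed.

Lemma free_assoc_ok x y z w : alternating x -> alternating y -> alternating z ->
  assoc_ok (free_assoc x y z w).
Proof. by move=> hx hy hz; apply: assoc_rec_ok. Qed.

Lemma free_assoc_bij x y z w : alternating x -> alternating y -> alternating z ->
  bijective (free_assoc x y z w).
Proof. by move=> hx hy hz; case: (@free_assoc_ok x y z w hx hy hz). Qed.
Lemma free_assoc_ev x y z w m : alternating x -> alternating y -> alternating z ->
  ocomp (spaceR_ev x y z w (free_assoc x y z w m)) (lamW w) = ocomp (spaceL_ev x y z w m) (lamW w).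
Proof. by move=> hx hy hz; case: (@free_assoc_ok x y z w hx hy hz). Qed.

(** * Depth and labels of evaluated brackets *)

Lemma theta_shiftn n k a b c f O :
  ocomp (shiftn n (theta a b (Some c) f)) (shiftn (n + k.+1) O) =
  ocomp (shiftn (n + k.+2) O) (shiftn n (theta a b (Some c) f)).
Proof. by rewrite !shiftnD -!shiftnM !shiftnS theta_shift. Qed.
Lemma theta_none_shiftn n k a b f O :
  ocomp (shiftn n (theta a b None f)) (shiftn (n + k) O) =
  ocomp (shiftn (n + k.+2) O) (shiftn n (theta a b None f)).
Proof. by rewrite !shiftnD -!shiftnM !shiftnS theta_none_shift. Qed.

Lemma size_rcons_cons x a b y : (size (rcons x a) + size (b :: y) = size x + (size y).+2)%N.
Proof. by rewrite size_rcons addSnnS. Qed.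
Lemma size_cat_cons x c y : (size (x ++ c :: y) = size x + (size y).+1)%N.
Proof. by rewrite size_cat. Qed.

(** Each generator of the bracket is handed over with its form and its evaluation, so that the
    arguments below compute with operators only. *)
Lemma tri_split_ind (W : lmodType K) x a b y z (F G : {linear tri (rcons x a) (b :: y) z -> W}) :
  ~~ joins (rcons x a) (b :: y) ->
  (forall c h f, z = x ++ c :: y -> Th (rcons x a) (b :: y) z h = shiftn (size x) (theta a b (Some c) f) ->
    h = linv (split (rcons x a) (b :: y) x a b y z) (linl (dinj c (guard_in _ f))) -> F h = G h) ->
  (forall h f g, Th (rcons x a) (b :: y) z h = ocomp (shiftn (size x) (theta a b None f)) (Th x y z g) ->
    h = linv (split (rcons x a) (b :: y) x a b y z) (linr (tpure f g)) -> F h = G h) ->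
  F =1 G.
Proof.
move=> nj h1 h2 h.
have sb := @split_bij K C D S T (rcons x a) (b :: y) x a b y z erefl erefl nj.
rewrite -[h](linvK sb); move: (split _ _ _ _ _ _ _ h) => {}h; move: h.
set V := linv _.
apply: (@prodm_ext _ _ _ _ (F \ol V) (G \ol V)).
  apply: (@dsum_ext _ _ _ _ (F \ol V \ol linl) (G \ol V \ol linl)) => c g.
  have [gc|/negP ngc] := pselect ((x ++ c :: y == z) = true); last by rewrite [g]guard0 // !linear0.
  rewrite -[g]guard_outK !lcompE; apply: (h1 c _ (guard_out _ g)) => //; first by apply/eqP; rewrite eq_sym.
  by rewrite (@tri_ev_split _ _ _ _ _ _ _ _ erefl erefl nj) linvVK // split_ev_linl guard_inK.
apply: (@tens_ext _ _ _ _ (F \ol V \ol linr) (G \ol V \ol linr)) => f g.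
rewrite !lcompE; apply: (h2 _ f g) => //.
by rewrite (@tri_ev_split _ _ _ _ _ _ _ _ erefl erefl nj) linvVK // split_ev_linr.
Qed.

(** An element of [[x y; z]] trades the [size z] outermost steps for [size x + size y] new ones and
    leaves the rest untouched. This is the interchange law behind the flip in composite (A). *)
Lemma tri_ev_shift x y z h O : alternating x -> alternating y ->
  ocomp (Th x y z h) (shiftn (size z) O) = ocomp (shiftn (size x + size y) O) (Th x y z h).
Proof.
elim: {x}(size x) {-2}x (erefl (size x)) y z h => [|n ih] x sx y z h hx hy.
  move: sx h; case: x hx => // hx _ h.
  rewrite tri_ev_join // ocompZl ocompZr ocomp1l ocomp1r.
  have [e|ne] := pselect (z = y); first by subst z.
  by rewrite (tri_join0 (x := [::]) h hy ne) [join_out _ _ _ _]linear0 !scale0r.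
have [jo|nj] := boolP (joins x y).
  rewrite tri_ev_join // ocompZl ocompZr ocomp1l ocomp1r.
  have [e|ne] := pselect (z = x ++ y); first by subst z; rewrite size_cat.
  by rewrite (tri_join0 h jo ne) [join_out _ _ _ _]linear0 !scale0r.
case/lastP: x hx sx nj h => [//|x a] hx sx nj.
case: y hy nj => [|b y] hy nj; first by move: nj; rewrite /joins cats0 hx.
apply: (@tri_split_ind _ _ _ _ _ _ (ocompr (shiftn (size z) O) \ol Th (rcons x a) (b :: y) z)
    (ocompl (shiftn (size (rcons x a) + size (b :: y)) O) \ol Th (rcons x a) (b :: y) z)) => // [c h f ez eh _|h f g eh _];
  rewrite !lcompE -[LHS]/(ocomp _ _) -[RHS]/(ocomp _ _) eh size_rcons_cons.
  by rewrite ez size_cat_cons theta_shiftn.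
have sx' : size x = n by move: sx; rewrite size_rcons => -[].
rewrite -ocompA ih //; [|exact: alt_rcons_l hx|exact: alt_cons_r hy].
by rewrite ocompA theta_none_shiftn -ocompA.
Qed.

Lemma lamW_idem x : ocomp (lamW x) (lamW x) = lamW x.
Proof.
elim: x => [|a x ih]; first by rewrite ocomp1l.
rewrite [lamW _]/(ocomp (lamL a) (shift (lamW x))) ocompA -[ocomp (ocomp _ _) (lamL a)]ocompA.
by rewrite -[ocomp (shift _) (lamL a)]lam_shift ocompA lam_idem -ocompA -shiftM ih.
Qed.
Lemma lamW_cons a x : lamW (a :: x) = ocomp (lamL a) (shift (lamW x)). Proof. by []. Qed.
Lemma lamW_ew w : oact (lamW w) w (ew w) = ew w.
Proof.
elim: w => [|a w ih] //; rewrite lamW_cons oact_comp -[ew (a :: w)]/(stepJ a w (ew w)).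
rewrite shift_stepJ ih; case: a => a.
- exact: (@lam_cons K C D S T (@Lb K C D S T true a) w None (Some a)).
- exact: (@lam_cons K C D S T (@Lb K C D S T false a) w None (Some a)).
Qed.

Lemma ocomp_lamW x O O' :
  ocomp (ocomp (lamW x) (shiftn (size x) O)) (ocomp (lamW x) (shiftn (size x) O')) =
  ocomp (lamW x) (shiftn (size x) (ocomp O O')).
Proof.
rewrite -ocompA [ocomp (shiftn _ _) (ocomp _ _)]ocompA shiftn_lamW -ocompA -shiftnM.
by rewrite ocompA lamW_idem.
Qed.

(* An element of [x y; z] only produces paths starting with the labels x, y. *)
Lemma lamW_tri_ev x y z h : alternating x -> alternating y ->
  ocomp (ocomp (lamW x) (shiftn (size x) (lamW y))) (ocomp (Th x y z h) (lamW z)) =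
  ocomp (Th x y z h) (lamW z).
Proof.
elim: {x}(size x) {-2}x (erefl (size x)) y z h => [|n ih] x sx y z h hx hy.
  move: sx h; case: x hx => // hx _ h.
  rewrite tri_ev_join // shiftn0 ocomp1l ocompZl ocomp1l ocompZr.
  have [e|ne] := pselect (z = y); first by subst z; rewrite lamW_idem.
  by rewrite (tri_join0 (x := [::]) h hy ne) [join_out _ _ _ _]linear0 !scale0r.
have [jo|nj] := boolP (joins x y).
  rewrite tri_ev_join // ocompZl ocomp1l ocompZr -lamW_cat.
  have [e|ne] := pselect (z = x ++ y); first by subst z; rewrite lamW_idem.
  by rewrite (tri_join0 h jo ne) [join_out _ _ _ _]linear0 !scale0r.
case/lastP: x hx sx nj h => [//|x a] hx sx nj.
case: y hy nj => [|b y] hy nj; first by move: nj; rewrite /joins cats0 hx.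
have E d (f : B a b d) : ocomp (lamL a) (ocomp (shift (lamL b)) (theta a b d f)) = theta a b d f.
  by rewrite shift_lam_theta lam_theta.
have P : ocomp (lamW (rcons x a)) (shiftn (size (rcons x a)) (lamW (b :: y))) =
   ocomp (lamW x) (shiftn (size x) (ocomp (lamL a) (ocomp (shift (lamL b)) (shift (shift (lamW y)))))).
  by rewrite -cats1 lamW_cat size_cat addn1 lamW_cons shift1 ocomp1r -ocompA shiftnSr -shiftnM lamW_cons shiftM.
apply: (@tri_split_ind _ _ _ _ _ _ (ocompl (ocomp (lamW (rcons x a)) (shiftn (size (rcons x a)) (lamW (b :: y)))) \ol ocompr (lamW z) \ol Th (rcons x a) (b :: y) z)
    (ocompr (lamW z) \ol Th (rcons x a) (b :: y) z)) => // [c h f ez eh _|h f g eh _];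
  rewrite !lcompE -[LHS]/(ocomp _ (ocomp _ _)) -[RHS]/(ocomp _ _) eh P.
  rewrite [ocomp (shiftn _ _) _](_ : _ = ocomp (lamW x) (shiftn (size x) (ocomp (theta a b (Some c) f) (lamW (c :: y))))).
    rewrite ocomp_lamW; congr (ocomp _ (shiftn _ _)); rewrite ocompA -[ocomp (ocomp _ _) (theta _ _ _ _)]ocompA.
    rewrite -[ocomp (ocomp _ _) (theta _ _ _ _)]ocompA -theta_shift [ocomp (shift (lamL b)) _]ocompA ocompA E -ocompA.
    by rewrite lamW_cons [ocomp (shift _) _]ocompA -[ocomp (shift _) (lamL c)]lam_shift -ocompA -shiftM lamW_idem.
  by rewrite ez lamW_cat ocompA shiftn_lamW -ocompA -shiftnM.
have sx' : size x = n by move: sx; rewrite size_rcons => -[].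
rewrite -[ocomp (ocomp (shiftn _ _) _) _]ocompA; set Q := ocomp (Th x y z g) _.
have IH : ocomp (ocomp (lamW x) (shiftn (size x) (lamW y))) Q = Q.
  by apply: ih => //; [exact: alt_rcons_l hx|exact: alt_cons_r hy].
rewrite ocompA -[ocomp (ocomp (lamW x) _) (shiftn _ _)]ocompA -shiftnM -[ocomp (ocomp _ _) (theta _ _ _ _)]ocompA.
rewrite -[ocomp (ocomp _ _) (theta _ _ _ _)]ocompA -theta_none_shift [ocomp (shift (lamL b)) _]ocompA ocompA E.
by rewrite shiftnM ocompA -shiftn_lamW -!ocompA [ocomp (lamW x) _]ocompA IH.
Qed.

(** * Reading labels off a path *)

Definition dinjw (V : seq letter -> lmodType K) q : {linear V q -> dsum (fun u : word => V (val u))} :=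
  match insub q : option word with
  | Some u => dinj u \ol transport V q (val u)
  | None => lzero
  end.
Lemma dinjwE V (u : word) v : dinjw V (val u) v = dinj u v.
Proof. by rewrite /dinjw valK lcompE transportE. Qed.

Definition oat w (t : pat w) : {linear op -> pat w} :=
  mklin (fun k O O' => oactP k O O' t).
Lemma oatE w t O : oat t O = oact O w t. Proof. by []. Qed.

Lemma oactZ k (O : op) w t : oact (k *: O) w t = k *: oact O w t.
Proof. by []. Qed.

(** What remains after the labels [x] are read off a path ending at [w]: the bracket that led to
    [w], and the path below. *)
Definition rd_tgt x w : lmodType K := dsum (fun q : word => tens (tri x (val q) w) (pat (val q))).

Lemma tri_joinZ x y z (m : tri x y z) : joins x y ->
  m = (join_out x y z m : K) *: join_in x y z (1 : K^o).
Proof.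
move=> h; rewrite {1}(join_outK m h) -linearZZ; congr (join_in _ _ _ _).
by rewrite [RHS]mulr1.
Qed.

Let rdJ a q : {linear pat q -> rd_tgt [:: a] (a :: q)} :=
  dinjw (fun q0 => tens (tri [:: a] q0 (a :: q)) (pat q0)) q
    \ol tpurer _ (join_in [:: a] q (a :: q) (1 : K^o)).
(** The letter bracket [f] as an element of the triangular space of [a] and [b y], obtained by
    inverting [split]. *)
Let fuse a b y d : {linear B a b d -> tri [:: a] (b :: y) (cat_opt d y)} :=
  match d return {linear B a b d -> tri [:: a] (b :: y) (cat_opt d y)} with
  | Some c => linv (split [:: a] (b :: y) [::] a b y (c :: y)) \ol linl \ol dinj c \ol guard_in _
  | None => linv (split [:: a] (b :: y) [::] a b y y) \ol linr \ol tpurel _ (join_in [::] y y (1 : K^o))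
  end.
Let rdS a b y d : {linear tens (B a b d) (pat (b :: y)) -> rd_tgt [:: a] (cat_opt d y)} :=
  dinjw (fun q0 => tens (tri [:: a] q0 (cat_opt d y)) (pat q0)) (b :: y) \ol tmap (fuse a b y d) lid.

(** Applied to a canonical path, an element of [[a q; w]] shows as a single last step, an addition,
    a fusion or a cancellation, over the canonical path of [q]; that step determines the element.
    The operator [O] is arbitrary so that reading can continue below. *)
Lemma read_letter a w : exists Rd : {linear pat w -> rd_tgt [:: a] w},
  forall (q : word) h O, Rd (oact (shift O) w (oact (Th [:: a] (val q) w h) w (ew w))) =
    dinj q (tpure h (oact O (val q) (ew (val q)))).
Proof.
have [rd [hJ hS]] := @read_key K C D S T EndC EndD (rd_tgt [:: a]) a (rdJ a) (rdS a).
exists (rd w) => q h O.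
have [jo|nj] := boolP (joins [:: a] (val q)).
  have [e|ne] := pselect (w = a :: val q); last first.
    rewrite (tri_join0 (x := [:: a]) h jo ne) tpure0l [dinj _ _]linear0 [Th _ _ _ _]linear0.
    by rewrite -[oact 0 w _]/(oat _ 0) !linear0.
  subst w; rewrite tri_ev_join //; move: (join_out _ _ _ h : K) (tri_joinZ h jo) => k ->.
  rewrite oactZ oact_id.
  rewrite [in LHS]linearZZ [in LHS]linearZZ -[ew (a :: _)]/(stepJ a (val q) (ew (val q))) shift_stepJ hJ; last first.
    by move: jo; rewrite /joins; case: (val q) => //= b y /andP[].
  rewrite /rdJ lcompE -[tpurer _ _ _]/(tpure _ _) (@dinjwE (fun q0 => tens (tri [:: a] q0 (a :: val q)) (pat q0))).
  by rewrite -[tpure (_ *: _) _]/(tpurel _ _ _) !linearZZ.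
rewrite -(@dinjwE (fun q0 => tens (tri [:: a] q0 w) (pat q0))).
move: (valP q) nj h O; case: (val q) => [//|b y] hy nj h O.
have gy : good a y.
  have ab : side a = side b by exact: (side_ab (x' := [::]) (y' := y) erefl erefl nj).
  by case: y hy {nj h} => //= c y /andP[bc _]; rewrite ab.
have bs z := @split_bij K C D S T [:: a] (b :: y) [::] a b y z erefl erefl nj.
set V := dinjw _ _.
apply: (@tri_split_ind _ [::] a b y w
   (rd w \ol oact (shift O) w \ol oat (ew w) \ol Th [:: a] (b :: y) w)
   (V \ol tpurel _ (oact O (b :: y) (ew (b :: y))))) => // [c {}h f e eh dh|{}h f g eh dh];
   rewrite !lcompE -[tpurel _ _ _]/(tpure _ _) eh oatE.
  rewrite -[[::] ++ c :: y]/(c :: y) in e; subst w.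
  rewrite shiftn0 -[ew (c :: y)]/(stepJ c y (ew y)) theta_stepJ.
  rewrite (shift_stepS (d := Some c)) (hS b y (Some c)) // /rdS lcompE tmapE dh /V.
  by rewrite /fuse 3!lcompE.
have jg : joins [::] y by exact: alt_cons_r hy.
have [e|ne] := pselect (w = y); last first.
  have g0 : g = 0 by apply: (tri_join0 (x := [::]) g) => //; exact: alt_cons_r hy.
  rewrite dh g0 tpure0r [linv _ _]linear0 tpure0l [Th [::] y w 0]linear0 ocomp0r.
  by rewrite -[oact 0 w _]/(oat _ 0) !linear0.
subst w; rewrite shiftn0 (@tri_ev_join _ _ _ _ jg) ocompZr ocomp1r.
rewrite oactZ theta_none_stepJ //.
rewrite [in LHS]linearZZ [in LHS]linearZZ (shift_stepS (d := None)) (hS b y None) // /rdS lcompE tmapE dh /V.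
rewrite /fuse 2!lcompE lidE -[tpurel _ _ _]/(tpure _ _).
move: (join_out _ _ _ g : K) (tri_joinZ g jg) => k ->.
rewrite -[tpure f (k *: _)]/(tpurer _ _ _) [tpurer _ _ _]linearZZ [linr _]linearZZ.
rewrite [linv _ _ in RHS]linearZZ -[tpure (k *: _) _]/(tpurel _ _ _) [tpurel _ _ _]linearZZ.
by rewrite [RHS]linearZZ.
Qed.

Section Snoc.
Variables (x : seq letter) (a : letter).
Hypothesis hx : alternating (x ++ [:: a]).
(** The isomorphism of [[xa q; w]] with [(+)_v [a q; v] (x) [x v; w]] given by the transformation
    for [x, a, q]. It reduces reading [x a] to reading [x] and then [a]. *)
Let unsnoc q w : {linear tri (x ++ [:: a]) q w -> spaceR x [:: a] q w} :=
  free_assoc x [:: a] q w \ol linv (join x [:: a] (fun u => tri u q w)).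
Let unsnoc_bij q w : alternating q -> bijective (unsnoc q w).
Proof.
move=> hq; apply: bij_lcomp; last by apply: linv_bij; exact: join_bij.
apply: (@free_assoc_bij) => //; exact: alt_catl hx.
Qed.
Let unsnoc_ev q w h : alternating q ->
  ocomp (spaceR_ev x [:: a] q w (unsnoc q w h)) (lamW w) = ocomp (Th (x ++ [:: a]) q w h) (lamW w).
Proof.
move=> hq; rewrite /unsnoc lcompE (@free_assoc_ev) //; last exact: alt_catl hx.
by rewrite spaceL_ev_join // linvVK //; exact: join_bij.
Qed.

Lemma read_snoc w :
  (exists Rd : {linear pat w -> rd_tgt x w}, forall (q : word) h O,
    Rd (oact (shiftn (size x) O) w (oact (Th x (val q) w h) w (ew w))) =
    dinj q (tpure h (oact O (val q) (ew (val q))))) ->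
  exists Rd : {linear pat w -> rd_tgt (x ++ [:: a]) w}, forall (q : word) h O,
    Rd (oact (shiftn (size (x ++ [:: a])) O) w (oact (Th (x ++ [:: a]) (val q) w h) w (ew w))) =
    dinj q (tpure h (oact O (val q) (ew (val q)))).
Proof.
case=> rd hrd; pose rl v := projT1 (cid (@read_letter a v)).
have hrl v := projT2 (cid (@read_letter a v)).
pose Rd : {linear rd_tgt x w -> rd_tgt (x ++ [:: a]) w} := dlift (fun v : word =>
  tdsumr (fun q : word => dinj q \ol
     tmap (linv (unsnoc (val q) w) \ol dinj v \ol tswap _ _) lid \ol tassocV _ _ _)
  \ol tmap lid (rl (val v))).
exists (Rd \ol rd) => q h O.
(* The projector fixes the canonical path, so it may be inserted here, where the invariance of
   evaluation under [unsnoc] needs it. *)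
rewrite -[X in oact (Th _ _ _ _) w X](lamW_ew w) -[oact (Th _ _ _ _) w (oact _ w _)]oact_comp -unsnoc_ev; last exact: valP.
rewrite oact_comp lamW_ew -[in RHS](linvK (@unsnoc_bij (val q) w (valP q)) h).
move: (unsnoc _ _ h); move=> m; move: m.
apply: (@dtens_ext _ _ _ _ _ (Rd \ol rd \ol oact (shiftn (size (x ++ [:: a])) O) w \ol oat (ew w) \ol spaceR_ev x [:: a] (val q) w)
  (dinj q \ol tpurel _ (oact O (val q) (ew (val q))) \ol linv (unsnoc (val q) w))) => v f g.
rewrite !lcompE /spaceR_ev fus_evE oatE oact_comp size_cat addn1 shiftnSr -oact_comp -shiftnM hrd.
rewrite /Rd dlift_inj lcompE tmapE lidE oact_comp hrl tdsumrE 2!lcompE.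
by rewrite tassocVE tmapE 2!lcompE tswapE.
Qed.
End Snoc.

Lemma read_word x w : alternating x -> exists Rd : {linear pat w -> rd_tgt x w},
  forall (q : word) h O, Rd (oact (shiftn (size x) O) w (oact (Th x (val q) w h) w (ew w))) =
    dinj q (tpure h (oact O (val q) (ew (val q)))).
Proof.
elim/last_ind: x => [|x a ih] hx; last first.
  rewrite -cats1 in hx *; apply: read_snoc => //; apply: ih; exact: alt_catl hx.
exists (dinjw (fun q0 => tens (tri [::] q0 w) (pat q0)) w \ol tpurer _ (join_in [::] w w (1 : K^o))) => q h O.
have jo : joins [::] (val q) by exact: valP.
have [e|ne] := pselect (w = val q); last first.
  rewrite (tri_join0 (x := [::]) h jo ne) tpure0l [dinj _ _]linear0 [Th _ _ _ _]linear0.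
  by rewrite -[oact 0 w _]/(oat _ 0) !linear0.
subst w; rewrite (@tri_ev_join _ _ _ _ jo) shiftn0.
move: (join_out _ _ _ h : K) (tri_joinZ h jo) => k ->.
rewrite oactZ oact_id lcompE -[tpurer _ _ _]/(tpure _ _) (@dinjwE (fun q0 => tens (tri [::] q0 (val q)) (pat q0))).
rewrite -[tpure (k *: _) _]/(tpurel _ _ _) [tpurel _ _ _]linearZZ [RHS]linearZZ.
by rewrite [oact O _ _]linearZZ -[tpure _ (k *: _)]/(tpurer _ _ _) [tpurer _ _ _]linearZZ [LHS]linearZZ.
Qed.

(** Reading all of [v] off its canonical path leaves the empty path with coefficient 1; thus [ew] of
    a word is nonzero. *)
Lemma ew_functional (v : word) : exists eps : {linear pat (val v) -> K^o}, eps (ew (val v)) = 1.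
Proof.
have [Rd hRd] := @read_word (val v) (val v) (valP v).
pose e0 : forall w, {linear pat w -> K^o} := @telim K C D S T (fun=> K^o) 1 (fun l y o o' => lzero).
pose n0 : word := Sub [::] (erefl true).
exists (dlift (fun q : word => tunitl _ \ol tmap (join_out (val v) (val q) (val v)) (e0 (val q))) \ol Rd).
have j0 : joins (val v) (val n0) by rewrite /joins cats0; exact: valP.
have := hRd n0 (join_in _ _ _ (1 : K^o)) oid.
rewrite shiftn_id !oact_id (@tri_ev_join _ _ _ _ j0) join_inK ?cats0 // scale1r oact_id.
move=> e; rewrite lcompE e dlift_inj lcompE tmapE join_inK ?cats0 // tunitlE scale1r.
exact: telim_Om.
Qed.

(** * Injectivity of the evaluation of the target *)

Section Target.
Variables s t u v w : word.
Definition pent_target_ev : {linear @pent_target K C D S T s t u v w -> op} :=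
  dlift (fun i : word * word =>
    omul (shiftn (size (val s) + size (val t)) \ol Th (val u) (val v) (val i.1))
      (omul (shiftn (size (val s)) \ol Th (val t) (val i.1) (val i.2)) (Th (val s) (val i.2) (val w)))).

(** For the innermost bracket, reading [u] leaves the canonical path of [v], which [eps] turns into
    the scalar 1. *)
Lemma read_last r : exists Rd : {linear pat r -> tri (val u) (val v) r},
  forall h, Rd (oact (Th (val u) (val v) r h) r (ew r)) = h.
Proof.
have [rd hrd] := @read_word (val u) r (valP u).
have [eps heps] := ew_functional v.
pose pr : {linear rd_tgt (val u) r -> tens (tri (val u) (val v) r) (pat (val v))} :=
  dlift (fun q : word => transport (fun q => tens (tri (val u) q r) (pat q)) (val q) (val v)).
exists (tunitr _ \ol tmap lid eps \ol pr \ol rd) => h.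
have := hrd v h oid; rewrite shiftn_id !oact_id => e.
by rewrite 3!lcompE e /pr dlift_inj transportE tmapE tunitrE heps scale1r.
Qed.

(** Reading [s], [t] and [u] in turn yields the brackets of [[s q; w]], [[t r; q]] and [[u v; r]],
    the operators of the inner ones serving as [O] in [read_word]. This gives a left inverse of
    evaluation at the canonical path, where the projector is invisible. *)
Lemma pent_target_ev_inj m m' :
  ocomp (pent_target_ev m) (lamW (val w)) = ocomp (pent_target_ev m') (lamW (val w)) -> m = m'.
Proof.
have [rs hs] := @read_word (val s) (val w) (valP s).
pose rt q := projT1 (cid (@read_word (val t) q (valP t))).
have ht q := projT2 (cid (@read_word (val t) q (valP t))).
pose ru r := projT1 (cid (read_last r)).
have hu r := projT2 (cid (read_last r)).
pose Rd : {linear rd_tgt (val s) (val w) -> pent_target s t u v w} := dlift (fun q : word =>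
  tdsumr (fun r : word => dinj (r, q) \ol tassoc _ _ _ \ol tmap (tswap _ _) lid \ol tswap _ _
     \ol tmap lid (tmap lid (ru (val r)))) \ol tmap lid (rt (val q))).
have RdK n : Rd (rs (oact (pent_target_ev n) (val w) (ew (val w)))) = n.
  move: n; apply: (@dsum_ext _ _ _ _ (Rd \ol rs \ol oat (ew (val w)) \ol pent_target_ev) lid) => -[r q].
  apply: (@tens3_ext _ _ _ _ _ (Rd \ol rs \ol oat (ew (val w)) \ol pent_target_ev \ol dinj (r, q)) (dinj (r, q))) => k k' l.
  rewrite 4!lcompE oatE /pent_target_ev dlift_inj !omulE 2!lcompE.
  rewrite [shiftn (_ + _)  _]shiftnD ocompA -shiftnM oact_comp hs /Rd dlift_inj lcompE tmapE lidE oact_comp ht.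
  by rewrite tdsumrE 4!lcompE 2!tmapE hu !lidE tswapE tmapE tswapE tassocE.
move=> e; rewrite -(RdK m) -(RdK m'); congr (Rd (rs _)).
by rewrite -(lamW_ew (val w)) -!oact_comp e.
Qed.
End Target.

Lemma dmap_tmapr_ev (I : choiceType) (U M N : I -> lmodType K) (eU : forall i, {linear U i -> op})
    (eM : forall i, {linear M i -> op}) (eN : forall i, {linear N i -> op})
    (f : forall i, {linear M i -> N i}) (l : op) m :
  (forall i m, ocomp (eN i (f i m)) l = ocomp (eM i m) l) ->
  ocomp (dlift (fun i => omul (eU i) (eN i)) (dmap (fun i => tmap lid (f i)) m)) l =
  ocomp (dlift (fun i => omul (eU i) (eM i)) m) l.
Proof.
move=> h; move: m; apply: (@dtens_ext _ _ _ _ _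
  (ocompr l \ol dlift (fun i => omul (eU i) (eN i)) \ol dmap (fun i => tmap lid (f i)))
  (ocompr l \ol dlift (fun i => omul (eU i) (eM i)))) => i u m.
rewrite !lcompE dmap_inj !dlift_inj tmapE !omulE lidE -[LHS]/(ocomp (ocomp _ _) _) -[RHS]/(ocomp (ocomp _ _) _).
by rewrite -!ocompA h.
Qed.
(** Unlike in [dmap_tmapr_ev], a further operator [eU i u] stands between the transformed factor and
    [l]; invariance is therefore required after that operator. *)
Lemma dmap_tmapl_ev (I : choiceType) (U M N : I -> lmodType K) (eU : forall i, {linear U i -> op})
    (eM : forall i, {linear M i -> op}) (eN : forall i, {linear N i -> op})
    (f : forall i, {linear M i -> N i}) (l : op) m :
  (forall i m u, ocomp (eN i (f i m)) (ocomp (eU i u) l) = ocomp (eM i m) (ocomp (eU i u) l)) ->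
  ocomp (dlift (fun i => omul (eN i) (eU i)) (dmap (fun i => tmap (f i) lid) m)) l =
  ocomp (dlift (fun i => omul (eM i) (eU i)) m) l.
Proof.
move=> h; move: m; apply: (@dtens_ext _ _ _ _ _
  (ocompr l \ol dlift (fun i => omul (eN i) (eU i)) \ol dmap (fun i => tmap (f i) lid))
  (ocompr l \ol dlift (fun i => omul (eM i) (eU i)))) => i m u.
rewrite !lcompE dmap_inj !dlift_inj tmapE !omulE lidE -[LHS]/(ocomp (ocomp _ _) _) -[RHS]/(ocomp (ocomp _ _) _).
by rewrite -!ocompA h.
Qed.

Lemma dlift_omulE (I : choiceType) (U V : I -> lmodType K) (eU : forall i, {linear U i -> op})
    (eV : forall i, {linear V i -> op}) i (f : U i) (g : V i) :
  dlift (fun i => omul (eU i) (eV i)) (dinj i (tpure f g)) = ocomp (eU i f) (eV i g).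
Proof. by rewrite dlift_inj omulE. Qed.
Lemma dsum2_extr (I J : choiceType) (U : I -> lmodType K) (V W : I -> J -> lmodType K) (X : lmodType K)
    (F G : {linear dsum (fun i => tens (U i) (dsum (fun j => tens (V i j) (W i j)))) -> X}) :
  (forall i f j k l, F (dinj i (tpure f (dinj j (tpure k l)))) = G (dinj i (tpure f (dinj j (tpure k l))))) ->
  F =1 G.
Proof.
move=> h; apply: dtens_ext => i f m; move: m.
by apply: (@dtens_ext _ _ _ _ _ (F \ol dinj i \ol tpurer _ f) (G \ol dinj i \ol tpurer _ f)) => j k l; exact: h.
Qed.
Lemma dsum2_extl (I J : choiceType) (U : I -> lmodType K) (V W : I -> J -> lmodType K) (X : lmodType K)
    (F G : {linear dsum (fun i => tens (dsum (fun j => tens (V i j) (W i j))) (U i)) -> X}) :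
  (forall i f j k l, F (dinj i (tpure (dinj j (tpure k l)) f)) = G (dinj i (tpure (dinj j (tpure k l)) f))) ->
  F =1 G.
Proof.
move=> h; apply: dtens_ext => i m f; move: m.
by apply: (@dtens_ext _ _ _ _ _ (F \ol dinj i \ol tpurel _ f) (G \ol dinj i \ol tpurel _ f)) => j k l; exact: h.
Qed.
Lemma dsum2_ext (I : choiceType) (U V W : I -> lmodType K) (X : lmodType K)
    (F G : {linear dsum (fun i => tens (U i) (tens (V i) (W i))) -> X}) :
  (forall i f k l, F (dinj i (tpure f (tpure k l))) = G (dinj i (tpure f (tpure k l)))) ->
  F =1 G.
Proof.
move=> h; apply: dsum_ext => i.
by apply: (@tens3_ext _ _ _ _ _ (F \ol dinj i) (G \ol dinj i)) => f k l; exact: h.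
Qed.

Lemma spaceL_evE x y z w (u : word) f m : spaceL_ev x y z w (dinj u (tpure f m)) =
  ocomp (Th x y (val u) f) (Th (val u) z w m).
Proof. by rewrite /spaceL_ev fus_evE shiftn0. Qed.
Lemma spaceR_evE x y z w (u : word) f m : spaceR_ev x y z w (dinj u (tpure f m)) =
  ocomp (shiftn (size x) (Th y z (val u) f)) (Th x (val u) w m).
Proof. by rewrite /spaceR_ev fus_evE. Qed.

(** * The two composites of the pentagon *)

Variables s t u v w : word.
Let alt (x : word) : alternating (val x). Proof. exact: valP. Qed.

Definition pent_source_ev : {linear @pent_source K C D S T s t u v w -> op} :=
  dlift (fun i : word * word => omul (Th (val s) (val t) (val i.1))
    (omul (Th (val i.1) (val u) (val i.2)) (Th (val i.2) (val v) (val w)))).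

Local Notation tev := (@pent_target_ev s t u v w).

Lemma pent_target_evE r q k k' l : tev (dinj (r, q) (tpure k (tpure k' l))) =
  ocomp (shiftn (size (val s) + size (val t)) (Th (val u) (val v) (val r) k))
    (ocomp (shiftn (size (val s)) (Th (val t) (val r) (val q) k')) (Th (val s) (val q) (val w) l)).
Proof. by rewrite /pent_target_ev dlift_inj !omulE !lcompE. Qed.
Lemma pent_source_evE p q f g h : pent_source_ev (dinj (p, q) (tpure f (tpure g h))) =
  ocomp (Th (val s) (val t) (val p) f) (ocomp (Th (val p) (val u) (val q) g) (Th (val q) (val v) (val w) h)).
Proof. by rewrite /pent_source_ev dlift_inj !omulE. Qed.

Let A5 := unnest_r (fun r : word => tri (val u) (val v) (val r)) (fun r q : word => tri (val t) (val r) (val q))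
  (fun r q : word => tri (val s) (val q) (val w)).
Let A3 := nest_flip (fun p : word => tri (val s) (val t) (val p)) (fun r : word => tri (val u) (val v) (val r))
  (fun p r : word => tri (val p) (val r) (val w)).
Let A1 := nest_r (fun p : word => tri (val s) (val t) (val p)) (fun p q : word => tri (val p) (val u) (val q))
  (fun p q : word => tri (val q) (val v) (val w)).
Let pathAE m : pathA s t u v w m =
  A5 (dmap (fun r : word => tmap lid (free_assoc (val s) (val t) (val r) (val w)))
    (A3 (dmap (fun p : word => tmap lid (free_assoc (val p) (val u) (val v) (val w))) (A1 m)))).
Proof. by []. Qed.

Lemma pathA_ev m : ocomp (tev (pathA s t u v w m)) (lamW (val w)) = ocomp (pent_source_ev m) (lamW (val w)).
Proof.
pose eU1 (p : word) := Th (val s) (val t) (val p).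
pose eU3 (r : word) := shiftn (size (val s) + size (val t)) \ol Th (val u) (val v) (val r).
pose e1 (p : word) := spaceL_ev (val p) (val u) (val v) (val w).
pose e2 (p : word) := spaceR_ev (val p) (val u) (val v) (val w).
pose e3 (r : word) := spaceL_ev (val s) (val t) (val r) (val w).
pose e4 (r : word) := spaceR_ev (val s) (val t) (val r) (val w).
have h5 n : tev (A5 n) = dlift (fun r => omul (eU3 r) (e4 r)) n.
  move: n; apply: (@dsum2_extr _ _ _ _ _ _ (tev \ol A5)) => r k q k' l.
  by rewrite lcompE [A5 _]unnest_rE pent_target_evE [RHS]dlift_omulE /e4 spaceR_evE /eU3 lcompE.
have h3 n : dlift (fun r => omul (eU3 r) (e3 r)) (A3 n) = dlift (fun p => omul (eU1 p) (e2 p)) n.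
  move: n; apply: (@dsum2_extr _ _ _ _ _ _ (dlift _ \ol A3)) => p f r k l.
  rewrite lcompE [A3 _]nest_flipE [LHS]dlift_omulE [RHS]dlift_omulE /e3 /e2 spaceL_evE spaceR_evE /eU3 lcompE.
  (* The brackets of [s, t] and of [u, v] act at different depths and hence commute. *)
  by rewrite !ocompA tri_ev_shift.
have h1 n : dlift (fun p => omul (eU1 p) (e1 p)) (A1 n) = pent_source_ev n.
  move: n; apply: (@dsum2_ext _ _ _ _ _ (dlift _ \ol A1)) => -[p q] f g h.
  by rewrite lcompE [A1 _]nest_rE pent_source_evE [LHS]dlift_omulE /e1 spaceL_evE.
rewrite pathAE h5 (@dmap_tmapr_ev _ _ _ _ eU3 e3 e4); last first.
  by move=> r n; apply: (@free_assoc_ev).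
rewrite h3 (@dmap_tmapr_ev _ _ _ _ eU1 e1 e2) ?h1 //.
by move=> r n; apply: (@free_assoc_ev).
Qed.

Let B7 := unnest_l (fun r : word => tri (val u) (val v) (val r)) (fun q : word => tri (val s) (val q) (val w))
  (fun r q : word => tri (val t) (val r) (val q)).
Let B5 := nest_rl (fun p : word => tri (val t) (val u) (val p)) (fun q : word => tri (val s) (val q) (val w))
  (fun p q : word => tri (val p) (val v) (val q)).
Let B3 := nest_lr (fun p : word => tri (val t) (val u) (val p)) (fun q : word => tri (val q) (val v) (val w))
  (fun p q : word => tri (val s) (val p) (val q)).
Let B1 := nest_l (fun p : word => tri (val s) (val t) (val p)) (fun q : word => tri (val q) (val v) (val w))
  (fun p q : word => tri (val p) (val u) (val q)).
Let pathBE m : pathB s t u v w m =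
  B7 (dmap (fun q : word => tmap (free_assoc (val t) (val u) (val v) (val q)) lid)
    (B5 (dmap (fun p : word => tmap lid (free_assoc (val s) (val p) (val v) (val w)))
      (B3 (dmap (fun q : word => tmap (free_assoc (val s) (val t) (val u) (val q)) lid) (B1 m)))))).
Proof. by []. Qed.

Lemma pathB_ev m : ocomp (tev (pathB s t u v w m)) (lamW (val w)) = ocomp (pent_source_ev m) (lamW (val w)).
Proof.
pose eU1 (q : word) := Th (val q) (val v) (val w).
pose eU3 (p : word) := shiftn (size (val s)) \ol Th (val t) (val u) (val p).
pose eU5 (q : word) := Th (val s) (val q) (val w).
pose e1 (q : word) := spaceL_ev (val s) (val t) (val u) (val q).
pose e2 (q : word) := spaceR_ev (val s) (val t) (val u) (val q).
pose e3 (p : word) := spaceL_ev (val s) (val p) (val v) (val w).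
pose e4 (p : word) := spaceR_ev (val s) (val p) (val v) (val w).
pose e5 (q : word) := shiftn (size (val s)) \ol spaceL_ev (val t) (val u) (val v) (val q).
pose e6 (q : word) := shiftn (size (val s)) \ol spaceR_ev (val t) (val u) (val v) (val q).
have h7 n : tev (B7 n) = dlift (fun q => omul (e6 q) (eU5 q)) n.
  move: n; apply: (@dsum2_extl _ _ _ _ _ _ (tev \ol B7)) => q l r k k'.
  by rewrite lcompE [B7 _]unnest_lE pent_target_evE [RHS]dlift_omulE /e6 lcompE spaceR_evE shiftnM ocompA shiftnD.
have h5 n : dlift (fun q => omul (e5 q) (eU5 q)) (B5 n) = dlift (fun p => omul (eU3 p) (e4 p)) n.
  move: n; apply: (@dsum2_extr _ _ _ _ _ _ (dlift _ \ol B5)) => p k q k' l.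
  by rewrite lcompE [B5 _]nest_rlE [LHS]dlift_omulE [RHS]dlift_omulE /e5 /e4 /eU3 2!lcompE spaceR_evE spaceL_evE shiftnM ocompA.
have h3 n : dlift (fun p => omul (eU3 p) (e3 p)) (B3 n) = dlift (fun q => omul (e2 q) (eU1 q)) n.
  move: n; apply: (@dsum2_extl _ _ _ _ _ _ (dlift _ \ol B3)) => q h p k l.
  by rewrite lcompE [B3 _]nest_lrE [LHS]dlift_omulE [RHS]dlift_omulE /e3 /e2 /eU3 lcompE spaceR_evE spaceL_evE ocompA.
have h1 n : dlift (fun q => omul (e1 q) (eU1 q)) (B1 n) = pent_source_ev n.
  move: n; apply: (@dsum2_ext _ _ _ _ _ (dlift _ \ol B1)) => -[p q] f g h.
  by rewrite lcompE [B1 _]nest_lE pent_source_evE [LHS]dlift_omulE /e1 spaceL_evE ocompA.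
rewrite pathBE h7 (@dmap_tmapl_ev _ _ _ _ eU5 e5 e6); last first.
  (* The bracket [[s q; w]] acts first and produces paths labelled by [s q], so the projector on [q]
     may be inserted at depth [size s]. *)
  move=> q n h; rewrite -lamW_tri_ev // /e5 /e6 2!lcompE -shiftn_lamW !ocompA -!shiftnM.
  by rewrite (@free_assoc_ev).
rewrite h5 (@dmap_tmapr_ev _ _ _ _ eU3 e3 e4); last first.
  by move=> r n; apply: (@free_assoc_ev).
rewrite h3 (@dmap_tmapl_ev _ _ _ _ eU1 e1 e2) ?h1 //.
(* Likewise [[q v; w]] produces paths labelled by [q v], which supplies the projector on [q]. *)
move=> q n h; rewrite -lamW_tri_ev // !ocompA.
by rewrite (@free_assoc_ev).
Qed.

Lemma pentagon : pathA s t u v w =1 pathB s t u v w.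
Proof.
by move=> m; apply: (@pent_target_ev_inj); rewrite pathA_ev pathB_ev.
Qed.
End FreeProduct.

Theorem mainTheorem1 (R : realType) (C D : tensorCategory R[i])
    (semisimple_C : semisimple C) (semisimple_D : semisimple D)
    (S : spectrum C) (T : spectrum D) (s t u v w : word S T) :
  pathA s t u v w =1 pathB s t u v w.
Proof.
exact: (@pentagon _ C D S T semisimple_C semisimple_D
  (@closed_End_simple (R[i] : closedFieldType) C semisimple_C)
  (@closed_End_simple (R[i] : closedFieldType) D semisimple_D)).
Qed.
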